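(* Let $\mathsf{Sp}$ be either the category of $C^\infty$-manifolds or the category of complex manifolds. There exists a natural construction which assigns to every Satake orbifold $X$ (a Hausdorff topological space with an orbifold atlas, possibly non-effective) an $\mathsf{Sp}$-orbifold $[X]$, such that every orbifold chart $(V,H,\pi)$ of (the atlas of) $X$ gives an open embedding of $\mathsf{Sp}$-orbifolds $$\hat\pi:[H\backslash V]\to[X]$$ (lifting the open embedding of spaces $H\backslash V\to X$ induced by $\pi$). In particular, the coarse space of the orbifold $[X]$ is homeomorphic to the underlying space of $X$.
   Context: Orbifolds. An $\mathsf{Sp}$-groupoid is a groupoid object $X_\bullet=(X_0,X_1)$ in $\mathsf{Sp}$ whose source and target maps $s,t:X_1\to X_0$ are étale (local isomorphisms) and for which $(s,t):X_1\to X_0\times X_0$ is proper. An $\mathsf{Sp}$-stack is a stack of groupoids on $\mathsf{Sp}$ for the topology of open covers. An $\mathsf{Sp}$-orbifold is an $\mathsf{Sp}$-stack equivalent to the stack $[X_\bullet]$ associated to the functor $M\mapsto(\mathrm{Hom}(M,X_0),\mathrm{Hom}(M,X_1))$ for some $\mathsf{Sp}$-groupoid $X_\bullet$; $X_\bullet$ is then a presentation. For a finite group $H$ acting on $V\in\mathsf{Sp}$, $[H\backslash V]$ is the orbifold presented by $H\times V\rightrightarrows V$. An orbifold is representable if all its fiber groupoids have trivial automorphism groups; a morphism $\mathcal X\to\mathcal Y$ is representable if its base changes along morphisms from objects of $\mathsf{Sp}$ (when they exist) are representable; a representable morphism is an open embedding if its base change along $Y_0\to\mathcal Y$, for a presentation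 $Y_\bullet$ of $\mathcal Y$, is an open embedding. The coarse space $|\mathcal X|$ is the set of isomorphism classes of objects of $\mathcal X(\mathrm{point})$ with the quotient topology from $X_0$. Charts. An abstract orbifold chart is a pair $(V,H)$, $V\in\mathsf{Sp}$, $H$ a finite group acting on $V$ (not necessarily effectively). A morphism $(V,H)\to(V',H')$ is a pair $(f_V,f_H)$ with $f_H:H\to H'$ a homomorphism and $f_V:V\to V'$ an $f_H$-equivariant morphism, such that the induced map $[H\backslash V]\to[H'\backslash V']$ is an open embedding. An orbifold chart of a Hausdorff space $X$ is a triple $(V,H,\pi)$ with $(V,H)$ an abstract orbifold chart and $\pi:V\to X$ a continuous map identifying $V/H$ with an open subset of $X$; morphisms $(V,H,\pi)\to(V',H',\pi')$ are morphisms of abstract charts with $\pi=\pi'\circ f_V$. They form a category $\mathtt{Charts}/X$. Any $h\in H$ defines an inner automorphism of $(V,H,\pi)$: $h_V(x)=h(x)$, $h_H(g)=hgh^{-1}$. Atlases. A chart category is a category $A$ in which all endomorphisms are invertible and each $\mathrm{Hom}_A(a,b)$ is a (possibly empty) $\mathrm{Aut}(b)$-torsor. An orbifold atlas of $X$ consists of a chart category $A$, a functor $c:A\to\mathtt{Charts}/X$, $c(a)=(V(a),H(a),\pi(a))$, and isomorphisms $\iota:\mathrm{Aut}(a)\to H(a)$ compatible with the actions on $V(a)$, such that $\phi\in\mathrm{Aut}(a)$ induces the inner automorphism of $c(a)$ given by $\iota(\phi)$; it is required that (i) the images of the charts $c(a)$ cover $X$; (ii) for any $x\in X$ in the images of $c(a')$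 and $c(a'')$ there exist $a\in A$ and arrows $a\to a'$, $a\to a''$ such that $x$ is in the image of $c(a)$. A morphism of atlases $(A,c)\to(A',c')$ is a fully faithful functor $f:A\to A'$ with an isomorphism of functors $c\simeq c'\circ f$; two atlases are equivalent if connected by a sequence of morphisms. A Satake orbifold is a Hausdorff space with an orbifold atlas (up to equivalence).
   Formalization: The isomorphisms ι:Aut(a)→H(a) of an atlas are also required to be natural in a: for f:a→b, if k'f=fk then ι(k')=f_H(ι(k)). Without this, non-effective atlases exist for which no [X] exists. Manifolds need not be second countable or of pure dimension. *)

(* Defs.v *)
From HB Require Import structures.
From Stdlib Require Import Relation_Operators.
From mathcomp Require Import all_boot all_order all_algebra all_fingroup complex.
From mathcomp Require Import all_classical all_reals all_analysis.
Set Implicit Arguments.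
Unset Strict Implicit.
Unset Printing Implicit Defensive.
Import Order.TTheory GRing.Theory Num.Theory numFieldNormedType.Exports.
Local Open Scope classical_set_scope.
Local Open Scope ring_scope.

(* C^k in the Frechet sense, the derivative being taken along each fixed v. *)
Fixpoint is_Ck (K : numFieldType) (V W : normedModType K) (k : nat)
    (U : set V) (f : V -> W) : Prop :=
  if k is k'.+1 then
    (forall x, U x -> differentiable f x) /\
    (forall v, is_Ck k' U (fun x => 'd f x v))
  else forall x, U x -> {for x, continuous f}.

Section Ck.
Context {K : numFieldType}.
Implicit Types V W : normedModType K.

Lemma near_eq_diff V W (f g : V -> W) (x : V) :
  (\forall y \near x, f y = g y) -> differentiable f x ->
  differentiable g x /\ 'd g x = 'd f x :> (V -> W).
Proof.
move=> fg df.
have gE : g \o shift x = cst (g x) + 'd f x +o_ 0 id.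
  apply/eqaddoP => _/posnumP[e].
  have /eqaddoP/(_ e%:num (gt0 e)) := diff_locally df.
  have fgx : f x = g x by exact: (nbhs_singleton fg).
  have : \forall z \near (0 : V), f (z + x) = g (z + x).
    have h : (fun z : V => z + x) @ 0 --> x.
      rewrite -[X in _ --> X]add0r; apply: cvgD; [exact: cvg_id|exact: cvg_cst].
    exact: (h _ fg).
  move=> h1 h2; near=> z.
  have : f (z + x) = g (z + x) by near: z.
  rewrite !fctE /= -fgx => <-; by near: z.
have dgE : 'd g x = 'd f x :> (V -> W).
  by apply: diff_unique gE; exact: (diff_continuous df).
split=> //; apply/diff_locallyP; rewrite dgE; split=> //.
exact: (diff_continuous df).
Unshelve. all: by end_near. Qed.

Lemma is_Ck_ext V W k (U : set V) (f g : V -> W) : open U ->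
  (forall x, U x -> f x = g x) -> is_Ck k U f -> is_Ck k U g.
Proof.
move=> oU; elim: k f g => [|k IH] f g fg.
  move=> /= cf x Ux; rewrite /prop_for /continuous_at -(fg _ Ux).
  apply: cvg_trans (cf _ Ux); apply: near_eq_cvg.
  by apply: filterS (open_nbhs_nbhs (conj oU Ux)) => y /fg.
move=> /= [df Df].
have h x : U x -> differentiable g x /\ 'd g x = 'd f x :> (V -> W).
  move=> Ux; apply: near_eq_diff; last exact: df.
  by apply: filterS (open_nbhs_nbhs (conj oU Ux)) => y /fg.
split=> [x /h[]//|v]; apply: IH (Df v) => x /h[_ ->] //.
Qed.

Lemma is_CkS V W k (U : set V) (f : V -> W) : is_Ck k.+1 U f -> is_Ck k U f.
Proof.
elim: k f => [|k IH] f /= [df Df].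
  by move=> x /df /differentiable_continuous.
by split=> // v; apply: IH; exact: (Df v).
Qed.

Lemma is_Ck_sub V W k (U U' : set V) (f : V -> W) :
  U' `<=` U -> is_Ck k U f -> is_Ck k U' f.
Proof.
move=> sU; elim: k f => [|k IH] f /=; first by move=> cf x /sU /cf.
by move=> [df Df]; split=> [x /sU/df//|v]; exact: IH.
Qed.

Lemma is_Ck_cst V W k (U : set V) (w : W) : is_Ck k U (fun=> w : W).
Proof.
elim: k w => [|k IH] w /=; first by move=> x _; exact: cvg_cst.
split=> [x _|v]; first exact: differentiable_cst.
rewrite (_ : (fun x => _) = fun=> 0 : W) //.
by apply/funext => x; rewrite (diff_cst w x).
Qed.

Lemma is_Ck_id V k (U : set V) : is_Ck k U (@id V).
Proof.
case: k => [|k] /=; first by move=> x _; exact: cvg_id.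
split=> [x _|v]; first by case: (is_diff_id x).
rewrite (_ : (fun x => _) = fun=> v); first exact: is_Ck_cst.
by apply/funext => x; rewrite diff_val.
Qed.

Lemma is_Ck_add V W k (U : set V) (f g : V -> W) : open U ->
  is_Ck k U f -> is_Ck k U g -> is_Ck k U (fun x => f x + g x).
Proof.
move=> oU; elim: k f g => [|k IH] f g /=.
  by move=> cf cg x Ux; apply: cvgD; [exact: cf|exact: cg].
move=> [df Df] [dg Dg]; split=> [x Ux|v].
  by apply: differentiableD; [exact: df|exact: dg].
apply: (is_Ck_ext oU _ (IH _ _ (Df v) (Dg v))) => x Ux.
by rewrite (diffD (df _ Ux) (dg _ Ux)).
Qed.

Lemma scale_diff V W (u : V -> K) (w : V -> W) x :
  differentiable (u : V -> K^o) x -> differentiable w x ->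
  differentiable (fun y => u y *: w y) x /\
  'd (fun y => u y *: w y) x =
    (fun v => u x *: 'd w x v + 'd (u : V -> K^o) x v *: w x) :> (V -> W).
Proof.
move=> du dw.
have bil : bilinear_for (GRing.Scale.Law.clone _ _ *:%R _)
    (GRing.Scale.Law.clone _ _ *:%R _) (fun (a : K^o) (y : W) => a *: y).
  split=> [y a b c|b a y z] /=; first by rewrite scalerDl scalerA.
  by rewrite scalerDr !scalerA mulrC.
pose bM := @bilinear_isBilinear.Build K K^o W W _ _ _ bil.
pose B : {bilinear K^o -> W -> W} := HB.pack (fun (a : K^o) (y : W) => a *: y) bM.
have cB : continuous (fun p : K^o * W => B p.1 p.2).
  by move=> p; exact: scale_continuous.
have dB p := differentiable_bilin p cB.
have DB p := diff_bilin p cB.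
pose P := (fun y => (u y : K^o, w y)).
have dP : differentiable P x by exact: differentiable_pair.
have -> : (fun y => u y *: w y) = (fun p : K^o * W => B p.1 p.2) \o P by [].
split; first by apply: differentiable_comp.
by rewrite diff_comp // DB diff_pair.
Qed.

Lemma is_Ck_scale V W k (U : set V) (u : V -> K) (w : V -> W) : open U ->
  is_Ck k U (u : V -> K^o) -> is_Ck k U w -> is_Ck k U (fun x => u x *: w x).
Proof.
move=> oU; elim: k u w => [|k IH] u w Cu Cw.
  move=> x Ux; apply: (@cvgZ _ _ _ _ _ u w); [exact: Cu|exact: Cw].
have [[du Du] [dw Dw]] := (Cu, Cw); split=> [x Ux|v].
  by have [] := scale_diff (du _ Ux) (dw _ Ux).
apply: (is_Ck_ext oU _ (is_Ck_add oU (IH _ _ (is_CkS Cu) (Dw v))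
    (IH _ _ (Du v) (is_CkS Cw)))) => x Ux /=.
by have [_ ->] := scale_diff (du _ Ux) (dw _ Ux).
Qed.

Lemma is_Ck_sum V W k (U : set V) n (f : 'I_n -> V -> W) : open U ->
  (forall i, is_Ck k U (f i)) -> is_Ck k U (fun x => \sum_i f i x).
Proof.
move=> oU; elim: n f => [|n IH] f Cf.
  by under eq_fun do rewrite big_ord0; exact: is_Ck_cst.
under eq_fun do rewrite big_ord_recr /=.
by apply: is_Ck_add => //; exact: IH.
Qed.

Lemma is_Ck_coord V m k (U : set V) (f : V -> 'rV[K]_m) i : open U ->
  is_Ck k U f -> is_Ck k U (fun x => f x 0 i : K^o).
Proof.
move=> oU; elim: k f => [|k IH] f /= Cf.
  move=> x Ux; apply: (@continuous_comp _ _ _ f (fun N : 'rV[K]_m => N 0 i)).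
    exact: Cf.
  exact: coord_continuous.
have [df Df] := Cf.
have h x : U x -> differentiable (fun x => f x 0 i : K^o) x /\
    'd (fun x => f x 0 i : K^o) x = (fun v => 'd f x v 0 i) :> (V -> K^o).
  move=> Ux.
  have dc N := @differentiable_coord K 1 m N 0 i.
  split; first by apply: (differentiable_comp (df _ Ux) (dc _)).
  rewrite (_ : (fun x => _) = (fun N : 'rV[K]_m => N 0 i : K^o) \o f) //.
  rewrite diff_comp; [|exact: df|exact: dc].
  apply/funext => v /=.
  have @L : {linear 'rV[K]_m -> K^o}.
    by exists (fun N : 'M[K]_(_, _) => N 0 i); do 2![eexists]; do ?[constructor];
     rewrite ?mxE// => ? *; rewrite ?mxE//; move=> ?; rewrite !mxE.
  rewrite -[(fun N : 'rV[K]_m => N 0 i : K^o)]/(L : _ -> _) diff_lin //.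
  exact: coord_continuous.
split=> [x /h[]//|v].
by apply: (is_Ck_ext oU _ (IH _ (Df v))) => x /h[_ ->].
Qed.

Lemma is_Ck_comp V W m k (U : set V) (U' : set 'rV[K]_m)
    (f : V -> 'rV[K]_m) (g : 'rV[K]_m -> W) : open U ->
  (forall x, U x -> U' (f x)) -> is_Ck k U f -> is_Ck k U' g ->
  is_Ck k U (fun x => g (f x)).
Proof.
move=> oU fU; elim: k g => [|k IH] g Cf Cg.
  move=> x Ux; apply: continuous_comp; [exact: Cf|exact/Cg/fU].
have [[df Df] [dg Dg]] := (Cf, Cg); split=> [x Ux|v].
  by apply: differentiable_comp; [exact: df|exact/dg/fU].
have C := @is_Ck_sum _ _ k U m (fun i x => 'd f x v 0 i *: 'd g (f x) 'e_i) oU.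
apply: (is_Ck_ext oU _ (C _)) => [x Ux|i].
  rewrite -[fun x => g (f x)]/(g \o f) (diff_comp (df _ Ux) (dg _ (fU _ Ux))).
  rewrite /=; move: ('d f x v) => y; rewrite [y in RHS]row_sum_delta linear_sum.
  by apply: eq_bigr => i _; rewrite linearZ.
apply: (is_Ck_scale oU (is_Ck_coord i oU (Df v))).
exact: (IH (fun y => 'd g y 'e_i) (is_CkS Cf) (Dg 'e_i)).
Qed.
End Ck.

Variant geometry := RealSmooth | ComplexHolomorphic.

Definition scalars (R : realType) (sp : geometry) : numFieldType :=
  if sp is RealSmooth then R else R[i].

Section Manifolds.
Context (R : realType) (sp : geometry).
Local Notation K := (scalars R sp).

Definition smooth_on n m (U : set 'rV[K]_n) (f : 'rV[K]_n -> 'rV[K]_m) : Prop :=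
  if sp is RealSmooth then forall k, is_Ck k U f
  else forall x, U x -> differentiable f x.

(* Near x, the coordinates v are a smooth function of the coordinates u. *)
Definition smooth_wrt (M : topologicalType) n m
    (u : M -> 'rV[K]_n) (v : M -> 'rV[K]_m) (x : M) : Prop :=
  exists (U : set 'rV[K]_n) (f : 'rV[K]_n -> 'rV[K]_m),
    [/\ open U, U (u x), smooth_on U f & \forall y \near x, v y = f (u y)].

Record mchart (M : topologicalType) := MChart {
  mchart_dim : nat;
  mchart_dom : set M;
  mchart_map : M -> 'rV[K]_mchart_dim;
  mchart_open : open mchart_dom;
  mchart_cont : forall x, mchart_dom x -> {for x, continuous mchart_map};
  mchart_inj : forall x y, mchart_dom x -> mchart_dom y ->
    mchart_map x = mchart_map y -> x = y;
  mchart_open_map : forall U : set M, open U -> U `<=` mchart_dom ->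
    open (mchart_map @` U) }.

(* Neither second countability nor a constant dimension is imposed: a Satake
   orbifold is only assumed Hausdorff, its atlas may be uncountable and its
   charts may have different dimensions, so a presentation of the associated
   orbifold is in general a disjoint union of uncountably many pieces. *)
Record manifold := Manifold {
  mcarrier :> topologicalType;
  mhausdorff : hausdorff_space mcarrier;
  matlas : set (mchart mcarrier);
  matlas_cover : forall x, exists2 c, matlas c & mchart_dom c x;
  matlas_compat : forall c c' x, matlas c -> matlas c' ->
    mchart_dom c x -> mchart_dom c' x ->
    smooth_wrt (mchart_map c) (mchart_map c') x }.

Definition is_morphism (M N : manifold) (f : M -> N) : Prop :=
  continuous f /\
  forall c c' x, matlas c -> matlas c' -> mchart_dom c x ->
    mchart_dom c' (f x) ->
    smooth_wrt (mchart_map c) (fun y => mchart_map c' (f y)) x.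

Definition local_iso_at (M N : manifold) (f : M -> N) (x : M) : Prop :=
  exists U : set M, [/\ open U, U x,
    forall y z, U y -> U z -> f y = f z -> y = z,
    forall V : set M, open V -> V `<=` U -> open (f @` V) &
    forall y c c', U y -> matlas c -> matlas c' -> mchart_dom c y ->
      mchart_dom c' (f y) ->
      smooth_wrt (fun z => mchart_map c' (f z)) (mchart_map c) y].

Definition etale (M N : manifold) (f : M -> N) : Prop :=
  is_morphism f /\ forall x, local_iso_at f x.

Definition manifold_open_embedding (M N : manifold) (f : M -> N) : Prop :=
  etale f /\ injective f.

Lemma smooth_on_id n (U : set 'rV[K]_n) : smooth_on U id.
Proof.
rewrite /smooth_on; move: U; case: sp => U; first by move=> k; exact: is_Ck_id.
by move=> x _; case: (is_diff_id x).
Qed.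

Lemma smooth_on_cst n m (U : set 'rV[K]_n) (w : 'rV[K]_m) :
  smooth_on U (fun=> w).
Proof.
rewrite /smooth_on; move: U w; case: sp => U w.
  by move=> k; exact: is_Ck_cst.
by move=> x _; exact: differentiable_cst.
Qed.

Lemma smooth_on_cont n m (U : set 'rV[K]_n) (f : 'rV[K]_n -> 'rV[K]_m) x :
  smooth_on U f -> U x -> {for x, continuous f}.
Proof.
rewrite /smooth_on; move: U f x; case: sp => U f x; first by move=> /(_ 0%N); exact.
by move=> /[apply] /differentiable_continuous.
Qed.

Lemma smooth_on_comp n m p (U : set 'rV[K]_n) (U' : set 'rV[K]_m)
    (f : 'rV[K]_n -> 'rV[K]_m) (g : 'rV[K]_m -> 'rV[K]_p) : open U -> open U' ->
  smooth_on U f -> smooth_on U' g ->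
  open (U `&` f @^-1` U') /\ smooth_on (U `&` f @^-1` U') (fun x => g (f x)).
Proof.
move=> oU oU' sf sg.
have oW : open (U `&` f @^-1` U').
  rewrite openE => x [Ux U'x]; rewrite /interior; apply: filterI.
    exact: (open_nbhs_nbhs (conj oU Ux)).
  exact: (smooth_on_cont sf Ux) (open_nbhs_nbhs (conj oU' U'x)).
split=> //; move: U U' f g oU oU' oW sf sg.
rewrite /smooth_on; case: sp => U U' f g oU oU' oW sf sg.
  move=> k; apply: (is_Ck_comp (U' := U') oW) => [x []//||].
    by apply: is_Ck_sub (sf k) => x [].
  exact: sg.
by move=> x [Ux U'x]; apply: differentiable_comp; [exact: sf|exact: sg].
Qed.

Lemma smooth_wrt_comp (M N : topologicalType) n m p (f : M -> N)
    (u : M -> 'rV[K]_n) (v : N -> 'rV[K]_m) (w : M -> 'rV[K]_p)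
    (w' : N -> 'rV[K]_p) (x : M) :
  {for x, continuous f} -> {for x, continuous u} ->
  smooth_wrt u (fun y => v (f y)) x -> smooth_wrt v w' (f x) ->
  (\forall y \near x, w y = w' (f y)) -> smooth_wrt u w x.
Proof.
move=> cf cu [U [a [oU Ux sa ua]]] [U' [b [oU' U'x sb vb]]] ww'.
have [oW sW] := smooth_on_comp oU oU' sa sb.
exists (U `&` a @^-1` U'), (fun z => b (a z)); split=> //.
  split=> //=; by rewrite -(nbhs_singleton ua).
have vb' := cf _ vb.
by move: ua vb' ww'; apply: filterS3 => y /= <- -> ->.
Qed.

Lemma is_morphism_id (M : manifold) : is_morphism (fun x : M => x).
Proof.
split=> [x|c c' x Ac Ac' cx c'x]; first exact: cvg_id.
exact: matlas_compat.
Qed.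

Lemma is_morphism_cst (M N : manifold) (y : N) : is_morphism (fun _ : M => y).
Proof.
split=> [x|c c' x Ac Ac' cx c'x]; first exact: cvg_cst.
exists setT, (fun=> mchart_map c' y); split=> //; first exact: openT.
  exact: smooth_on_cst.
by near=> z.
Unshelve. all: by end_near. Qed.

Lemma is_morphism_comp (M N P : manifold) (f : M -> N) (g : N -> P) :
  is_morphism g -> is_morphism f -> is_morphism (fun x => g (f x)).
Proof.
move=> [cg sg] [cf sf]; split.
  by move=> x; apply: continuous_comp; [exact: cf|exact: cg].
move=> c c' x Ac Ac' cx c'x; have [d Ad dx] := matlas_cover (f x).
apply: (smooth_wrt_comp (f := f) (v := mchart_map d)
  (w' := fun y => mchart_map c' (g y))).
- exact: cf.
- exact: mchart_cont.
- exact: sf.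
- exact: sg.
- by near=> y.
Unshelve. all: by end_near. Qed.

Lemma is_morphism_local (M N : manifold) (f : M -> N) :
  (forall x : M, exists2 g : M -> N, is_morphism g & \forall y \near x, f y = g y) ->
  is_morphism f.
Proof.
move=> H; split=> [x|c c' x Ac Ac' cx c'x].
  have [g [cg _] fg] := H x; rewrite /continuous_at (nbhs_singleton fg).
  apply: cvg_trans (cg x); apply: near_eq_cvg.
  by apply: filterS fg => y ->.
have [g [_ sg] fg] := H x; rewrite (nbhs_singleton fg) in c'x.
have [U [h [oU Ux sh nh]]] := sg _ _ _ Ac Ac' cx c'x.
by exists U, h; split=> //; apply: filterS2 fg nh => y -> ->.
Qed.

Section Euclidean.
Variable n : nat.

Definition euclidean_chart : mchart 'rV[K]_n.
Proof.
refine (@MChart 'rV[K]_n n setT id openT _ _ _).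
- by move=> x _; exact: cvg_id.
- by [].
- by move=> U oU _; rewrite image_id.
Defined.

Definition euclidean : manifold.
Proof.
refine (@Manifold 'rV[K]_n (@norm_hausdorff _ _) [set euclidean_chart] _ _).
- by move=> x; exists euclidean_chart.
- move=> c c' x -> -> _ _; exists setT, id.
  split=> //; [exact: openT|exact: smooth_on_id|by near=> y].
Unshelve. all: by end_near. Defined.
End Euclidean.

Definition one_point : manifold := euclidean 0.

(* The product I x V of a discrete set I with a manifold V. *)
Section Copies.
Variables (I : choiceType) (V : manifold).

Lemma near_copies (i : I) (x : V) (P : {_ : I & V} -> Prop) :
  (\forall y \near x, P (existT _ i y)) ->
  \forall p \near (existT (fun=> V : Type) i x), P p.
Proof. by []. Qed.

Definition copies_chart (i : I) (c : mchart V) : mchart {_ : I & V}.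
Proof.
refine (@MChart {_ : I & V} (mchart_dim c)
  [set p | projT1 p = i /\ mchart_dom c (projT2 p)]
  (fun p => mchart_map c (projT2 p)) _ _ _ _).
- apply/sigT_openP => j; have [->|ji] := eqVneq j i.
    rewrite (_ : _ @^-1` _ = mchart_dom c); first exact: mchart_open.
    by apply/seteqP; split=> x //= [].
  rewrite (_ : _ @^-1` _ = set0); first exact: open0.
  by apply/seteqP; split=> x //= [/eqP]; rewrite (negbTE ji).
- by move=> [j x] [/= _ cx] A /(mchart_cont cx).
- move=> [j x] [k y] [/= -> cx] [/= -> cy] xy.
  by rewrite (mchart_inj cx cy xy).
- move=> U /sigT_openP oU sU.
  rewrite (_ : _ @` U = mchart_map c @` (existT (fun=> V : Type) i @^-1` U)).
    apply: mchart_open_map; first exact: (oU i).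
    by move=> x /= /sU[].
  apply/seteqP; split=> [_ [[j x] Ux <-]|_ [x Ux <-]].
    by have [/= ji _] := sU _ Ux; exists x => //=; rewrite -ji.
  by exists (existT (fun=> V : Type) i x).
Defined.

Definition copies : manifold.
Proof.
refine (@Manifold {_ : I & V} (sigT_hausdorff (fun=> @mhausdorff V))
  [set ch | exists i, exists2 c, matlas c & ch = copies_chart i c] _ _).
- move=> [i x]; have [c Ac cx] := matlas_cover x.
  by exists (copies_chart i c) => //; exists i, c.
- move=> _ _ [i x] [j [c Ac ->]] [k [c' Ac' ->]] [/= _ cx] [/= _ c'x].
  have [U [f [oU Ux sf nf]]] := matlas_compat Ac Ac' cx c'x.
  by exists U, f.
Defined.

Lemma copies_morphism (T : manifold) (i : T -> I) (v : T -> V) :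
  (forall x, \forall y \near x, i y = i x) -> is_morphism v ->
  is_morphism ((fun x => existT _ (i x) (v x)) : T -> copies).
Proof.
move=> li [cv sv]; split.
  move=> x A /= /cv; apply: filterS2 (li x) => y /= ->; exact.
move=> c _ x Ac [j [c' Ac' ->]] cx [/= ij c'x].
exact: sv.
Qed.

Lemma copies_index (T : manifold) (a : T -> copies) : continuous a ->
  forall x, \forall y \near x, projT1 (a y) = projT1 (a x).
Proof.
move=> ca x; have n : nbhs (a x) [set p | projT1 p = projT1 (a x)].
  by case: (a x) => i v; apply: near_copies; exact: nearW.
exact: (ca x _ n).
Qed.

Lemma copies_projT2 : is_morphism (fun p : copies => (projT2 p : V)).
Proof.
split; first by move=> [i x] A nA.
move=> _ c' [i x] [j [c Ac ->]] Ac' [/= _ cx] c'x.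
have [U [f [oU Ux sf nf]]] := matlas_compat Ac Ac' cx c'x.
by exists U, f.
Qed.
End Copies.

(* A groupoid object, internally the pair (g1 -> g0). `mul a b` is the composite
   of b followed by a; it is meaningful only when src a = tgt b. Its being a
   morphism on the fibre product of src and tgt is expressed on T-valued
   points, T ranging over all manifolds. *)
Record groupoid := Groupoid {
  g0 : manifold;
  g1 : manifold;
  src : g1 -> g0;
  tgt : g1 -> g0;
  unt : g0 -> g1;
  inv : g1 -> g1;
  mul : g1 -> g1 -> g1;
  src_morphism : is_morphism src;
  tgt_morphism : is_morphism tgt;
  unt_morphism : is_morphism unt;
  inv_morphism : is_morphism inv;
  mul_morphism : forall (T : manifold) (a b : T -> g1),
    is_morphism a -> is_morphism b -> (forall x, src (a x) = tgt (b x)) ->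
    is_morphism (fun x => mul (a x) (b x));
  src_unt : forall x, src (unt x) = x;
  tgt_unt : forall x, tgt (unt x) = x;
  src_inv : forall a, src (inv a) = tgt a;
  tgt_inv : forall a, tgt (inv a) = src a;
  src_mul : forall a b, src a = tgt b -> src (mul a b) = src b;
  tgt_mul : forall a b, src a = tgt b -> tgt (mul a b) = tgt a;
  gmulA : forall a b c, src a = tgt b -> src b = tgt c ->
    mul a (mul b c) = mul (mul a b) c;
  mul_untl : forall a, mul (unt (tgt a)) a = a;
  mul_untr : forall a, mul a (unt (src a)) = a;
  mul_invl : forall a, mul (inv a) a = unt (src a);
  mul_invr : forall a, mul a (inv a) = unt (tgt a) }.

Definition is_Sp_groupoid (G : groupoid) : Prop :=
  [/\ etale (@src G), etale (@tgt G) &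
      forall C : set (g0 G * g0 G)%type, compact C ->
        compact ((fun a : g1 G => (src a, tgt a)) @^-1` C)].

Record groupoid_map (G G' : groupoid) := GroupoidMap {
  gm0 : g0 G -> g0 G';
  gm1 : g1 G -> g1 G';
  gm0_morphism : is_morphism gm0;
  gm1_morphism : is_morphism gm1;
  gm_src : forall a, src (gm1 a) = gm0 (src a);
  gm_tgt : forall a, tgt (gm1 a) = gm0 (tgt a);
  gm_unt : forall x, gm1 (unt x) = unt (gm0 x);
  gm_mul : forall a b, src a = tgt b -> gm1 (mul a b) = mul (gm1 a) (gm1 b) }.

(* A category over Sp: the objects over M are `fob M`, the arrows over
   f : M -> N are `fhom f x y` (there are none unless f is a morphism).
   Indexing arrows by the underlying function makes the category laws well
   typed without transport. *)
Record fibcat := Fibcat {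
  fob : manifold -> Type;
  fhom : forall M N : manifold, (M -> N) -> fob M -> fob N -> Type;
  fhom_morphism : forall (M N : manifold) (f : M -> N) x y, fhom f x y -> is_morphism f;
  fid : forall M (x : fob M), fhom (fun m : M => m) x x;
  fcomp : forall (M N P : manifold) (f : M -> N) (g : N -> P) x y z,
    fhom g y z -> fhom f x y -> fhom (fun m => g (f m)) x z;
  fcomp1 : forall (M N : manifold) (f : M -> N) x y (a : fhom f x y),
    (fcomp a (fid x) : fhom f x y) = a;
  f1comp : forall (M N : manifold) (f : M -> N) x y (a : fhom f x y),
    (fcomp (fid y) a : fhom f x y) = a;
  fcompA : forall (M N P Q : manifold) (f : M -> N) (g : N -> P) (h : P -> Q)
    x y z t (a : fhom f x y) (b : fhom g y z) (c : fhom h z t),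
    fcomp c (fcomp b a) = fcomp (fcomp c b) a }.

(* Fibred in groupoids: arrows lift along morphisms of Sp, and every arrow is
   cartesian. *)
Definition fibred (F : fibcat) : Prop :=
  (forall (M N : manifold) (f : M -> N) (y : fob F N), is_morphism f ->
     exists x : fob F M, inhabited (fhom f x y)) /\
  (forall (M N P : manifold) (f : M -> N) (g : N -> P) (x : fob F M)
     (y : fob F N) (z : fob F P) (b : fhom g y z)
     (c : fhom (fun m => g (f m)) x z), is_morphism f ->
     exists! a : fhom f x y, fcomp b a = c).

Record fibmor (F G : fibcat) := Fibmor {
  fm_ob :> forall M, fob F M -> fob G M;
  fm_hom : forall (M N : manifold) (f : M -> N) x y,
    fhom f x y -> fhom f (fm_ob x) (fm_ob y);
  fm_id : forall M (x : fob F M), fm_hom (fid x) = fid (fm_ob x);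
  fm_comp : forall (M N P : manifold) (f : M -> N) (g : N -> P) x y z
    (b : fhom g y z) (a : fhom f x y),
    fm_hom (fcomp b a) = fcomp (fm_hom b) (fm_hom a) }.

Record fibtrans (F G : fibcat) (p q : fibmor F G) := Fibtrans {
  ft :> forall M (x : fob F M), fhom (fun m : M => m) (p M x) (q M x);
  ft_nat : forall (M N : manifold) (f : M -> N) x y (a : fhom f x y),
    (fcomp (fm_hom q a) (ft x) : fhom f (p M x) (q N y)) =
    fcomp (ft y) (fm_hom p a) }.

(* For G fibred in groupoids a 2-morphism is automatically invertible. *)
Definition isomorphic (F G : fibcat) (p q : fibmor F G) : Prop :=
  inhabited (fibtrans p q).

Definition fibcomp (F G H : fibcat) (q : fibmor G H) (p : fibmor F G) :
  fibmor F H.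
Proof.
refine (@Fibmor F H (fun M x => q M (p M x))
  (fun M N f x y a => fm_hom q (fm_hom p a)) _ _).
- by move=> M x; rewrite !fm_id.
- by move=> *; rewrite !fm_comp.
Defined.

Definition equivalence (F G : fibcat) (p : fibmor F G) : Prop :=
  (forall (M N : manifold) (f : M -> N) (x : fob F M) (y : fob F N),
     bijective (@fm_hom _ _ p M N f x y)) /\
  (forall M (z : fob G M), exists x : fob F M,
     inhabited (fhom (fun m : M => m) (p M x) z)).

(* Composition with p is an equivalence of categories Hom(G,H) -> Hom(F,H). *)
Definition precomp_equivalence (F G H : fibcat) (p : fibmor F G) : Prop :=
  (forall q : fibmor F H, exists r : fibmor G H,
     isomorphic (fibcomp r p) q) /\
  (forall (r s : fibmor G H)
     (u : fibtrans (fibcomp r p) (fibcomp s p)),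
     exists! v : fibtrans r s, forall M (x : fob F M), v M (p M x) = u M x).

Record sieve (M : manifold) := Sieve {
  sv :> forall T : manifold, set (T -> M);
  sv_morphism : forall (T : manifold) (u : T -> M), sv u -> is_morphism u;
  sv_comp : forall (T T' : manifold) (f : T' -> T) (u : T -> M),
    is_morphism f -> sv u -> sv (fun x => u (f x)) }.

Definition max_sieve (M : manifold) : sieve M.
Proof.
refine (@Sieve M (fun T u => is_morphism u) _ _) => //.
by move=> T T' f u mf mu; exact: is_morphism_comp.
Defined.

(* S contains an open cover of M. *)
Definition covering (M : manifold) (S : sieve M) : Prop :=
  forall x : M, exists (U : manifold) (e : U -> M),
    [/\ manifold_open_embedding e, range e x & S U e].

Definition sieve_fib (M : manifold) (S : sieve M) : fibcat.
Proof.
unshelve refine (@Fibcat (fun T => {u : T -> M | S T u})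
  (fun T T' f u v => is_morphism f /\ sval u = (fun x => sval v (f x)))
  _ _ _ _ _ _).
- by move=> T u; split=> //; exact: is_morphism_id.
- move=> T T' T'' f g u v w [mg vg] [mf uf].
  by split; [exact: is_morphism_comp|rewrite uf vg].
- by move=> T T' f u v [].
- by move=> *; exact: Prop_irrelevance.
- by move=> *; exact: Prop_irrelevance.
- by move=> *; exact: Prop_irrelevance.
Defined.

Definition yoneda (M : manifold) : fibcat := sieve_fib (max_sieve M).

Definition sieve_incl (M : manifold) (S : sieve M) :
  fibmor (sieve_fib S) (yoneda M).
Proof.
refine (@Fibmor (sieve_fib S) (yoneda M)
  (fun T u => exist _ (sval u) (sv_morphism (proj2_sig u)))
  (fun T T' f u v a => a) _ _).
- by move=> *; exact: (@Prop_irrelevance (_ /\ _)).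
- by move=> *; exact: (@Prop_irrelevance (_ /\ _)).
Defined.

(* Descent: by the 2-Yoneda lemma Hom(M, F) is F(M), and Hom(S, F) is the
   category of descent data along S. *)
Definition is_stack (F : fibcat) : Prop :=
  fibred F /\
  forall (M : manifold) (S : sieve M), covering S ->
    precomp_equivalence F (sieve_incl S).

(* The functor M |-> (Hom(M,g0), Hom(M,g1)), as a category over Sp. *)
Definition pre_hom (G : groupoid) (M N : manifold) (f : M -> N)
    (u : {u : M -> g0 G | is_morphism u})
    (v : {v : N -> g0 G | is_morphism v}) : Type :=
  {a : M -> g1 G | [/\ is_morphism f, is_morphism a,
    forall x, src (a x) = sval u x & forall x, tgt (a x) = sval v (f x)]}.

Lemma pre_hom_eq (G : groupoid) (M N : manifold) (f : M -> N) u v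
  (a b : @pre_hom G M N f u v) : (forall x, sval a x = sval b x) -> a = b.
Proof.
by case: a b => [a pa] [b pb] /= /funext ab; subst b; congr exist;
  exact: Prop_irrelevance.
Qed.

Lemma pre_id_subproof (G : groupoid) (M : manifold)
    (u : {u : M -> g0 G | is_morphism u}) :
  [/\ is_morphism (fun x : M => x), is_morphism (fun x => unt (sval u x)),
    forall x, src (unt (sval u x)) = sval u x &
    forall x, tgt (unt (sval u x)) = sval u x].
Proof.
split=> [|||x]; first exact: is_morphism_id.
- by apply: is_morphism_comp (proj2_sig u); exact: unt_morphism.
- by move=> x; rewrite src_unt.
- by rewrite tgt_unt.
Qed.

Lemma pre_comp_subproof (G : groupoid) (M N P : manifold) (f : M -> N)
    (g : N -> P) u v w (b : @pre_hom G N P g v w) (a : @pre_hom G M N f u v) :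
  let c x := mul (sval b (f x)) (sval a x) in
  [/\ is_morphism (fun x => g (f x)), is_morphism c,
    forall x, src (c x) = sval u x & forall x, tgt (c x) = sval w (g (f x))].
Proof.
case: a b => [a [mf ma sa ta]] [b [mg mb sb tb]] /=.
have ba x : src (b (f x)) = tgt (a x) by rewrite sb ta.
split=> [|||x]; first exact: is_morphism_comp.
- by apply: mul_morphism => //; exact: is_morphism_comp.
- by move=> x; rewrite src_mul.
- by rewrite tgt_mul.
Qed.

Definition prestack (G : groupoid) : fibcat.
Proof.
refine (@Fibcat (fun M => {u : M -> g0 G | is_morphism u}) (@pre_hom G) _
  (fun M u => exist _ _ (pre_id_subproof u))
  (fun M N P f g u v w b a => exist _ _ (pre_comp_subproof b a)) _ _ _).
- by move=> M N f u v [a []].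
- move=> M N f u v a; apply: pre_hom_eq => x /=.
  by have [_ _ <- _] := proj2_sig a; rewrite mul_untr.
- move=> M N f u v a; apply: pre_hom_eq => x /=.
  by have [_ _ _ <-] := proj2_sig a; rewrite mul_untl.
- move=> M N P Q f g h u v w z a b c; apply: pre_hom_eq => x /=.
  have [_ _ sc _] := proj2_sig c; have [_ _ sb tb] := proj2_sig b.
  by have [_ _ _ ta] := proj2_sig a; rewrite gmulA // ?sc ?tb ?sb ?ta.
Defined.

Lemma prestack_map_subproof (G G' : groupoid) (p : groupoid_map G G')
    (M N : manifold) (f : M -> N) u v (a : @pre_hom G M N f u v) :
  [/\ is_morphism f, is_morphism (fun x => gm1 p (sval a x)),
    forall x, src (gm1 p (sval a x)) = gm0 p (sval u x) &
    forall x, tgt (gm1 p (sval a x)) = gm0 p (sval v (f x))].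
Proof.
case: a => [a [mf ma sa ta]] /=; split=> // [|x|x].
- by apply: is_morphism_comp => //; exact: gm1_morphism.
- by rewrite gm_src sa.
- by rewrite gm_tgt ta.
Qed.

Definition prestack_map (G G' : groupoid) (p : groupoid_map G G') :
  fibmor (prestack G) (prestack G').
Proof.
refine (@Fibmor (prestack G) (prestack G')
  (fun M u => exist _ (fun x => gm0 p (sval u x))
     (is_morphism_comp (gm0_morphism p) (proj2_sig u)))
  (fun M N f u v a => exist _ _ (prestack_map_subproof p a)) _ _).
- by move=> M u; apply: pre_hom_eq => x /=; rewrite gm_unt.
- move=> M N P f g u v w b a; apply: pre_hom_eq => x /=.
  have [_ _ sb _] := proj2_sig b; have [_ _ _ ta] := proj2_sig a.
  by rewrite gm_mul // sb ta.
Defined.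

(* F is the stack associated with the groupoid G, by universal property. *)
Definition associated_stack (G : groupoid) (F : fibcat)
    (eta : fibmor (prestack G) F) : Prop :=
  is_stack F /\ forall F', is_stack F' -> precomp_equivalence F' eta.

Definition presentation (F : fibcat) (G : groupoid)
    (eta : fibmor (prestack G) F) : Prop :=
  is_Sp_groupoid G /\ associated_stack eta.

Definition is_orbifold (F : fibcat) : Prop :=
  exists (G : groupoid) (eta : fibmor (prestack G) F), presentation eta.

Definition is_representable (F : fibcat) : Prop :=
  forall M (x : fob F M) (a : fhom (fun m : M => m) x x), a = fid x.

Record fp_ob (X Y Z : fibcat) (p : fibmor X Z) (q : fibmor Y Z)
    (M : manifold) := FpOb {
  fp1 : fob X M;
  fp2 : fob Y M;
  fp_iso : fhom (fun m : M => m) (p M fp1) (q M fp2) }.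

Definition fp_hom (X Y Z : fibcat) (p : fibmor X Z) (q : fibmor Y Z)
    (M N : manifold) (f : M -> N) (x : fp_ob p q M) (y : fp_ob p q N) : Type :=
  {ab : fhom f (fp1 x) (fp1 y) * fhom f (fp2 x) (fp2 y) |
    (fcomp (fm_hom q ab.2) (fp_iso x) : fhom f (p M (fp1 x)) (q N (fp2 y))) =
    fcomp (fp_iso y) (fm_hom p ab.1)}.

Lemma fp_hom_eq (X Y Z : fibcat) (p : fibmor X Z) (q : fibmor Y Z)
    (M N : manifold) (f : M -> N) (x : fp_ob p q M) (y : fp_ob p q N)
    (a b : fp_hom f x y) : sval a = sval b -> a = b.
Proof.
by case: a b => [a pa] [b pb] /= ab; subst b; congr exist;
  exact: Prop_irrelevance.
Qed.

Definition fibre_product (X Y Z : fibcat) (p : fibmor X Z) (q : fibmor Y Z) :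
  fibcat.
Proof.
unshelve refine (@Fibcat (fp_ob p q) (@fp_hom X Y Z p q) _ _ _ _ _ _).
- move=> M x; exists (fid (fp1 x), fid (fp2 x)) => /=.
  by rewrite !fm_id (f1comp (fp_iso x)) (fcomp1 (fp_iso x)).
- move=> M N P f g x y z b a.
  exists (fcomp (sval b).1 (sval a).1, fcomp (sval b).2 (sval a).2) => /=.
  rewrite !fm_comp.
  have ea := proj2_sig a; have eb := proj2_sig b; rewrite /= in ea eb.
  have A1 := fcompA (fp_iso x) (fm_hom q (sval a).2) (fm_hom q (sval b).2).
  have A2 := fcompA (fm_hom p (sval a).1) (fp_iso y) (fm_hom q (sval b).2).
  have A3 := fcompA (fm_hom p (sval a).1) (fm_hom p (sval b).1) (fp_iso z).
  etransitivity; first exact: esym A1.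
  etransitivity; first exact: (congr1 (fcomp (fm_hom q (sval b).2)) ea).
  etransitivity; first exact: A2.
  etransitivity; last exact: esym A3.
  exact: (congr1 (fun t => fcomp t (fm_hom p (sval a).1)) eb).
- by move=> M N f x y a; exact: fhom_morphism (sval a).1.
- move=> M N f x y a; apply: fp_hom_eq => /=.
  by rewrite (fcomp1 (sval a).1) (fcomp1 (sval a).2); case: (sval a).
- move=> M N f x y a; apply: fp_hom_eq => /=.
  by rewrite (f1comp (sval a).1) (f1comp (sval a).2); case: (sval a).
- move=> M N P Q f g h x y z t a b c; apply: fp_hom_eq => /=.
  by rewrite (fcompA (sval a).1) (fcompA (sval a).2).
Defined.

Definition fibre_product2 (X Y Z : fibcat) (p : fibmor X Z) (q : fibmor Y Z) :
  fibmor (fibre_product p q) Y.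
Proof.
by refine (@Fibmor (fibre_product p q) Y (fun M => @fp2 X Y Z p q M)
  (fun M N f x y a => (sval a).2) _ _).
Defined.

(* A base change along T -> Y exists in Sp-orbifolds when the 2-fibre product is
   an orbifold. *)
Definition representable_morphism (X Y : fibcat) (p : fibmor X Y) : Prop :=
  forall (T : manifold) (t : fibmor (yoneda T) Y),
    is_orbifold (fibre_product p t) -> is_representable (fibre_product p t).

Lemma unit_section_subproof (G : groupoid) (M N : manifold) (f : M -> N)
    (u : fob (yoneda (g0 G)) M) (v : fob (yoneda (g0 G)) N) (a : fhom f u v) :
  [/\ is_morphism f, is_morphism (fun x => unt (sval u x)),
    forall x, src (unt (sval u x)) = sval u x &
    forall x, tgt (unt (sval u x)) = sval v (f x)].
Proof.
case: a => mf uv; split=> // [|x|x].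
- by apply: is_morphism_comp (proj2_sig u); exact: unt_morphism.
- by rewrite src_unt.
- by rewrite tgt_unt uv.
Qed.

Definition unit_section (G : groupoid) : fibmor (yoneda (g0 G)) (prestack G).
Proof.
refine (@Fibmor (yoneda (g0 G)) (prestack G) (fun M u => u)
  (fun M N f u v a => exist _ _ (unit_section_subproof a)) _ _).
- by move=> M u; apply: pre_hom_eq.
- move=> M N P f g u v w [mg vw] [mf uv]; apply: pre_hom_eq => x /=.
  by have := mul_untl (unt (sval v (f x))); rewrite tgt_unt uv => ->.
Defined.

Definition presentation_map (F : fibcat) (G : groupoid)
    (eta : fibmor (prestack G) F) : fibmor (yoneda (g0 G)) F :=
  fibcomp eta (unit_section G).

(* The base change of p along g0 -> Y, for some presentation of Y, is up to
   equivalence an open embedding of manifolds W -> g0. *)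
Definition open_embedding (X Y : fibcat) (p : fibmor X Y) : Prop :=
  representable_morphism p /\
  exists (G : groupoid) (eta : fibmor (prestack G) Y), presentation eta /\
  exists (W : manifold) (e : W -> g0 G)
    (E : fibmor (yoneda W) (fibre_product p (presentation_map eta))),
    [/\ manifold_open_embedding e, equivalence E &
        forall M (u : fob (yoneda W) M) m,
          sval (fibre_product2 p (presentation_map eta) M (E M u)) m =
          e (sval u m)].

Definition gpoint (G : groupoid) (x : g0 G) : fob (prestack G) one_point :=
  exist _ (fun=> x) (is_morphism_cst one_point x).

(* c induces a homeomorphism |F| -> X, where |F| is the set of isomorphism
   classes of F(one_point) with the quotient topology from g0. *)
Definition coarse_homeomorphism (F : fibcat) (X : topologicalType)
    (c : fob F one_point -> X) : Prop :=
  [/\ forall a b, c a = c b <-> inhabited (fhom (fun m : one_point => m) a b),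
      forall x, exists a, c a = x &
      exists (G : groupoid) (eta : fibmor (prestack G) F), presentation eta /\
        forall U : set X,
          open U <-> open [set x : g0 G | U (c (eta one_point (gpoint x)))]].

Record achart := Achart {
  ac_V : manifold;
  ac_H : finGroupType;
  ac_act : ac_H -> ac_V -> ac_V;
  ac_act_morphism : forall h, is_morphism (ac_act h);
  ac_act1 : forall v, ac_act 1%g v = v;
  ac_actM : forall g h v, ac_act (g * h)%g v = ac_act g (ac_act h v) }.

(* H x V => V, with (h, v) an arrow from v to h(v). *)
Definition action_arrows (c : achart) : manifold := copies (ac_H c) (ac_V c).

Definition action_arrow (c : achart) (h : ac_H c) (v : ac_V c) :
  action_arrows c := existT _ h v.

Definition arrow_elt (c : achart) (a : action_arrows c) : ac_H c := projT1 a.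
Definition arrow_src (c : achart) (a : action_arrows c) : ac_V c := projT2 a.
Definition arrow_tgt (c : achart) (a : action_arrows c) : ac_V c :=
  ac_act (arrow_elt a) (arrow_src a).

Lemma arrow_elt_near (c : achart) (T : manifold) (a : T -> action_arrows c) :
  is_morphism a -> forall x, \forall y \near x, arrow_elt (a y) = arrow_elt (a x).
Proof. by move=> [ca _]; exact: (copies_index ca). Qed.

Lemma arrow_src_morphism (c : achart) : is_morphism (@arrow_src c).
Proof. exact: copies_projT2. Qed.

Lemma arrow_tgt_morphism (c : achart) : is_morphism (@arrow_tgt c).
Proof.
apply: is_morphism_local => a.
exists (fun b => ac_act (arrow_elt a) (arrow_src b)).
  apply: is_morphism_comp; first exact: ac_act_morphism.
  exact: arrow_src_morphism.
apply: filterS (arrow_elt_near (is_morphism_id (action_arrows c)) a) => b.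
by rewrite /arrow_tgt => ->.
Qed.

Lemma action_arrow_morphism (c : achart) (T : manifold) (h : T -> ac_H c)
    (v : T -> ac_V c) :
  (forall x, \forall y \near x, h y = h x) -> is_morphism v ->
  is_morphism (fun x => action_arrow (h x) (v x)).
Proof. exact: copies_morphism. Qed.

Lemma action_arrowE (c : achart) (a : action_arrows c) :
  action_arrow (arrow_elt a) (arrow_src a) = a.
Proof. by case: a. Qed.

Definition action_groupoid (c : achart) : groupoid.
Proof.
refine (@Groupoid (ac_V c) (action_arrows c) (@arrow_src c) (@arrow_tgt c)
  (fun v => action_arrow 1%g v)
  (fun a => action_arrow (arrow_elt a)^-1%g (arrow_tgt a))
  (fun a b => action_arrow (arrow_elt a * arrow_elt b)%g (arrow_src b))
  (@arrow_src_morphism c) (@arrow_tgt_morphism c) _ _ _ _ _ _ _ _ _ _ _ _ _ _).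
- apply: action_arrow_morphism (@is_morphism_id _) => x.
  exact: nearW.
- apply: action_arrow_morphism (@arrow_tgt_morphism c) => x.
  apply: filterS (arrow_elt_near (is_morphism_id (action_arrows c)) x) => y.
  by move=> ->.
- move=> T a b ma mb _; apply: action_arrow_morphism => [x|].
    apply: filterS2 (arrow_elt_near ma x) (arrow_elt_near mb x) => y.
    by move=> -> ->.
  by apply: is_morphism_comp mb; exact: arrow_src_morphism.
- by [].
- by move=> v; exact: ac_act1.
- by [].
- by move=> a; rewrite /arrow_tgt /= -ac_actM mulVg ac_act1.
- by [].
- by move=> a b ab; rewrite {1}/arrow_tgt /= ac_actM /arrow_tgt ab.
- by move=> a b d ab bd; rewrite /action_arrow /= mulgA.
- by move=> a; rewrite /= mul1g action_arrowE.
- by move=> a; rewrite /= mulg1 action_arrowE.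
- by move=> a; rewrite /= mulVg.
- by move=> a; rewrite /= mulgV.
Defined.

(* [H\V], with its presentation by H x V => V. *)
Record quotient_stack (c : achart) := QuotientStack {
  qs_fib :> fibcat;
  qs_eta : fibmor (prestack (action_groupoid c)) qs_fib;
  qs_assoc : associated_stack qs_eta }.

Definition qs_point (c : achart) (q : quotient_stack c) (v : ac_V c) :
    fob q one_point :=
  qs_eta q one_point (gpoint (G := action_groupoid c) v).

Record equivariant_map (c c' : achart) := EquivariantMap {
  em_V : ac_V c -> ac_V c';
  em_H : ac_H c -> ac_H c';
  em_V_morphism : is_morphism em_V;
  em_HM : {morph em_H : g h / (g * h)%g};
  em_equiv : forall h v, em_V (ac_act h v) = ac_act (em_H h) (em_V v) }.

Definition action_groupoid_map (c c' : achart) (p : equivariant_map c c') :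
  groupoid_map (action_groupoid c) (action_groupoid c').
Proof.
refine (@GroupoidMap (action_groupoid c) (action_groupoid c') (em_V p)
  (fun a => action_arrow (em_H p (arrow_elt a)) (em_V p (arrow_src a)))
  (em_V_morphism p) _ _ _ _ _).
- apply: action_arrow_morphism => [x|].
    apply: filterS (arrow_elt_near (is_morphism_id (action_arrows c)) x) => y.
    by move=> ->.
  by apply: is_morphism_comp (@arrow_src_morphism c); exact: em_V_morphism.
- by [].
- by move=> a; rewrite /= /arrow_tgt em_equiv.
- move=> v /=; congr action_arrow; apply: (@mulgI _ (em_H p 1)).
  by rewrite -em_HM !mulg1.
- by move=> a b ab; rewrite /= em_HM.
Defined.

Definition induced_map (c c' : achart) (p : equivariant_map c c')
    (q : quotient_stack c) (q' : quotient_stack c') (F : fibmor q q') : Prop :=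
  isomorphic (fibcomp F (qs_eta q))
    (fibcomp (qs_eta q') (prestack_map (action_groupoid_map p))).

(* A morphism of abstract charts. The stacks [H\V], [H'\V'] and the induced map
   are unique up to equivalence, so the choice of q, q' and F is immaterial. *)
Definition is_chart_morphism (c c' : achart) (p : equivariant_map c c') : Prop :=
  exists (q : quotient_stack c) (q' : quotient_stack c') (F : fibmor q q'),
    induced_map p F /\ open_embedding F.

Record ochart (X : topologicalType) := Ochart {
  oc_chart :> achart;
  oc_pi : ac_V oc_chart -> X;
  oc_cont : continuous oc_pi;
  oc_orbit : forall v w,
    oc_pi v = oc_pi w <-> exists h : ac_H oc_chart, w = ac_act h v;
  oc_open : open (range oc_pi);
  (* V/H -> range oc_pi is a homeomorphism *)
  oc_quotient : forall U : set X, U `<=` range oc_pi ->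
    (open U <-> open (oc_pi @^-1` U)) }.

Record chart_category := ChartCategory {
  cc_ob :> Type;
  cc_hom : cc_ob -> cc_ob -> Type;
  cc_id : forall a, cc_hom a a;
  cc_comp : forall a b d, cc_hom b d -> cc_hom a b -> cc_hom a d;
  cc_comp1 : forall a b (f : cc_hom a b), cc_comp f (cc_id a) = f;
  cc_1comp : forall a b (f : cc_hom a b), cc_comp (cc_id b) f = f;
  cc_compA : forall a b d e (f : cc_hom a b) (g : cc_hom b d) (h : cc_hom d e),
    cc_comp h (cc_comp g f) = cc_comp (cc_comp h g) f;
  cc_endo_inv : forall a (f : cc_hom a a), exists g : cc_hom a a,
    cc_comp f g = cc_id a /\ cc_comp g f = cc_id a;
  cc_torsor : forall a b (f g : cc_hom a b),
    exists! k : cc_hom b b, cc_comp k f = g }.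

Record atlas (X : topologicalType) := Atlas {
  at_cat :> chart_category;
  at_chart : at_cat -> ochart X;
  at_map : forall a b : at_cat, cc_hom a b ->
    equivariant_map (at_chart a) (at_chart b);
  at_map_chart : forall a b (f : cc_hom a b), is_chart_morphism (at_map f);
  at_map_pi : forall a b (f : cc_hom a b) v,
    oc_pi (em_V (at_map f) v) = oc_pi v;
  at_id_V : forall a v, em_V (at_map (cc_id a)) v = v;
  at_id_H : forall a h, em_H (at_map (cc_id a)) h = h;
  at_comp_V : forall a b d (f : cc_hom a b) (g : cc_hom b d) v,
    em_V (at_map (cc_comp g f)) v = em_V (at_map g) (em_V (at_map f) v);
  at_comp_H : forall a b d (f : cc_hom a b) (g : cc_hom b d) h,
    em_H (at_map (cc_comp g f)) h = em_H (at_map g) (em_H (at_map f) h);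
  at_iota : forall a : at_cat, cc_hom a a -> ac_H (at_chart a);
  at_iota_bij : forall a, bijective (@at_iota a);
  at_iotaM : forall a (f g : cc_hom a a),
    at_iota (cc_comp f g) = (at_iota f * at_iota g)%g;
  at_iota_V : forall a (f : cc_hom a a) v,
    em_V (at_map f) v = ac_act (at_iota f) v;
  at_iota_H : forall a (f : cc_hom a a) h,
    em_H (at_map f) h = (at_iota f * h * (at_iota f)^-1)%g;
  (* In a chart category an arrow f : a -> b induces Aut(a) -> Aut(b), k |-> k'
     with k' f = f k; iota is an isomorphism between this functor and H. *)
  at_iota_nat : forall a b (f : cc_hom a b) (k : cc_hom a a) (k' : cc_hom b b),
    cc_comp k' f = cc_comp f k -> at_iota k' = em_H (at_map f) (at_iota k);
  at_cover : forall x : X, exists a : at_cat, range (@oc_pi _ (at_chart a)) x;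
  at_refine : forall (a b : at_cat) (x : X),
    range (@oc_pi _ (at_chart a)) x -> range (@oc_pi _ (at_chart b)) x ->
    exists d : at_cat, [/\ inhabited (cc_hom d a), inhabited (cc_hom d b) &
      range (@oc_pi _ (at_chart d)) x] }.

Record atlas_morphism (X : topologicalType) (A B : atlas X) := AtlasMorphism {
  am_ob : A -> B;
  am_hom : forall a b : A, cc_hom a b -> cc_hom (am_ob a) (am_ob b);
  am_id : forall a, am_hom (cc_id a) = cc_id (am_ob a);
  am_comp : forall a b d (f : cc_hom a b) (g : cc_hom b d),
    am_hom (cc_comp g f) = cc_comp (am_hom g) (am_hom f);
  am_ff : forall a b : A, bijective (@am_hom a b);
  am_iso : forall a : A,
    equivariant_map (at_chart a) (at_chart (am_ob a));
  am_inv : forall a : A,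
    equivariant_map (at_chart (am_ob a)) (at_chart a);
  am_iso_chart : forall a, is_chart_morphism (am_iso a);
  am_inv_chart : forall a, is_chart_morphism (am_inv a);
  am_isoK_V : forall a, cancel (em_V (am_iso a)) (em_V (am_inv a));
  am_invK_V : forall a, cancel (em_V (am_inv a)) (em_V (am_iso a));
  am_isoK_H : forall a, cancel (em_H (am_iso a)) (em_H (am_inv a));
  am_invK_H : forall a, cancel (em_H (am_inv a)) (em_H (am_iso a));
  am_iso_pi : forall a v, oc_pi (em_V (am_iso a) v) = oc_pi v;
  am_nat_V : forall a b (f : cc_hom a b) v,
    em_V (am_iso b) (em_V (at_map f) v) =
    em_V (at_map (am_hom f)) (em_V (am_iso a) v);
  am_nat_H : forall a b (f : cc_hom a b) h,
    em_H (am_iso b) (em_H (at_map f) h) =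
    em_H (at_map (am_hom f)) (em_H (am_iso a) h) }.

Definition atlas_equivalent (X : topologicalType) (A B : atlas X) : Prop :=
  clos_refl_sym_trans _ (fun A B => inhabited (atlas_morphism A B)) A B.

Record satake_orbifold := SatakeOrbifold {
  so_space :> topologicalType;
  so_hausdorff : hausdorff_space so_space;
  so_atlas : atlas so_space }.
End Manifolds.

(* Main.v *)
Require Import Defs.
From HB Require Import structures.
From mathcomp Require Import all_boot all_order all_algebra all_fingroup.
From mathcomp Require Import all_classical all_reals all_analysis.
(* Imported again so that mul and inv are the operations of a groupoid. *)
Require Import Defs.
Set Implicit Arguments.
Unset Strict Implicit.
Unset Printing Implicit Defensive.
Import numFieldNormedType.Exports.
Local Open Scope classical_set_scope.

(* The orbifold of an atlas is the stack of cocycles in a groupoid whose objects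
   are the points of all the charts. An arrow is a class of spans (l1, z, l2): a
   point z of a chart d with two arrows l1, l2 of the atlas out of d; two spans are
   identified when they agree after restriction to a common chart. The torsor
   property of chart categories makes this a calculus of fractions. An open
   embedding [H\V] -> [H'\V'] is fully faithful, so V -> V' is etale; arrows
   therefore inherit a manifold structure from the charts, with etale source map.
   The groupoid is proper because near two given points lying under a chart d, the
   arrows form finitely many continuous families, indexed by the finite group of
   the target chart.

   A functor from a prestack to a stack exhibits the associated stack if and only
   if it is fully faithful and locally essentially surjective: the stack of cocycles
   is of this kind, and any other one is equivalent to it. Functors between the
   orbifolds thus come from functors of groupoids, and their full faithfulness and
   essential surjectivity are checked locally on points of charts. *)

(** * Etale maps, open submanifolds and coproducts *)

(** Since the groups may act ineffectively, an arrow of the groupoid cannot be a germ of a map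
    between charts: a span has to remember the arrows of the atlas category themselves.
    Effectiveness is replaced by the bijectivity of an open embedding [H\V] -> [H'\V'] on arrows: an
    element of H' carrying f(v) to f(w) comes from exactly one element of H carrying v to w.
    Refinement of spans, cancellation of their legs and injectivity of f near a point all rest on
    this. Surjectivity of f near f(v) needs more than full faithfulness; it is extracted from the
    manifold that represents the base change of the open embedding. Stacks such as [H\V] are given
    only by a universal property, so nothing can be computed in them directly. Statements about them
    pass through the prestack of the action groupoid, a dense full subcategory whose arrows are
    honest maps. *)

Lemma near_continuous (S T : topologicalType) (f : S -> T) (x : S)
    (P : T -> Prop) : {for x, continuous f} ->
  (\forall z \near f x, P z) -> \forall y \near x, P (f y).
Proof. by move=> cf /cf. Qed.

Lemma existT_injr (I : choiceType) (V : I -> Type) (i : I) (x y : V i) :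
  existT V i x = existT V i y -> x = y.
Proof. exact: (@existT_inj2 I). Qed.

Section Manifolds.
Context (R : realType) (sp : geometry).
Implicit Types M N P T : manifold R sp.

Definition smooth_at M N (f : M -> N) (x : M) : Prop :=
  {for x, continuous f} /\
  forall c c', matlas c -> matlas c' -> mchart_dom c x ->
    mchart_dom c' (f x) ->
    smooth_wrt (mchart_map c) (fun y => mchart_map c' (f y)) x.

Lemma is_morphismP M N (f : M -> N) :
  is_morphism f <-> forall x, smooth_at f x.
Proof.
split=> [[cf sf] x|sf]; first by split=> [|c c']; [exact: cf|exact: sf].
by split=> [x|c c' x]; have [] := sf x => // _; exact.
Qed.

Lemma smooth_at_comp M N P (f : M -> N) (g : N -> P) x :
  smooth_at f x -> smooth_at g (f x) -> smooth_at (fun y => g (f y)) x.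
Proof.
move=> [cf sf] [cg sg]; split; first exact: continuous_comp.
move=> c c' Ac Ac' cx c'x; have [d Ad dx] := matlas_cover (f x).
apply: (smooth_wrt_comp (f := f) (v := mchart_map d)
  (w' := fun y => mchart_map c' (g y))) => //.
- exact: mchart_cont.
- exact: sf.
- exact: sg.
- exact: nearW.
Qed.

Lemma smooth_at_near M N (f g : M -> N) x :
  (\forall y \near x, f y = g y) -> smooth_at f x -> smooth_at g x.
Proof.
move=> fg [cf sf]; have fgx := nbhs_singleton fg; split.
  rewrite /prop_for /continuous_at -fgx; apply: cvg_trans cf.
  by apply: near_eq_cvg.
move=> c c' Ac Ac' cx; rewrite -fgx => c'x.
have [U [h [oU Ux sh nh]]] := sf _ _ Ac Ac' cx c'x.
by exists U, h; split=> //; apply: filterS2 fg nh => y ->.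
Qed.

Lemma smooth_at_id M (x : M) : smooth_at (fun y => y) x.
Proof. by move: x; apply/is_morphismP; exact: is_morphism_id. Qed.

(** The local inverse [r] is a total function that has to be smooth at the single point [f x], so
    that no open submanifold needs to be formed. *)
Definition loc_inv M N (f : M -> N) (x : M) : Prop :=
  exists r : N -> M, [/\ r (f x) = x, smooth_at r (f x),
    \forall y \near x, r (f y) = y & \forall z \near f x, f (r z) = z].

Lemma etaleP M N (f : M -> N) :
  etale f <-> is_morphism f /\ forall x, loc_inv f x.
Proof.
split=> [[mf lf]|[mf lf]]; split=> // x.
  have [U [oU Ux inj opn sm]] := lf x.
  pose r z := if pselect (exists2 y, U y & f y = z) is left e
    then projT1 (cid2 e) else x.
  have rK y : U y -> r (f y) = y.
    move=> Uy; rewrite /r; case: pselect => [e|]; last by case; exists y.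
    by case: (cid2 e) => y' /= Uy' /inj; exact.
  have rfK z : (f @` U) z -> f (r z) = z by move=> [y Uy <-]; rewrite rK.
  have nU : nbhs (f x) (f @` U).
    by apply: open_nbhs_nbhs; split; [exact: opn|exists x].
  exists r; rewrite rK //; split=> //; last first.
  - exact: filterS nU.
  - by apply: filterS (open_nbhs_nbhs (conj oU Ux)).
  split=> [A|c c' Ac Ac' cx c'x].
    rewrite rK // => /nbhs_interior nA.
    have oUA : open (interior A `&` U) by apply: openI => //; exact: open_interior.
    have : nbhs (f x) (f @` (interior A `&` U)).
      apply: open_nbhs_nbhs; split; first by apply: opn oUA _ => y [].
      by exists x => //; split=> //; exact: nbhs_singleton.
    by apply: filterS => _ [y [Ay Uy] <-] /=; rewrite rK //; exact: interior_subset.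
  rewrite rK // in c'x.
  have [V [h [oV Vx sh nh]]] := sm _ _ _ Ux Ac' Ac c'x cx.
  exists V, h; split=> //; have nhU := filterI nh (open_nbhs_nbhs (conj oU Ux)).
  have oW := open_interior [set z | mchart_map c' z = h (mchart_map c (f z)) /\ U z].
  have : nbhs (f x) (f @`
     interior [set z | mchart_map c' z = h (mchart_map c (f z)) /\ U z]).
    apply: open_nbhs_nbhs; split; last by exists x => //; exact: nhU.
    by apply: opn oW _ => y /interior_subset [].
  by apply: filterS => _ [y /interior_subset [e Uy] <-]; rewrite rK.
(* [r] only serves to find an open set on which [f] is injective. Since it is smooth at [f x] alone,
   openness and smoothness at another point [y] come from the local inverse at [y]. *)
have [r [rx sr rK fK]] := lf x.
exists (interior [set y | r (f y) = y]); split=> [|||V oV sV|y c c' _].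
- exact: open_interior.
- exact: rK.
- by move=> y z /interior_subset /= {2}<- /interior_subset /= {2}<- ->.
- rewrite openE => _ [y Vy <-]; have [s [sy [cs _] sK fsK]] := lf y.
  have nV : \forall z \near f y, V (s z).
    by apply: cs; rewrite sy; exact: (open_nbhs_nbhs (conj oV Vy)).
  rewrite /interior; apply: filterS2 nV fsK => z /= Vz <-; by exists (s z).
move=> Ac Ac' cy c'y; have [s [sy [cs ss] sK fsK]] := lf y.
have := ss _ _ Ac' Ac c'y; rewrite sy => /(_ cy) [U [h [oU Ux sh nh]]].
exists U, h; split=> //; have [cf _] := mf.
by apply: filterS2 sK (cf _ _ nh) => z /= sz <-; rewrite sz.
Qed.

Lemma etale_morphism M N (f : M -> N) : etale f -> is_morphism f.
Proof. by case. Qed.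

Lemma etale_loc_inv M N (f : M -> N) x : etale f -> loc_inv f x.
Proof. by move=> /etaleP[]. Qed.

Lemma etale_open M N (f : M -> N) (U : set M) : etale f -> open U -> open (f @` U).
Proof.
move=> ef oU; rewrite openE => _ [y Uy <-].
have [s [sy [cs _] sK fsK]] := etale_loc_inv y ef.
have nV : \forall z \near f y, U (s z).
  by apply: cs; rewrite sy; exact: (open_nbhs_nbhs (conj oU Uy)).
by rewrite /interior; apply: filterS2 nV fsK => z /= Vz <-; exists (s z).
Qed.

Lemma etale_comp M N P (f : M -> N) (g : N -> P) :
  etale g -> etale f -> etale (fun x => g (f x)).
Proof.
move=> eg ef; apply/etaleP; split.
  by apply: is_morphism_comp; exact: etale_morphism.
move=> x; have [s [sx ss sK gs]] := etale_loc_inv (f x) eg.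
have [r [rx sr rK fr]] := etale_loc_inv x ef.
exists (fun z => r (s z)); split; rewrite ?sx //.
- by apply: smooth_at_comp => //; rewrite sx.
- have [cf _] := etale_morphism ef.
  by apply: filterS2 rK (cf _ _ sK) => y /= ry ->.
- have nf : \forall z \near g (f x), f (r (s z)) = s z.
    by apply: (near_continuous (P := fun z => f (r z) = z) ss.1); rewrite sx.
  by apply: filterS2 gs nf => z gz ->.
Qed.

(** Near [x], a continuous [f] is the composite of [s f] with a local inverse of [s]. Smoothness of
    a map into an etale space is thus tested after projection. *)
Lemma smooth_at_etale T M N (s : M -> N) (f : T -> M) x : etale s ->
  {for x, continuous f} -> smooth_at (fun y => s (f y)) x -> smooth_at f x.
Proof.
move=> es cf ssf; have [r [rx sr rK sK]] := etale_loc_inv (f x) es.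
apply: smooth_at_near (smooth_at_comp ssf sr).
exact: (cf _ rK).
Qed.

Lemma morphism_etale T M N (s : M -> N) (f : T -> M) : etale s ->
  continuous f -> is_morphism (fun y => s (f y)) -> is_morphism f.
Proof.
move=> es cf /is_morphismP ssf; apply/is_morphismP => x.
by apply: smooth_at_etale es _ _; [exact: cf|exact: ssf].
Qed.

Lemma etale_inj_near M N (f : M -> N) x : etale f ->
  exists U : set M, [/\ open U, U x &
    forall y z, U y -> U z -> f y = f z -> y = z].
Proof. by case=> _ /(_ x) [U [oU Ux iU _ _]]; exists U. Qed.

Lemma open_embedding_lift T M N (e : M -> N) (t : T -> N) :
  manifold_open_embedding e -> is_morphism t -> (forall x, range e (t x)) ->
  exists2 t' : T -> M, is_morphism t' & forall x, e (t' x) = t x.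
Proof.
move=> [ee ie] mt rt.
pose t' x := projT1 (cid2 (rt x)).
have et' x : e (t' x) = t x by rewrite /t'; case: cid2.
exists t' => //; apply/is_morphismP => x.
have [r [rx sr rK eK]] := etale_loc_inv (t' x) ee.
rewrite et' in sr eK.
apply: (smooth_at_near _ (smooth_at_comp (proj1 (is_morphismP t) mt x) sr)).
have [ct _] := mt.
by apply: filterS (near_continuous (ct x) eK) => y /= ey; apply: ie; rewrite et'.
Qed.

Section EtaleSpace.
Variables (Y : topologicalType) (M : manifold R sp) (s : Y -> M).
Hypotheses (hY : hausdorff_space Y) (cs : continuous s).
Hypothesis loc : forall y, exists D : set Y, [/\ open D, D y,
  forall a b, D a -> D b -> s a = s b -> a = b &
  forall V, open V -> V `<=` D -> open (s @` V)].

Definition etale_space_chart (D : set Y) (oD : open D)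
    (iD : forall a b, D a -> D b -> s a = s b -> a = b)
    (pD : forall V, open V -> V `<=` D -> open (s @` V))
    (c : mchart R sp M) : mchart R sp Y.
Proof.
refine (@MChart _ _ Y (mchart_dim c) (D `&` s @^-1` mchart_dom c)
  (fun y => mchart_map c (s y)) _ _ _ _).
- apply: openI => //; apply: open_comp; last exact: mchart_open.
  by move=> y _; exact: cs.
- move=> x [_ cx]; exact: (continuous_comp (@cs x) (mchart_cont cx)).
- by move=> x y [Dx cx] [Dy cy] /(mchart_inj cx cy); exact: iD.
- move=> V oV sV; rewrite (_ : _ @` V = mchart_map c @` (s @` V)).
    apply: mchart_open_map; first by apply: pD => // y /sV[].
    by move=> _ [y /sV[_ cy] <-].
  by rewrite -image_comp.
Defined.

(** The structure that makes [s] a local isomorphism. It serves twice: for open subsets, with [s]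
    the inclusion, and for the arrows of an atlas, with [s] the source map. *)
Definition etale_space : manifold R sp.
Proof.
refine (@Manifold R sp Y hY [set ch | exists D oD iD pD c,
  matlas c /\ ch = @etale_space_chart D oD iD pD c] _ _).
- move=> y; have [D [oD Dy iD pD]] := loc y; have [c Ac cy] := matlas_cover (s y).
  by exists (etale_space_chart oD iD pD c) => //; exists D, oD, iD, pD, c.
- move=> d d' x [D [oD [iD [pD [c [Ac ->]]]]]] {d}.
  move=> [D' [oD' [iD' [pD' [c' [Ac' ->]]]]]] {d'} [Dx cx] [D'x c'x].
  have [U [f [oU Ux sf nf]]] := matlas_compat Ac Ac' cx c'x.
  exists U, f; split=> //; exact: (cs nf).
Defined.

Lemma etale_space_etale : etale (s : etale_space -> M).
Proof.
split.
  split=> [|_ c' x [D [oD [iD [pD [c [Ac ->]]]]]] Ac' [Dx cx] c'x].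
    exact: cs.
  have [U [f [oU Ux sf nf]]] := matlas_compat Ac Ac' cx c'x.
  exists U, f; split=> //; exact: (cs nf).
move=> x; have [D [oD Dx iD pD]] := loc x; exists D; split=> //.
move=> y _ c' Dy [D' [oD' [iD' [pD' [c [Ac ->]]]]]] Ac' [D'y cy] c'y.
have [U [f [oU Ux sf nf]]] := matlas_compat Ac' Ac c'y cy.
exists U, f; split=> //; exact: (cs nf).
Qed.

End EtaleSpace.

Section OpenSubmanifold.
Variables (M : manifold R sp) (U : set M) (oU : open U).

Lemma set_val_hausdorff : hausdorff_space (set_type U).
Proof.
move=> x y xy; apply/val_inj/(@mhausdorff _ _ M) => A B nA nB.
have [z [Az Bz]] := xy _ _ (@initial_continuous _ _ set_val x _ nA)
  (@initial_continuous _ _ set_val y _ nB).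
by exists (val z).
Qed.

Lemma set_val_loc (y : set_type U) : exists D : set (set_type U), [/\ open D, D y,
  forall a b, D a -> D b -> set_val a = set_val b :> M -> a = b &
  forall V, open V -> V `<=` D -> open ((set_val : _ -> M) @` V)].
Proof.
exists setT; split=> //; first exact: openT.
  by move=> a b _ _ /val_inj.
move=> _ [W oW <-] _; rewrite (_ : _ @` _ = U `&` W); first exact: openI.
apply/seteqP; split=> [_ [a Wa <-]|x [Ux Wx]].
  by split=> //; exact: set_valP.
by exists (SigSub (mem_set Ux)).
Qed.

Definition opens : manifold R sp :=
  etale_space set_val_hausdorff (@initial_continuous _ _ set_val) set_val_loc.

Definition opens_val : opens -> M := set_val.

Lemma opens_val_embedding : manifold_open_embedding opens_val.
Proof. by split; [exact: etale_space_etale|exact: val_inj]. Qed.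

Lemma opens_valP (x : opens) : U (opens_val x).
Proof. exact: set_valP. Qed.

Lemma opens_range : range opens_val = U.
Proof.
apply/seteqP; split=> [_ [x _ <-]|x Ux]; first exact: opens_valP.
by exists (SigSub (mem_set Ux)).
Qed.

End OpenSubmanifold.

Lemma open_embedding_comp M N P (f : M -> N) (g : N -> P) :
  manifold_open_embedding g -> manifold_open_embedding f ->
  manifold_open_embedding (fun x => g (f x)).
Proof. by move=> [eg ig] [ef jf]; split; [exact: etale_comp|move=> x y /ig/jf]. Qed.

Lemma open_embedding_morphism M N (e : M -> N) :
  manifold_open_embedding e -> is_morphism e.
Proof. by case=> /etale_morphism. Qed.

Section Coproduct.
Variables (I : choiceType) (V : I -> manifold R sp).

(** Chart maps are total functions; the value 0 on the other summands lies outside the domain of the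
    chart. *)
Definition coprod_map (i : I) (c : mchart R sp (V i)) (p : {j : I & V j}) :
    'rV[scalars R sp]_(mchart_dim c) :=
  if pselect (exists x, p = existT V i x) is left e
  then mchart_map c (projT1 (cid e)) else 0%R.

Lemma coprod_mapE i (c : mchart R sp (V i)) x :
  coprod_map c (existT _ i x) = mchart_map c x.
Proof.
rewrite /coprod_map; case: pselect => [e|]; last by case; exists x.
by case: (cid e) => y /= h; rewrite (existT_injr h).
Qed.

Definition coprod_chart (i : I) (c : mchart R sp (V i)) :
  mchart R sp {j : I & V j}.
Proof.
refine (@MChart R sp {j : I & V j} (mchart_dim c)
  [set p | exists2 x, mchart_dom c x & p = existT _ i x]
  (coprod_map c) _ _ _ _).
- apply/sigT_openP => j; have [<-|ji] := eqVneq i j.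
    rewrite (_ : _ @^-1` _ = mchart_dom c); first exact: mchart_open.
    apply/seteqP; split=> x /=; last by move=> cx; exists x.
    by move=> [y cy h]; rewrite (existT_injr h).
  rewrite (_ : _ @^-1` _ = set0); first exact: open0.
  apply/seteqP; split=> x //= [y _ /(congr1 (@projT1 _ _)) /= e].
  by rewrite e eqxx in ji.
- move=> _ [x cx ->] A; rewrite coprod_mapE => nA.
  change (\forall y \near x, A (coprod_map c (existT _ i y))).
  apply: filterS (near_continuous (mchart_cont cx) nA) => y /=.
  by rewrite coprod_mapE.
- move=> _ _ [x cx ->] [y cy ->]; rewrite !coprod_mapE.
  by move=> /(mchart_inj cx cy) ->.
- move=> U /sigT_openP oU sU.
  rewrite (_ : _ @` U = mchart_map c @` (existT V i @^-1` U)).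
    apply: mchart_open_map; first exact: (oU i).
    by move=> x /= /sU[y cy h]; rewrite (existT_injr h).
  apply/seteqP; split=> [_ [p Up <-]|_ [x Ux <-]].
    have [x cx px] := sU _ Up; rewrite px coprod_mapE; exists x => //.
    by rewrite /= -px.
  by exists (existT V i x) => //; rewrite coprod_mapE.
Defined.

Definition coprod : manifold R sp.
Proof.
refine (@Manifold R sp {j : I & V j} (sigT_hausdorff (fun i => @mhausdorff _ _ (V i)))
  [set ch | exists i, exists2 c, matlas c & ch = @coprod_chart i c] _ _).
- move=> [i x]; have [c Ac cx] := matlas_cover x.
  by exists (coprod_chart c); [exists i, c|exists x].
- move=> d d' p [i [c Ac ->]] [j [c' Ac' ->]] {d d'} [x cx ->] [y c'y].
  move=> e; have ij := congr1 (@projT1 _ _) e; rewrite /= in ij; subst j.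
  have {}e := existT_injr e; subst y.
  have [U [f [oU Ux sf nf]]] := matlas_compat Ac Ac' cx c'y.
  exists U, f; split=> //=; first by rewrite coprod_mapE.
  change (\forall z \near x, coprod_map c' (existT _ i z) = f (coprod_map c (existT _ i z))).
  by apply: filterS nf => z /=; rewrite !coprod_mapE.
Defined.

Definition coprod_in (i : I) (x : V i) : coprod := existT _ i x.

Lemma coprod_in_smooth i (N : manifold R sp) (f : coprod -> N) (x : V i) :
  smooth_at f (coprod_in x) <-> smooth_at (fun y : V i => f (coprod_in y)) x.
Proof.
split=> [[cf sf]|[cf sf]].
  split=> // c c' Ac Ac' cx c'x.
  have [||U [h [oU Ux sh nh]]] := sf (coprod_chart c) c' _ Ac' _ c'x.
  - by exists i, c.
  - by exists x.
  exists U, h; split=> //; first by move: Ux; rewrite /= coprod_mapE.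
  have {}nh : \forall y \near x, mchart_map c' (f (coprod_in y)) =
    h (coprod_map c (coprod_in y)) by [].
  by apply: filterS nh => y /=; rewrite coprod_mapE.
split=> // d c' [j [c Ac ->]] Ac' {d} [y cy e].
have ij := congr1 (@projT1 _ _) e; rewrite /= in ij; subst j.
have {}e := existT_injr e; subst y => c'x.
have [U [h [oU Ux sh nh]]] := sf _ _ Ac Ac' cy c'x.
exists U, h; split=> //=; first by rewrite coprod_mapE.
change (\forall y \near x, mchart_map c' (f (coprod_in y)) =
  h (coprod_map c (coprod_in y))).
by apply: filterS nh => y /=; rewrite coprod_mapE.
Qed.

Lemma coprod_in_embedding i : manifold_open_embedding (@coprod_in i).
Proof.
split; last by move=> x y h; exact: existT_injr h.
apply/etaleP; split=> [|x].
  apply/is_morphismP => y.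
  exact: (proj1 (coprod_in_smooth (fun z => z) y) (smooth_at_id _)).
pose r (p : coprod) := if pselect (exists y, p = coprod_in y) is left e
  then projT1 (cid e) else x.
have rK y : r (coprod_in y) = y.
  rewrite /r; case: pselect => [e|]; last by case; exists y.
  by case: (cid e) => z /= h; rewrite (existT_injr h).
exists r; split; first exact: rK.
- apply/coprod_in_smooth; apply: smooth_at_near (smooth_at_id x).
  by apply: nearW => y; rewrite rK.
- by apply: nearW => y; rewrite rK.
- change (\forall y \near x, coprod_in (r (coprod_in y)) = coprod_in y).
  by apply: nearW => y; rewrite rK.
Qed.

Lemma coprod_morphism (N : manifold R sp) (f : coprod -> N) :
  (forall i, is_morphism (fun y : V i => f (coprod_in y))) -> is_morphism f.
Proof.
move=> mf; apply/is_morphismP => -[i x].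
exact: (proj2 (coprod_in_smooth f x) (proj1 (is_morphismP _) (mf i) x)).
Qed.

Lemma coprod_open (U : set coprod) :
  open U <-> forall i, open [set x : V i | U (coprod_in x)].
Proof. exact: sigT_openP. Qed.

End Coproduct.
End Manifolds.

(** * Fibred categories *)

Section Stacks.
Context (R : realType) (sp : geometry).
Implicit Types F G H : fibcat R sp.
Implicit Types M N P T U : manifold R sp.

Local Notation iso x y := (fhom (fun m => m) x y).
Local Notation fh F f x y := (@fhom R sp F _ _ f x y).

Lemma fcancel F (fF : fibred F) M N P (f : M -> N) (g : N -> P)
    (x : fob F M) (y : fob F N) (z : fob F P) (b : fhom g y z)
    (a a' : fhom f x y) : fcomp b a = fcomp b a' -> a = a'.
Proof.
move=> e; have [c [_ u]] := fF.2 _ _ _ f g x y z b (fcomp b a) (fhom_morphism a).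
by rewrite -(u a) // -(u a').
Qed.

Lemma flift F (fF : fibred F) M N P (f : M -> N) (g : N -> P)
    (x : fob F M) (y : fob F N) (z : fob F P) (b : fhom g y z)
    (c : fhom (fun m => g (f m)) x z) : is_morphism f ->
  exists a : fhom f x y, fcomp b a = c.
Proof. by move=> mf; have [a [e _]] := fF.2 _ _ _ f g x y z b c mf; exists a. Qed.

Lemma finv F (fF : fibred F) M (x y : fob F M) (a : iso x y) :
  exists b : iso y x, (fcomp a b : iso y y) = fid y /\
    (fcomp b a : iso x x) = fid x.
Proof.
have [b ab] := @flift F fF M M M (fun m => m) (fun m => m) y x y a (fid y)
  (is_morphism_id M).
exists b; split=> //; apply: (@fcancel F fF M M M (fun m => m) (fun m => m) _ _ _ a).
have := fcompA a b a; rewrite /= => ->; rewrite ab.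
by rewrite (f1comp a) (fcomp1 a).
Qed.

Lemma fcancelr F (fF : fibred F) M N (f : M -> N) (x y : fob F M) (z : fob F N)
    (t : iso x y) (a a' : fhom f y z) :
  (fcomp a t : fh F f x z) = fcomp a' t -> a = a'.
Proof.
move=> e; have [ti [tti _]] := finv fF t.
have K (b : fh F f y z) : (fcomp (fcomp b t) ti : fh F f y z) = b.
  etransitivity; first exact: esym (fcompA ti t b).
  etransitivity; first exact: (congr1 (fcomp b) tti).
  exact: fcomp1 b.
rewrite -[LHS]K -[RHS]K.
exact: (congr1 (fun c : fh F f x z => (fcomp c ti : fh F f y z)) e).
Qed.

Lemma fliftr F (fF : fibred F) M N (f : M -> N) (x y : fob F M) (z : fob F N)
    (t : iso x y) (c : fhom f x z) : exists a : fhom f y z, (fcomp a t : fh F f x z) = c.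
Proof.
have [ti [_ tit]] := finv fF t; exists (fcomp c ti).
etransitivity; first exact: esym (fcompA t ti c).
etransitivity; first exact: (congr1 (fcomp c) tit).
exact: fcomp1 c.
Qed.

(** Arrows are indexed by functions, but an arrow of a sieve knows its base only up to a
    propositional equality; this transport bridges the gap. *)
Definition fcast F M N (f g : M -> N) (e : f = g) x y (a : fhom f x y) :
  fh F g x y := ecast h (fhom h x y) e a.

Lemma fcast_id F M N (f : M -> N) (e : f = f) x y (a : fh F f x y) :
  fcast e a = a.
Proof. by rewrite (Prop_irrelevance e erefl). Qed.

Section MkFibmor.
Variables (F G : fibcat R sp) (o : forall M, fob F M -> fob G M).
Variable r : forall M N (f : M -> N) x y, fh F f x y ->
  fh G f (o x) (o y) -> Prop.
Hypothesis rE : forall M N (f : M -> N) x y (a : fh F f x y),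
  exists! b, r a b.
Hypothesis r1 : forall M (x : fob F M), r (fid x) (fid (o x)).
Hypothesis rM : forall M N P (f : M -> N) (g : N -> P) x y z
  (a : fh F f x y) (b : fhom g y z) a' b',
  r a a' -> r b b' -> r (fcomp b a) (fcomp b' a').

Lemma rE_uniq M N (f : M -> N) x y (a : fh F f x y) b b' :
  r a b -> r a b' -> b = b'.
Proof. by move=> rb rb'; have [c [_ u]] := rE a; rewrite -(u b) // -(u b'). Qed.

Definition mk_hom M N (f : M -> N) x y (a : fh F f x y) :=
  projT1 (cid (rE a)).

Lemma mk_homP M N (f : M -> N) x y (a : fh F f x y) : r a (mk_hom a).
Proof. by rewrite /mk_hom; case: cid => b []. Qed.

(** When the image of an arrow is the unique solution of a condition [r], functoriality is automatic
    as soon as solutions compose. *)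
Definition mk_fibmor : fibmor F G.
Proof.
refine (@Fibmor _ _ F G o mk_hom _ _).
- by move=> M x; apply: rE_uniq (mk_homP _) _; exact: r1.
- by move=> *; apply: rE_uniq (mk_homP _) _; apply: rM; exact: mk_homP.
Defined.

Lemma mk_fibmorP M N (f : M -> N) x y (a : fh F f x y) :
  r a (fm_hom mk_fibmor a).
Proof. exact: mk_homP. Qed.
End MkFibmor.

Lemma fibtrans_eq F G (p q : fibmor F G) (u v : fibtrans p q) :
  (forall M (x : fob F M), u M x = v M x) -> u = v.
Proof.
case: u v => [u pu] [v pv] /= uv.
have e : u = v by apply: functional_extensionality_dep => M;
  apply: functional_extensionality_dep.
by subst v; congr Fibtrans; exact: Prop_irrelevance.
Qed.

Definition fibid F : fibmor F F.
Proof. by refine (@Fibmor _ _ F F (fun M x => x) (fun M N f x y a => a) _ _). Defined.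

Definition fully_faithful F G (p : fibmor F G) : Prop :=
  forall M N (f : M -> N) (x : fob F M) (y : fob F N),
  bijective (@fm_hom _ _ _ _ p M N f x y).

Lemma ff_inj F G (p : fibmor F G) M N (f : M -> N) (x : fob F M) (y : fob F N)
  (a b : fhom f x y) : fully_faithful p -> fm_hom p a = fm_hom p b -> a = b.
Proof. by move=> /(_ M N f x y)/bij_inj; exact. Qed.

Lemma ff_surj F G (p : fibmor F G) M N (f : M -> N) (x : fob F M) (y : fob F N)
  (b : fhom f (p M x) (p N y)) : fully_faithful p -> exists a, fm_hom p a = b.
Proof. by move=> /(_ M N f x y) [g _ gK]; exists (g b). Qed.

Lemma ff_id F : fully_faithful (fibid F).
Proof. by move=> M N f x y; exists id. Qed.

Definition sieve_ob M (S : sieve M) T (u : T -> M) (h : S T u) :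
  fob (sieve_fib S) T := exist _ u h.

Definition sieve_arr M (S : sieve M) T T' (f : T -> T') (v : T' -> M)
    (h : S T (fun t => v (f t))) (hv : S T' v) (mf : is_morphism f) :
  fhom f (sieve_ob h) (sieve_ob hv) := conj mf erefl.

(** In a category fibred in groupoids every arrow is cartesian, so such a family says that [s] is
    the restriction of [z] to [S], without any choice of pullbacks of [z]. *)
Definition is_cone F M (S : sieve M) (s : fibmor (sieve_fib S) F) (z : fob F M)
    (k : forall T (u : T -> M) (h : S T u), fhom u (s T (sieve_ob h)) z) : Prop :=
  forall T T' (f : T -> T') (v : T' -> M) (h : S T (fun t => v (f t)))
    (hv : S T' v) (mf : is_morphism f),
  fcomp (k T' v hv) (fm_hom s (sieve_arr h hv mf)) = k T _ h.

(* Full faithfulness makes a functor of the arbitrarily chosen preimages o. *)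
Lemma lift_cone F G (p : fibmor F G) (pf : fully_faithful p) (fG : fibred G)
    M (S : sieve M) (z : fob G M)
    (o : forall T (u : T -> M) (h : S T u), fob F T)
    (k : forall T (u : T -> M) (h : S T u), fhom u (p T (o T u h)) z) :
  exists (s : fibmor (sieve_fib S) F) k', is_cone (s := fibcomp p s) (z := z) k'.
Proof.
pose r T T' (f : T -> T') (u : fob (sieve_fib S) T) (v : fob (sieve_fib S) T')
  (a : fhom f u v) (b : fhom f (o T (sval u) (proj2_sig u))
    (o T' (sval v) (proj2_sig v))) :=
  fcomp (k T' _ (proj2_sig v)) (fm_hom p b) =
  fcast (proj2 a) (k T _ (proj2_sig u)).
have rE T T' (f : T -> T') u v (a : fh (sieve_fib S) f u v) : exists! b, r _ _ _ _ _ a b.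
  have [b eb] := @flift G fG T T' M f (sval v) _ _ _ (k T' _ (proj2_sig v))
    (fcast (proj2 a) (k T _ (proj2_sig u))) (proj1 a).
  have [c cb] := ff_surj b pf; exists c; split; first by rewrite /r cb.
  move=> c' rc'; apply: (ff_inj pf); rewrite cb.
  by apply: (fcancel fG (b := k T' _ (proj2_sig v))); rewrite rc'.
have r1 T (u : fob (sieve_fib S) T) : r _ _ _ _ _ (fid u) (fid (o T _ (proj2_sig u))).
  by rewrite /r fm_id fcast_id (fcomp1 (k T _ (proj2_sig u))).
have rM T T' T'' (f : T -> T') (g : T' -> T'') u v w (a : fh (sieve_fib S) f u v)
    (b : fh (sieve_fib S) g v w) a' b' : r _ _ _ _ _ a a' -> r _ _ _ _ _ b b' ->
    r _ _ _ _ _ (fcomp b a) (fcomp b' a').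
  move: u v w a b a' b' => [u hu] [v hv] [w hw] [mf /= uf] [mg /= vg] a' b'.
  subst v; subst u; rewrite /r /= !fcast_id => ra rb.
  by rewrite fm_comp fcompA rb ra.
exists (mk_fibmor rE r1 rM), k => T T' f v h hv mf.
exact: (etrans (mk_fibmorP rE r1 rM (sieve_arr h hv mf)) (fcast_id _ _)).
Qed.

Lemma yoneda_exists F (fF : fibred F) M (S : sieve M) (z : fob F M) :
  exists (s : fibmor (sieve_fib S) F) k, is_cone (s := s) (z := z) k.
Proof.
have pull T (u : T -> M) (h : S T u) : {x : fob F T & fh F u x z}.
  have [x hx] := cid (fF.1 _ _ u z (sv_morphism h)).
  by exists x; exact: inhabited_witness hx.
have [s [k kc]] := @lift_cone F F (fibid F) (@ff_id F) fF M S z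
  (fun T u h => projT1 (pull T u h)) (fun T u h => projT2 (pull T u h)).
by exists s, k => T T' f v h hv mf; exact: kc.
Qed.

Lemma flift1 F (fF : fibred F) M N (u : M -> N) (x y : fob F M) (z : fob F N)
    (b : fhom u y z) (c : fhom u x z) :
  exists a : iso x y, (fcomp b a : fhom u x z) = c.
Proof.
exact: (@flift F fF M M N (fun m => m) u x y z b c (is_morphism_id M)).
Qed.

Lemma fcancel1 F (fF : fibred F) M N (u : M -> N) (x y : fob F M) (z : fob F N)
    (b : fhom u y z) (a a' : iso x y) :
  (fcomp b a : fhom u x z) = fcomp b a' -> a = a'.
Proof. exact: (@fcancel F fF M M N (fun m => m) u x y z b a a'). Qed.

(** The arrows of the second cone are cartesian, so [a] restricts in exactly one way over each
    member of the sieve; uniqueness gives naturality. *)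
Lemma cone_trans F (fF : fibred F) M (S : sieve M) (s1 s2 : fibmor (sieve_fib S) F)
    (z1 z2 : fob F M) k1 k2 :
  is_cone (s := s1) (z := z1) k1 -> is_cone (s := s2) (z := z2) k2 ->
  forall a : iso z1 z2, exists v : fibtrans s1 s2,
  forall T (u : T -> M) (h : S T u),
    (fcomp (k2 T u h) (v T (sieve_ob h)) : fhom u _ _) = fcomp a (k1 T u h).
Proof.
move=> c1 c2 a.
(* An object of the sieve is a variable [p], not literally a pair. Hence the property is stated for
   every way of writing [p] as [sieve_ob h]. *)
have pick T (p : {u : T -> M | S T u}) : {b : iso (s1 T p) (s2 T p) |
    forall u (h : S T u) (e : p = sieve_ob h),
      (fcomp (k2 T u h) (ecast p (iso (s1 T p) (s2 T p)) e b) : fhom u _ _) =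
      fcomp a (k1 T u h)}.
  apply: cid; case: p => u h.
  have [b eb] := flift1 fF (k2 T u h) (fcomp a (k1 T u h)).
  exists b => u' h' e; have eu : u = u' by case: e.
  subst u'; have eh : h = h' by exact: Prop_irrelevance.
  by subst h'; rewrite (Prop_irrelevance e erefl).
have nat T T' (f : T -> T') (x : fob (sieve_fib S) T) (y : fob (sieve_fib S) T')
  (b : fhom f x y) :
  (fcomp (fm_hom s2 b) (projT1 (pick T x)) : fhom f (s1 T x) (s2 T' y)) =
    fcomp (projT1 (pick T' y)) (fm_hom s1 b).
  move: x y b => [u hu] [v hv] [mf /= uf]; subst u.
  case: (pick _ _) => /= p /(_ _ hu erefl) /= ep.
  case: (pick _ _) => /= q /(_ _ hv erefl) /= eq.
  apply: (@fcancel F fF T T' M f v _ _ _ (k2 _ _ hv)).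
  have A1 := fcompA p (fm_hom s2 (sieve_arr hu hv mf)) (k2 _ _ hv).
  have A2 := fcompA (fm_hom s1 (sieve_arr hu hv mf)) q (k2 _ _ hv).
  have A3 := fcompA (fm_hom s1 (sieve_arr hu hv mf)) (k1 _ _ hv) a.
  etransitivity; first exact: A1.
  have -> := c2 _ _ f v hu hv mf.
  etransitivity; first exact: ep.
  etransitivity; last exact: (esym A2).
  etransitivity; last exact: (congr1 (fun t => fcomp t _) (esym eq)).
  etransitivity; last exact: A3.
  by have -> := c1 _ _ f v hu hv mf.
exists (Fibtrans nat) => T u h /=.
by case: (pick _ _) => /= b /(_ _ h erefl).
Qed.
End Stacks.

(** * Gluing in stacks *)

Section Descent.
Context (R : realType) (sp : geometry).
Implicit Types F G H : fibcat R sp.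
Implicit Types M N P T U : manifold R sp.

Local Notation iso x y := (fhom (fun m => m) x y).
Local Notation fh F f x y := (@fhom R sp F _ _ f x y).

(** For a fibred category, being a stack is split into three conditions free of functor categories:
    arrows are determined locally, arrows glue, objects glue. All later gluing uses these forms. *)
Definition hom_sep F : Prop := forall M N (f : M -> N) (x : fob F M) (y : fob F N)
  (a b : fhom f x y),
  (forall m, exists U (e : U -> M) (t : fob F U) (c : fhom e t x),
    [/\ manifold_open_embedding e, range e m & fcomp a c = fcomp b c]) -> a = b.

(* K u indexes test arrows kc into x over u, together with the composite kd that
   the glued arrow has to take; the pullbacks of x need not be chosen. *)
Definition hom_glue F : Prop := forall M N (f : M -> N) (x : fob F M) (y : fob F N)
  (K : forall T, (T -> M) -> Type) (kt : forall T u, K T u -> fob F T)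
  (kc : forall T u (k : K T u), fhom u (kt T u k) x)
  (kd : forall T u (k : K T u), fhom (fun t => f (u t)) (kt T u k) y),
  is_morphism f ->
  (forall T T' (g : T' -> T) (u : T -> M), is_morphism g -> K T u ->
     inhabited (K T' (fun t => u (g t)))) ->
  (forall T T' (g : T' -> T) (u : T -> M) (k : K T u)
     (k' : K T' (fun t => u (g t))) (j : fhom g (kt _ _ k') (kt _ _ k)),
     kc _ _ k' = fcomp (kc _ _ k) j -> kd _ _ k' = fcomp (kd _ _ k) j) ->
  (forall m, exists U (e : U -> M),
    [/\ manifold_open_embedding e, range e m & inhabited (K U e)]) ->
  exists a : fhom f x y, forall T u (k : K T u), fcomp a (kc T u k) = kd T u k.

Definition obj_glue F : Prop := forall M (S : sieve M) (s : fibmor (sieve_fib S) F),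
  covering S -> exists z k, is_cone (s := s) (z := z) k.

Definition univ_hom F M (r : fibmor (yoneda M) F) T (u : T -> M)
    (h : max_sieve M T u) :
  fhom u (r T (sieve_ob h)) (r M (sieve_ob (is_morphism_id M : max_sieve M M _))) :=
  fm_hom r (@sieve_arr R sp M (max_sieve M) T M u (fun m => m) h
    (is_morphism_id M) h).

Lemma univ_cone F M (r : fibmor (yoneda M) F) :
  is_cone (s := r) (z := r M (sieve_ob (is_morphism_id M : max_sieve M M _)))
    (univ_hom r).
Proof.
move=> T T' f v h hv mf; rewrite /univ_hom -fm_comp.
by congr fm_hom; exact: (@Prop_irrelevance (_ /\ _)).
Qed.

Lemma cone_incl F M (S : sieve M) (r : fibmor (yoneda M) F) z k :
  is_cone (s := r) (z := z) k ->
  is_cone (s := fibcomp r (sieve_incl S)) (z := z)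
    (fun T u h => k T u (sv_morphism h)).
Proof.
move=> kc T T' f v h hv mf.
by rewrite -(kc _ _ f v (sv_morphism h) (sv_morphism hv) mf).
Qed.

(** Converse of [cone_trans] over the maximal sieve: [a] is the component of [v] at the identity of
    [M], conjugated by the arrows of the two cones there. *)
Lemma yoneda_trans F (fF : fibred F) M (r s : fibmor (yoneda M) F) (x y : fob F M)
    kr ks : is_cone (s := r) (z := x) kr -> is_cone (s := s) (z := y) ks ->
  forall v : fibtrans r s, exists a : iso x y,
  forall T (u : T -> M) (h : max_sieve M T u),
    (fcomp a (kr T u h) : fhom u _ _) = fcomp (ks T u h) (v T (sieve_ob h)).
Proof.
move=> cr cs v; pose hid : max_sieve M M (fun m => m) := is_morphism_id M.
have [c [_ ck]] := finv fF (kr M _ hid).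
exists (fcomp (ks M _ hid) (fcomp (v M (sieve_ob hid)) c)) => T u h.
have er := cr T M u (fun m => m) h hid h.
have es := cs T M u (fun m => m) h hid h.
have nv := @ft_nat _ _ _ _ _ _ v T M u _ _ (sieve_arr h hid h).
pose ra := fm_hom r (sieve_arr h hid h).
have e1 : (fcomp c (kr T u h) : fhom u _ _) = ra.
  rewrite -er; have -> := fcompA ra (kr M _ hid) c.
  by rewrite -[RHS](f1comp ra) -ck.
have e2 : (fcomp (fcomp (v M (sieve_ob hid)) c) (kr T u h) : fhom u _ _) =
    fcomp (fm_hom s (sieve_arr h hid h)) (v T (sieve_ob h)).
  rewrite nv -/ra -e1; exact: esym (fcompA (kr T u h) c (v M (sieve_ob hid))).
rewrite -es.
have A1 := fcompA (kr T u h) (fcomp (v M (sieve_ob hid)) c) (ks M _ hid).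
have A2 := fcompA (v T (sieve_ob h)) (fm_hom s (sieve_arr h hid h)) (ks M _ hid).
etransitivity; first exact: esym A1.
etransitivity; last exact: A2.
exact: (congr1 (fun t => fcomp (ks M _ hid) t) e2).
Qed.

Section OfStack.
Variables (F : fibcat R sp) (sF : is_stack F).
Let fF := sF.1.

(** Descent extends [s], up to isomorphism, to a functor [r] on all of [M]; the glued object is the
    value of [r] at the identity. *)
Lemma stack_obj_glue : obj_glue F.
Proof.
move=> M S s cS; have [/(_ s)[r [t]] _] := sF.2 M S cS.
pose z := r M (sieve_ob (is_morphism_id M : max_sieve M M _)).
have inv T u (h : S T u) := cid (finv fF (t T (sieve_ob h))).
exists z, (fun T u h => fcomp (univ_hom r (sv_morphism h)) (projT1 (inv T u h))).
move=> T T' f v h hv mf.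
case: (inv T' v hv) => /= b' [tb' b't]; case: (inv T _ h) => /= b [tb bt].
have nt := @ft_nat _ _ _ _ _ _ t _ _ f _ _ (sieve_arr h hv mf).
have cr := cone_incl (S := S) (univ_cone r) h hv mf.
rewrite -cr.
have e1 : (fcomp b' (fm_hom s (sieve_arr h hv mf)) : fhom f _ _) =
    fcomp (fm_hom (fibcomp r (sieve_incl S)) (sieve_arr h hv mf)) b.
  rewrite -(f1comp (fcomp (fm_hom (fibcomp r (sieve_incl S)) (sieve_arr h hv mf)) b)).
  rewrite -b't -fcompA [in RHS](fcompA b) -nt -fcompA tb.
  by rewrite (fcomp1 (fm_hom s _)).
by rewrite -!fcompA e1.
Qed.

Lemma fpull M N (f : M -> N) (y : fob F N) : is_morphism f ->
  exists x, inhabited (fh F f x y).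
Proof. by move=> mf; exact: fF.1 y mf. Qed.

Definition eq_sieve M N (f : M -> N) (x : fob F M) (y : fob F N) (a b : fhom f x y) :
  sieve M.
Proof.
refine (@Sieve R sp M (fun T u => is_morphism u /\
  exists t (c : fhom u t x), fcomp a c = fcomp b c) _ _).
- by move=> T u [].
- move=> T T' g u mg [mu [t [c ac]]]; split; first exact: is_morphism_comp.
  have [t' [d]] := fpull t mg; exists t', (fcomp c d).
  by rewrite !fcompA ac.
Defined.

(** Two arrows into [x] over the same [u] differ by an isomorphism, so agreement on one of them
    passes to the other. *)
Lemma eq_sieve_all M N (f : M -> N) (x : fob F M) (y : fob F N) (a b : fhom f x y)
  T u t (c : fhom u t x) : eq_sieve a b T u -> fcomp a c = fcomp b c.
Proof.
move=> [mu [t' [c' e]]]; have [j <-] := flift1 fF c' c.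
by rewrite !fcompA e.
Qed.

(** Factored through a pullback [y'] of [y], the two arrows become transformations between the
    functors represented by [x] and [y']. These agree on the sieve where [a] and [b] do, which is
    covering, so they are equal by uniqueness in descent; the component at the identity returns the
    arrows. *)
Lemma stack_hom_sep : hom_sep F.
Proof.
move=> M N f x y a b cov.
have [y' [q]] := fpull y (fhom_morphism a).
have [a' ea] := flift1 fF q a; have [b' eb] := flift1 fF q b.
rewrite -ea -eb; congr fcomp.
have [r [kr cr]] := yoneda_exists fF (max_sieve M) x.
have [s [ks cs]] := yoneda_exists fF (max_sieve M) y'.
have [v1 h1] := cone_trans fF cr cs a'.
have [v2 h2] := cone_trans fF cr cs b'.
have cS : covering (eq_sieve a b).
  move=> m; have [U [e [t [c [oe re ac]]]]] := cov m; exists U, e; split=> //.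
  by split; [exact: open_embedding_morphism|exists t, c].
have [_ /(_ r s)] := sF.2 M _ cS.
pose w1 : fibtrans (fibcomp r (sieve_incl _)) (fibcomp s (sieve_incl _)) :=
  @Fibtrans _ _ _ _ (fibcomp r (sieve_incl (eq_sieve a b))) (fibcomp s (sieve_incl _))
  (fun T u => v1 T (sieve_incl (eq_sieve a b) T u))
  (fun T T' f u v c => @ft_nat _ _ _ _ _ _ v1 T T' f _ _
     (fm_hom (sieve_incl (eq_sieve a b)) c)).
move=> /(_ w1) [v [_ uv]].
have v12 : v1 = v2.
  rewrite -(uv v1) // -(uv v2) // => T [u hu] /=.
  apply: (fcancel1 fF (b := ks T u (sv_morphism hu))).
  etransitivity; first exact: (h2 T u (sv_morphism hu)).
  etransitivity; last exact: (esym (h1 T u (sv_morphism hu))).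
  apply: (fcancel fF (b := q)); rewrite !fcompA ea eb.
  by apply/esym; apply: eq_sieve_all.
subst v2.
pose hid : max_sieve M M (fun m => m) := is_morphism_id M.
have [c [kc _]] := finv fF (kr M _ hid).
have := etrans (esym (h1 M _ hid)) (h2 M _ hid).
move=> /(congr1 (fun t : iso _ _ => (fcomp t c : iso _ _))).
have A1 := fcompA c (kr M _ hid) a'; have A2 := fcompA c (kr M _ hid) b'.
move=> e; have {}e := etrans A1 (etrans e (esym A2)).
move: e; have -> : fcomp (kr M _ hid) c = fid x by [].
by rewrite (fcomp1 a') (fcomp1 b').
Qed.

Lemma stack_hom_glue : hom_glue F.
Proof.
move=> M N f x y K kt kc kd mf Kr Kc Kcov.
have [y' [q]] := fpull y mf.
(* [Phi c d]: the data force [d] to be the composite of the glued arrow with [c]. It makes sense for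
   every test [c], in particular for the arrows of a chosen cone over [x], which need not belong to
   [K]. *)
pose Phi T (u : T -> M) t (c : fhom u t x) (d : fhom (fun m => f (u m)) t y) :=
  forall T0 (g : T0 -> T) (k : K T0 (fun m => u (g m))) (j : fhom g (kt _ _ k) t),
  kc _ _ k = fcomp c j -> kd _ _ k = fcomp d j.
have PhiM T T' (u : T -> M) t t' (g : T' -> T) (c : fhom u t x) d (b : fhom g t' t) :
    Phi T u t c d -> Phi T' _ t' (fcomp c b) (fcomp d b).
  move=> p T0 g0 k j e; rewrite -fcompA.
  by apply: (p T0 (fun m => g (g0 m)) k (fcomp b j)); rewrite fcompA.
have PhiE T (u : T -> M) (k : K T u) t (c : fhom u t x) : exists d, Phi T u t c d.
  have [j0 e0] := flift1 fF c (kc _ _ k).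
  have [i0 [ji ij]] := finv fF j0.
  exists (fcomp (kd _ _ k) i0) => T0 g k' j e.
  have [b eb] := @flift _ _ F fF T0 T M g u _ _ _ (kc _ _ k) (kc _ _ k')
    (fhom_morphism j).
  rewrite (Kc _ _ _ _ _ _ b) //.
  have -> : j = fcomp j0 b.
    by apply: (fcancel fF (b := c)); rewrite -e -eb -e0 -fcompA.
  rewrite -fcompA; congr (fcomp _ _); have := fcompA b j0 i0.
  rewrite /= => ->; have -> : fcomp i0 j0 = fid _ by [].
  by rewrite (f1comp b).
have PhiU T (u : T -> M) (k : K T u) t (c : fhom u t x) d d' :
    Phi T u t c d -> Phi T u t c d' -> d = d'.
  move=> p p'.
  have [j0 e0] := flift1 fF c (kc _ _ k); have [i0 [ji ij]] := finv fF j0.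
  have e1 : (fcomp d j0 : fhom _ _ _) = fcomp d' j0.
    rewrite -(p T (fun m => m) k j0) //; exact: (p' T (fun m => m) k j0).
  have := congr1 (fun t : fhom _ _ _ => (fcomp t i0 : fhom (fun m => f (u m)) _ _)) e1.
  have A := fcompA i0 j0 d; have A' := fcompA i0 j0 d'.
  move=> e; have {}e := etrans A (etrans e (esym A')).
  move: e; have -> : fcomp j0 i0 = fid _ by [].
  by rewrite (fcomp1 d) (fcomp1 d').
have [r [kr cr]] := yoneda_exists fF (max_sieve M) x.
have [s [ks cs]] := yoneda_exists fF (max_sieve M) y'.
pose S : sieve M := @Sieve R sp M (fun T u => is_morphism u /\ inhabited (K T u))
  (fun T u h => h.1) (fun T T' g u mg h => conj (is_morphism_comp h.1 mg)
    (let: inhabits k := h.2 in Kr _ _ g u mg k)).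
have cS : covering S.
  move=> m; have [U [e [oe re k]]] := Kcov m; exists U, e; split=> //.
  by split=> //; exact: open_embedding_morphism.
have PhiP T (u : T -> M) (h : S T u) : exists b : iso (r T (sieve_ob (S := max_sieve M) h.1))
    (s T (sieve_ob (S := max_sieve M) h.1)),
    Phi T u _ (kr T u h.1) (fcomp q (fcomp (ks T u h.1) b)).
  have [k] := h.2; have [d pd] := PhiE T u k _ (kr T u h.1).
  have [d' ed] := @flift _ _ F fF T M N u f _ _ _ q d h.1.
  have [b eb] := flift1 fF (ks T u h.1) d'.
  by exists b; rewrite eb ed.
have pick T (p : {u : T -> M | S T u}) := cid (PhiP T (sval p) (proj2_sig p)).
have nat T T' (g : T -> T') (p : fob (sieve_fib S) T) (p' : fob (sieve_fib S) T')
  (b : fhom g p p') :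
  (fcomp (fm_hom (fibcomp s (sieve_incl S)) b) (projT1 (pick T p)) :
    fhom g (fibcomp r (sieve_incl S) T p) (fibcomp s (sieve_incl S) T' p')) =
    fcomp (projT1 (pick T' p')) (fm_hom (fibcomp r (sieve_incl S)) b).
  move: p p' b => [u hu] [v hv] [mg /= ug]; subst u.
  case: (pick _ _) => /= b pb; case: (pick _ _) => /= b' pb'.
  pose a := @sieve_arr _ _ M (max_sieve M) T T' g v hu.1 hv.1 mg.
  rewrite -/a.
  have cra : fcomp (kr T' v hv.1) (fm_hom r a) = kr T _ hu.1 by exact: cr.
  have csa : fcomp (ks T' v hv.1) (fm_hom s a) = ks T _ hu.1 by exact: cs.
  apply: (fcancel fF (b := fcomp q (ks T' v hv.1))).
  have [k] := hu.2.
  apply: (PhiU T _ k _ (kr T _ hu.1)).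
    have A1 := fcompA b (fm_hom s a) (ks T' v hv.1).
    have E : (fcomp (fcomp q (ks T' v hv.1)) (fcomp (fm_hom s a) b) :
        fhom (fun m => f (v (g m))) _ _) = fcomp q (fcomp (ks T _ hu.1) b).
      rewrite -fcompA; exact: (congr1 (fun t : fh F (fun m => v (g m)) _ _ => fcomp q t)
        (etrans A1 (congr1 (fun t => fcomp t b) csa))).
    exact: (@eq_ind_r _ _ (Phi T _ _ (kr T _ hu.1)) pb _ E).
  have pc := PhiM _ _ _ _ _ g _ _ (fm_hom r a) pb'.
  rewrite cra in pc.
  have E : (fcomp (fcomp q (ks T' v hv.1)) (fcomp b' (fm_hom r a)) :
      fhom (fun m => f (v (g m))) _ _) =
      fcomp (fcomp q (fcomp (ks T' v hv.1) b')) (fm_hom r a).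
    by rewrite -!fcompA.
  exact: (@eq_ind_r _ _ (Phi T _ _ (kr T _ hu.1)) pc _ E).
have [_ /(_ r s)] := sF.2 M _ cS.
move=> /(_ (@Fibtrans _ _ _ _ (fibcomp r (sieve_incl S))
  (fibcomp s (sieve_incl S)) _ nat)) [v [vw _]].
have [a ea] := yoneda_trans fF cr cs v.
exists (fcomp q a) => T u k.
have h : S T u by split; [exact: fhom_morphism (kc _ _ k)|].
have [j0 e0] := flift1 fF (kr T u h.1) (kc _ _ k).
have e1 := vw T (sieve_ob h).
have := projT2 (pick T (sieve_ob h)).
rewrite /= in e1; rewrite /= -e1 => p.
rewrite (p T (fun m => m) k j0 (esym e0)) -e0.
have A1 := fcompA j0 (kr T u h.1) a.
have A2 := fcompA (fcomp (kr T u h.1) j0) a q.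
have A3 := fcompA j0 (fcomp (ks T u h.1) (v T (sieve_ob (S := max_sieve M) h.1))) q.
etransitivity; first exact: esym A2.
etransitivity; last exact: A3.
exact: (congr1 (fun t : fh F u _ _ => fcomp q t)
  (etrans A1 (congr1 (fun t : fh F u _ _ => (fcomp t j0 : fh F u _ _)) (ea T u h.1)))).
Qed.
End OfStack.
End Descent.

(** * Dense fully faithful functors *)

Section Dense.
Context (R : realType) (sp : geometry).
Implicit Types F G H : fibcat R sp.
Implicit Types M N P T U : manifold R sp.

Local Notation iso x y := (fhom (fun m => m) x y).
Local Notation fh F f x y := (@fhom R sp F _ _ f x y).

Lemma is_stack_intro F : fibred F -> hom_sep F -> hom_glue F -> obj_glue F ->
  is_stack F.
Proof.
move=> fF sF gF oF; split=> // M S cS; split=> [q|r s u].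
  have [z [k ck]] := oF M S q cS.
  have [r [kr cr]] := yoneda_exists fF (max_sieve M) z.
  have [v _] := cone_trans fF (cone_incl (S := S) cr) ck (fid z).
  by exists r; constructor.
have cr := univ_cone r; have cs := univ_cone s.
(* By Yoneda a transformation from [r] to [s] amounts to one arrow between their values at the
   identity; that arrow is glued from the components of [u] over the members of [S]. *)
have [|T T' g v mg h|T T' g v h h' j e|m|a ea] := gF M M (fun m => m) _ _
  (fun T v => S T v)
  (fun T v h => r T (sieve_ob (sv_morphism h : max_sieve M T v)))
  (fun T v h => univ_hom r (sv_morphism h : max_sieve M T v))
  (fun T v h => fcomp (univ_hom s (sv_morphism h : max_sieve M T v))
     (u T (sieve_ob h))).
- exact: is_morphism_id.
- by constructor; exact: sv_comp.
- have mg := fhom_morphism j.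
  have er := cr T' T g v (sv_morphism h') (sv_morphism h) mg.
  have es := cs T' T g v (sv_morphism h') (sv_morphism h) mg.
  have -> : j = fm_hom r (sieve_arr (sv_morphism h' : max_sieve M _ _)
      (sv_morphism h : max_sieve M _ _) mg).
    by apply: (fcancel fF (b := univ_hom r (sv_morphism h : max_sieve M T v)));
      rewrite -e er.
  rewrite /= -es.
  have nu := @ft_nat _ _ _ _ _ _ u T' T g _ _ (sieve_arr h' h mg).
  have A1 := fcompA (u T' (sieve_ob h')) (fm_hom s (sieve_arr (sv_morphism h' : max_sieve M _ _)
      (sv_morphism h : max_sieve M _ _) mg)) (univ_hom s (sv_morphism h : max_sieve M T v)).
  have A2 := fcompA (fm_hom r (sieve_arr (sv_morphism h' : max_sieve M _ _)
      (sv_morphism h : max_sieve M _ _) mg)) (u T (sieve_ob h)) (univ_hom s (sv_morphism h : max_sieve M T v)).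
  etransitivity; first exact: esym A1.
  etransitivity; last exact: A2.
  exact: (congr1 (fun t => fcomp _ t) nu).
- have [U [e [oe re h]]] := cS m; exists U, e; split=> //; exact: (inhabits h).
have [v hv] := cone_trans fF cr cs a.
have hvu T (w : T -> M) (h : S T w) : v T (sieve_ob (sv_morphism h : max_sieve M T w)) =
    u T (sieve_ob h).
  apply: (fcancel1 fF (b := univ_hom s (sv_morphism h : max_sieve M T w))).
  etransitivity; first exact: hv.
  exact: ea.
exists v; split=> [T [w h]|v' hv']; first exact: hvu.
apply: fibtrans_eq => T [w h].
have [a1 e1] := yoneda_trans fF cr cs v; have [a2 e2] := yoneda_trans fF cr cs v'.
have a12 : a1 = a2.
  apply: sF => m; have [U [e [oe re hS]]] := cS m.
  exists U, e, _, (univ_hom r (sv_morphism hS : max_sieve M U e)); split=> //.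
  etransitivity; first exact: e1.
  etransitivity; last exact: esym (e2 _ _ _).
  by rewrite hvu -(hv' U (sieve_ob hS)).
apply: (fcancel1 fF (b := univ_hom s (h : max_sieve M T w))).
etransitivity; first exact: esym (e1 _ _ _).
by rewrite a12; exact: e2.
Qed.

Definition loc_image F G (p : fibmor F G) M (z : fob G M) : Prop :=
  forall m, exists U (e : U -> M) (x : fob F U),
  [/\ manifold_open_embedding e, range e m & inhabited (fhom e (p U x) z)].

Definition loc_ess_surj F G (p : fibmor F G) : Prop :=
  forall M (z : fob G M), loc_image p z.

Definition image_sieve F G (fF : fibred F) (p : fibmor F G) M (z : fob G M) : sieve M.
Proof.
refine (@Sieve R sp M (fun T u => is_morphism u /\
  exists x, inhabited (fhom u (p T x) z)) _ _).
- by move=> T u [].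
- move=> T T' g u mg [mu [x [c]]]; split; first exact: is_morphism_comp.
  have [x' [d]] := fF.1 _ _ g x mg; exists x'; constructor.
  exact: (fcomp c (fm_hom p d)).
Defined.

Lemma image_sieve_covering F G (fF : fibred F) (p : fibmor F G) M (z : fob G M) :
  loc_image p z -> covering (image_sieve fF p z).
Proof.
move=> lz m; have [U [e [x [oe re c]]]] := lz m; exists U, e; split=> //.
by split; [exact: open_embedding_morphism|exists x].
Qed.

Lemma image_sieve_cone F G (fF : fibred F) (fG : fibred G) (p : fibmor F G)
    (pf : fully_faithful p) M (z : fob G M) :
  exists (s : fibmor (sieve_fib (image_sieve fF p z)) F) k,
    is_cone (s := fibcomp p s) (z := z) k.
Proof.
have pick T (u : T -> M) (h : image_sieve fF p z T u) :
    {x : fob F T & fh G u (p T x) z}.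
  by have [x hx] := cid h.2; exists x; exact: inhabited_witness hx.
exact: (@lift_cone _ _ F G p pf fG M (image_sieve fF p z) z
  (fun T u h => projT1 (pick T u h)) (fun T u h => projT2 (pick T u h))).
Qed.

(** By full faithfulness, local preimages of [z] form a descent datum in [F]. It glues to some [x],
    and the local isomorphisms from [p x] to [z] glue in [G]. *)
Lemma loc_image_image F G (p : fibmor F G) (pf : fully_faithful p)
    (sF : is_stack F) (sG : is_stack G) M (z : fob G M) :
  loc_image p z -> exists x, inhabited (iso (p M x) z).
Proof.
move=> lz; have [fF fG] := (sF.1, sG.1).
have cS := image_sieve_covering fF lz.
have [s [k ck]] := image_sieve_cone fF fG pf z.
have [x [kx cx]] := stack_obj_glue sF s cS.
have [|T T' g v mg h|T T' g v h h' j e|m|a _] := stack_hom_glue sG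
  (f := fun m => m) (x := p M x) (y := z)
  (K := fun T v => image_sieve fF p z T v)
  (kt := fun T v h => p T (s T (sieve_ob h)))
  (kc := fun T v h => fm_hom p (kx T v h))
  (kd := fun T v h => k T v h).
- exact: is_morphism_id.
- by constructor; exact: sv_comp.
- have mg := fhom_morphism j; have es := ck T' T g v h' h mg.
  have ex := cx T' T g v h' h mg; rewrite -es /=; congr fcomp.
  apply: (fcancel fG (b := fm_hom p (kx T v h))).
  by rewrite -e -ex fm_comp.
- have [U [e [oe re h]]] := cS m; exists U, e; split=> //; exact: (inhabits h).
by exists x; constructor.
Qed.

Lemma inj_surj_bij (A B : Type) (f : A -> B) :
  injective f -> (forall b, exists a, f a = b) -> bijective f.
Proof.
move=> fi fs; exists (fun b => projT1 (cid (fs b))) => [a|b]; last by case: cid.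
by apply: fi; case: cid.
Qed.

Section FullyFaithfulLocal.
Variables (F G : fibcat R sp) (p : fibmor F G).
Hypotheses (sF : is_stack F) (sG : is_stack G).
Hypothesis full : forall M (x y : fob F M) (b : iso (p M x) (p M y)) m,
  exists U (e : U -> M) t (c : fhom e t x) (d : fhom e t y),
  [/\ manifold_open_embedding e, range e m &
      fm_hom p d = (fcomp b (fm_hom p c) : fh G e _ _)].
Hypothesis faith : forall M (x y : fob F M) (a b : iso x y),
  fm_hom p a = fm_hom p b -> forall m, exists U (e : U -> M) t (c : fhom e t x),
  [/\ manifold_open_embedding e, range e m &
      (fcomp a c : fh F e _ _) = fcomp b c].
Let fF := sF.1.
Let fG := sG.1.

Lemma local_faithful M N (f : M -> N) (x : fob F M) (y : fob F N) :
  injective (@fm_hom _ _ _ _ p M N f x y).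
Proof.
move=> a b ab.
have [y' [q]] := fpull sF y (fhom_morphism a).
have [a' ea] := flift1 fF q a; have [b' eb] := flift1 fF q b.
rewrite -ea -eb; congr fcomp; apply: (stack_hom_sep sF) => m.
apply: faith; apply: (fcancel1 fG (b := fm_hom p q)).
have B1 := fm_comp p q a'; have B2 := fm_comp p q b'.
etransitivity; first exact: esym B1.
etransitivity; last exact: B2.
etransitivity; first exact: (congr1 (@fm_hom _ _ _ _ p _ _ f _ _) ea).
etransitivity; last exact: (congr1 (@fm_hom _ _ _ _ p _ _ f _ _) (esym eb)).
exact: ab.
Qed.

Lemma ff_of_local : fully_faithful p.
Proof.
have idf T (x y : fob F T) (b : iso (p T x) (p T y)) : exists a, fm_hom p a = b.
  have [|T' T'' g v mg h|T' T'' g v h h' j e|m|a ea] := stack_hom_glue sF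
    (f := fun m => m) (x := x) (y := y)
    (* A test is an arrow [c] into [x] together with a preimage [d] of [b] composed with [p c].
       Faithfulness makes [d] unique, hence compatible with restriction. *)
    (K := fun T' v => {tc : {t : fob F T' & fh F v t x} &
      {d : fh F v (projT1 tc) y |
        fm_hom p d = (fcomp b (fm_hom p (projT2 tc)) : fh G v _ _)}})
    (kt := fun T' v h => projT1 (projT1 h))
    (kc := fun T' v h => projT2 (projT1 h))
    (kd := fun T' v h => sval (projT2 h)).
  - exact: is_morphism_id.
  - move: h => [[t c] [d /= ed]]; have [t' [l]] := fpull sF t mg.
    constructor; exists (existT _ t' (fcomp c l)) => /=.
    exists (fcomp d l).
    rewrite !fm_comp ed; exact: esym (fcompA (fm_hom p l) (fm_hom p c) b).
  - apply: local_faithful; rewrite fm_comp.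
    etransitivity; first exact: (proj2_sig (projT2 h')).
    rewrite (proj2_sig (projT2 h)) e fm_comp.
    exact: (fcompA (fm_hom p j) (fm_hom p (projT2 (projT1 h))) b).
  - have [U [e [t [c [d [oe re ed]]]]]] := full b m.
    exists U, e; split=> //; constructor; exists (existT _ t c) => /=.
    by exists d.
  exists a; apply: (stack_hom_sep sG) => m.
  have [U [e [t [c [d [oe re ed]]]]]] := full b m.
  exists U, e, _, (fm_hom p c); split=> //.
  have := ea U e (existT _ (existT _ t c) (exist _ _ ed)) => /= {}ea.
  etransitivity; first exact: esym (fm_comp p a c).
  etransitivity; first exact: (congr1 (@fm_hom _ _ _ _ p _ _ e _ _) ea).
  exact: ed.
move=> M N f x y; apply: inj_surj_bij => [|b]; first exact: local_faithful.
have [y' [q]] := fpull sF y (fhom_morphism b).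
have [b' eb] := flift1 fG (fm_hom p q) b.
have [a ea] := idf _ _ _ b'.
exists (fcomp q a); rewrite -eb -ea; exact: (fm_comp p q a).
Qed.
End FullyFaithfulLocal.

Section FullyFaithfulDense.
Variables (P F G : fibcat R sp) (eta : fibmor P F) (p : fibmor F G).
Hypotheses (fP : fibred P) (sF : is_stack F) (sG : is_stack G).
Hypotheses (le : loc_ess_surj eta) (ef : fully_faithful eta).
Hypothesis (pe : fully_faithful (fibcomp p eta)).
Let fF := sF.1.
Let fG := sG.1.

(** [x] comes from [P] on a neighbourhood of [m], and the pullback of [y] to it does so on a smaller
    one. *)
Lemma dense2 M (x y : fob F M) m : exists U (e : U -> M) w w',
  [/\ manifold_open_embedding e, range e m, inhabited (fhom e (eta U w) x) &
  inhabited (fhom e (eta U w') y)].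
Proof.
have [U [e [w [oe [n _ nm] [c]]]]] := le x m.
have [y1 [q]] := fpull sF y (open_embedding_morphism oe).
have [U' [e' [w' [oe' [n' _ nm'] [c']]]]] := le y1 n.
have [w2 [d]] := fP.1 _ _ e' w (open_embedding_morphism oe').
exists U', (fun t => e (e' t)), w2, w'; split.
- exact: open_embedding_comp.
- by exists n' => //; rewrite nm'.
- by constructor; exact: (fcomp c (fm_hom eta d)).
- by constructor; exact: (fcomp q c').
Qed.

(** Full faithfulness is local, and locally both objects come from [P], where [eta] and the
    composite [p eta] have the same arrows. *)
Lemma ff_of_dense : fully_faithful p.
Proof.
apply: ff_of_local => // M x y.
  move=> b m; have [U [e [w [w' [oe re [c] [c']]]]]] := dense2 x y m.
  have [b' eb'] := flift1 fG (fm_hom p c') (fcomp b (fm_hom p c)).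
  have [b0 eb0] := ff_surj (p := fibcomp p eta) (x := w) (y := w') b' pe.
  exists U, e, _, c, (fcomp c' (fm_hom eta b0)); split=> //.
  rewrite -eb' -eb0; exact: (fm_comp p c' (fm_hom eta b0)).
move=> a b ab m; have [U [e [w [w' [oe re [c] [c']]]]]] := dense2 x y m.
exists U, e, _, c; split=> //.
have [ac eac] := flift1 fF c' (fcomp a c); have [bc ebc] := flift1 fF c' (fcomp b c).
have pab : fm_hom p ac = fm_hom p bc.
  apply: (fcancel1 fG (b := fm_hom p c')).
  have E1 := congr1 (@fm_hom _ _ _ _ p _ _ e _ _) eac.
  have E2 := congr1 (@fm_hom _ _ _ _ p _ _ e _ _) ebc.
  etransitivity; first exact: esym (fm_comp p c' ac).
  etransitivity; last exact: (fm_comp p c' bc).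
  etransitivity; first exact: E1.
  etransitivity; last exact: esym E2.
  etransitivity; first exact: (fm_comp p a c).
  etransitivity; last exact: esym (fm_comp p b c).
  by rewrite ab.
have [a0 ea0] := ff_surj ac ef; have [b0 eb0] := ff_surj bc ef.
have ab0 : a0 = b0 by apply: (ff_inj pe); rewrite /= ea0 eb0.
etransitivity; first exact: esym eac.
by rewrite -ea0 ab0 eb0.
Qed.
End FullyFaithfulDense.
End Dense.

(** * Extending functors and transformations along dense fully faithful functors *)

Section Universal.
Context (R : realType) (sp : geometry).
Implicit Types F G H : fibcat R sp.
Implicit Types M N P T U : manifold R sp.

Local Notation iso x y := (fhom (fun m => m) x y).
Local Notation fh F f x y := (@fhom R sp F _ _ f x y).

Lemma isomorphic_sym F G (fG : fibred G) (p q : fibmor F G) :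
  isomorphic p q -> isomorphic q p.
Proof.
move=> [t]; have inv M (x : fob F M) := cid (finv fG (t M x)).
constructor; refine (@Fibtrans _ _ F G q p (fun M x => projT1 (inv M x)) _).
move=> M N f x y a; case: (inv M x) => /= b [tb bt]; case: (inv N y) => /= c [tc ct].
apply: (@fcancel _ _ G fG M N N f (fun m => m) _ _ _ (t N y)).
have A1 := fcompA b (fm_hom p a) (t N y).
have A2 := fcompA (fm_hom q a) c (t N y).
have A3 := fcompA b (t M x) (fm_hom q a).
etransitivity; first exact: A1.
etransitivity; last exact: esym A2.
etransitivity; first exact: (congr1 (fun u => fcomp u b) (esym (ft_nat t a))).
etransitivity; first exact: esym A3.
etransitivity; first exact: (congr1 (fun u => fcomp (fm_hom q a) u) tb).
etransitivity; last exact: (congr1 (fun u => fcomp u (fm_hom q a)) (esym tc)).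
by rewrite (fcomp1 (fm_hom q a)) (f1comp (fm_hom q a)).
Qed.

Lemma isomorphic_trans F G (p q r : fibmor F G) :
  isomorphic p q -> isomorphic q r -> isomorphic p r.
Proof.
move=> [t] [s]; constructor.
refine (@Fibtrans _ _ F G p r (fun M x => fcomp (s M x) (t M x)) _) => M N f x y a.
have A1 := fcompA (t M x) (s M x) (fm_hom r a).
have A2 := fcompA (t M x) (fm_hom q a) (s N y).
have A3 := fcompA (fm_hom p a) (t N y) (s N y).
etransitivity; first exact: A1.
etransitivity; first exact: (congr1 (fun u => fcomp u (t M x)) (ft_nat s a)).
etransitivity; first exact: esym A2.
etransitivity; first exact: (congr1 (fun u => fcomp (s N y) u) (ft_nat t a)).
exact: A3.
Qed.

Lemma isomorphic_precomp F G H (p : fibmor F G) (q r : fibmor G H) :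
  isomorphic q r -> isomorphic (fibcomp q p) (fibcomp r p).
Proof.
move=> [t]; constructor.
refine (@Fibtrans _ _ F H (fibcomp q p) (fibcomp r p) (fun M x => t M (p M x)) _).
by move=> M N f x y a; exact: (ft_nat t).
Qed.

Lemma isomorphic_postcomp F G H (q r : fibmor F G) (p : fibmor G H) :
  isomorphic q r -> isomorphic (fibcomp p q) (fibcomp p r).
Proof.
move=> [t]; constructor.
refine (@Fibtrans _ _ F H (fibcomp p q) (fibcomp p r) (fun M x => fm_hom p (t M x)) _).
move=> M N f x y a.
have B1 := fm_comp p (fm_hom r a) (t M x); have B2 := fm_comp p (t N y) (fm_hom q a).
etransitivity; first exact: esym B1.
etransitivity; last exact: B2.
exact: (congr1 (@fm_hom _ _ _ _ p _ _ f _ _) (ft_nat t a)).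
Qed.

Lemma isomorphic_ff F G (fG : fibred G) (p q : fibmor F G) :
  isomorphic p q -> fully_faithful p -> fully_faithful q.
Proof.
move=> [t] fp M N f x y.
apply: inj_surj_bij => [a b ab|b].
  apply: (ff_inj fp); apply: (@fcancel _ _ G fG M N N f (fun m => m) _ _ _ (t N y)).
  etransitivity; first exact: esym (ft_nat t a).
  etransitivity; last exact: (ft_nat t b).
  by rewrite ab.
have [c ec] := @flift _ _ G fG M N N f (fun m => m) _ _ _ (t N y) (fcomp b (t M x))
  (fhom_morphism b).
have [a ea] := ff_surj c fp; exists a.
apply: (fcancelr fG (t := t M x)).
etransitivity; first exact: (ft_nat t a).
by rewrite ea; exact: ec.
Qed.

Section DensePrecomp.
Variables (P F H : fibcat R sp) (eta : fibmor P F).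
Hypotheses (fP : fibred P) (fF : fibred F) (sH : is_stack H).
Hypotheses (ef : fully_faithful eta) (le : loc_ess_surj eta).
Let fH := sH.1.

Lemma dense_test_factor M (z : fob F M) T T' (u : T -> M) (g : T' -> T)
    (w : fob P T) (w' : fob P T')
    (c : fhom u (eta T w) z) (c' : fhom (fun t => u (g t)) (eta T' w') z) :
  is_morphism g -> exists b : fhom g w' w, fcomp c (fm_hom eta b) = c'.
Proof.
move=> mg; have [b0 e0] := @flift _ _ F fF T' T M g u _ _ _ c c' mg.
by have [b eb] := ff_surj b0 ef; exists b; rewrite eb.
Qed.

(** [z] is glued from objects of [P]; their images under [q] form a descent datum in [H], which
    glues to the value at [z]. The family [k] covers all tests into [z], not only the chosen ones,
    so that the extension to arrows can be described without choices. *)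
Lemma dense_extend_ob (q : fibmor P H) M (z : fob F M) :
  exists (z' : fob H M) (k : forall T w (u : T -> M) (c : fhom u (eta T w) z),
      fhom u (q T w) z'),
  forall T T' (g : T' -> T) w w' (b : fhom g w' w) u (c : fhom u (eta T w) z),
    k _ _ _ (fcomp c (fm_hom eta b)) = fcomp (k _ _ _ c) (fm_hom q b).
Proof.
have cS := image_sieve_covering fP (le z).
have [s [k ck]] := image_sieve_cone fP fF ef z.
have [z' [k0 ck0]] := stack_obj_glue sH (fibcomp q s) cS.
(* An arbitrary test [c] factors through the chosen test over [u] by an arrow [b] of [P]; its image
   is the chosen one composed with [q b]. *)
have pick T w (u : T -> M) (c : fhom u (eta T w) z) : {d : fh H u (q T w) z' |
    exists (h : image_sieve fP eta z T u) (b : iso w (s T (sieve_ob h))),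
    (fcomp (k T u h) (fm_hom eta b) : fh F u _ _) = c /\
    d = fcomp (k0 T u h) (fm_hom q b)}.
  apply: cid; have h : image_sieve fP eta z T u.
    by split; [exact: fhom_morphism c|exists w; constructor].
  have [b eb] := dense_test_factor (k T u h) c (is_morphism_id T).
  by exists (fcomp (k0 T u h) (fm_hom q b)), h, b.
exists z', (fun T w u c => projT1 (pick T w u c)) => T T' g w w' b u c.
case: (pick T w u c) => d /= [h [b1 [ec ->]]].
case: (pick _ _ _ _) => d' /= [h' [b2 [ec' ->]]].
have mg := fhom_morphism b.
have es := ck T' T g u h' h mg; have es0 := ck0 T' T g u h' h mg.
have bb : (fcomp (fm_hom s (sieve_arr (S := image_sieve fP eta z) (v := u) h' h mg)) b2 : fh P g _ _) = fcomp b1 b.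
  apply: (ff_inj ef); apply: (@fcancel _ _ F fF T' T M g u _ _ _ (k T u h)).
  have B1 := fm_comp eta (fm_hom s (sieve_arr (S := image_sieve fP eta z) (v := u) h' h mg)) b2.
  have B2 := fm_comp eta b1 b.
  have A1 := fcompA (fm_hom eta b2) (fm_hom eta (fm_hom s (sieve_arr (S := image_sieve fP eta z) (v := u) h' h mg))) (k T u h).
  have A2 := fcompA (fm_hom eta b) (fm_hom eta b1) (k T u h).
  etransitivity; first exact: (congr1 (fun t => fcomp (k T u h) t) B1).
  etransitivity; last exact: (congr1 (fun t => fcomp (k T u h) t) (esym B2)).
  etransitivity; first exact: A1.
  etransitivity; last exact: esym A2.
  etransitivity; first exact: (congr1 (fun t => fcomp t (fm_hom eta b2)) es).
  etransitivity; first exact: ec'.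
  exact: (congr1 (fun t => fcomp t (fm_hom eta b)) (esym ec)).
have B1 := fm_comp q (fm_hom s (sieve_arr (S := image_sieve fP eta z) (v := u) h' h mg)) b2.
have B2 := fm_comp q b1 b.
have A1 := fcompA (fm_hom q b2) (fm_hom q (fm_hom s (sieve_arr (S := image_sieve fP eta z) (v := u) h' h mg))) (k0 T u h).
have A2 := fcompA (fm_hom q b) (fm_hom q b1) (k0 T u h).
etransitivity; first exact: (congr1 (fun t => fcomp t (fm_hom q b2)) (esym es0)).
etransitivity; first exact: esym A1.
etransitivity; last exact: A2.
etransitivity; first exact: (congr1 (fun t => fcomp (k0 T u h) t) (esym B1)).
etransitivity; last exact: (congr1 (fun t => fcomp (k0 T u h) t) B2).
exact: (congr1 (fun t => fcomp (k0 T u h) (fm_hom q t)) bb).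
Qed.

Lemma dense_extend (q : fibmor P H) : exists r : fibmor F H, isomorphic (fibcomp r eta) q.
Proof.
have pick M (z : fob F M) := cid (dense_extend_ob q z).
have [ob pick2] : exists ob : forall M, fob F M -> fob H M, forall M (z : fob F M),
    exists k : forall T w (u : T -> M) (c : fhom u (eta T w) z), fhom u (q T w) (ob M z),
    forall T T' (g : T' -> T) w w' (b : fhom g w' w) u (c : fhom u (eta T w) z),
    k _ _ _ (fcomp c (fm_hom eta b)) = fcomp (k _ _ _ c) (fm_hom q b).
  by exists (fun M z => projT1 (pick M z)) => M z; exact: (projT2 (pick M z)).
have {pick}pick M (z : fob F M) := cid (pick2 M z).
pose k M (z : fob F M) := projT1 (pick M z).
have kM M (z : fob F M) T T' (g : T' -> T) w w' (b : fhom g w' w) u (c : fhom u (eta T w) z) :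
  k _ _ _ _ _ (fcomp c (fm_hom eta b)) = fcomp (k _ _ _ _ _ c) (fm_hom q b).
  exact: (projT2 (pick M z)).
(* The image of [a] is characterised by its composites with all tests: it exists by gluing of arrows
   in [H] and is unique by separation. *)
pose r M N (f : M -> N) x y (a : fh F f x y) (b : fh H f (ob M x) (ob N y)) :=
  forall T u w (c : fhom u (eta T w) x), fcomp b (k _ _ _ _ _ c) = k _ _ _ _ _ (fcomp a c).
have rE M N (f : M -> N) x y (a : fh F f x y) : exists! b, r _ _ _ _ _ a b.
  have [|T T' g u mg [w c]|T T' g u [w c] [w' c'] /= j e|m|b eb] := stack_hom_glue sH
    (f := f) (x := ob M x) (y := ob N y)
    (K := fun T u => {w : fob P T & fh F u (eta T w) x})
    (kt := fun T u h => q T (projT1 h))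
    (kc := fun T u h => k _ _ _ _ _ (projT2 h))
    (kd := fun T u h => k _ _ _ _ _ (fcomp a (projT2 h))).
  - exact: fhom_morphism a.
  - have [w' [l]] := fP.1 _ _ g w mg.
    by constructor; exists w'; exact: (fcomp c (fm_hom eta l)).
  - have [l el] := dense_test_factor c c' (fhom_morphism j).
    rewrite -el fcompA kM; congr fcomp.
    apply: (@fcancel _ _ H fH T' T M g u _ _ _ (k _ _ _ _ _ c)).
    by rewrite -e -kM el.
  - have [U [e [w [oe re [c]]]]] := le x m.
    by exists U, e; split=> //; constructor; exists w.
  exists b; split=> [T u w c|b' rb']; first exact: (eb T u (existT _ w c)).
  apply: (stack_hom_sep sH) => m.
  have [U [e [w [oe re [c]]]]] := le x m.
  exists U, e, _, (k _ _ _ _ _ c); split=> //.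
  by rewrite rb'; exact: (eb U e (existT _ w c)).
have r1 M (x : fob F M) : r _ _ _ _ _ (fid x) (fid (ob M x)).
  move=> T u w c; have -> := f1comp (k _ _ _ _ _ c).
  by have -> := f1comp c.
have rM M N N' (f : M -> N) (g : N -> N') x y z (a : fh F f x y) (b : fh F g y z) a' b' :
    r _ _ _ _ _ a a' -> r _ _ _ _ _ b b' -> r _ _ _ _ _ (fcomp b a) (fcomp b' a').
  by move=> ra rb T u w c; rewrite -!fcompA ra rb.
exists (mk_fibmor rE r1 rM); apply: (isomorphic_sym fH); constructor.
refine (@Fibtrans _ _ P H q (fibcomp (mk_fibmor rE r1 rM) eta) (fun M w => k _ _ _ _ _ (fid (eta M w))) _).
move=> M N f w w' b /=.
have E := mk_fibmorP rE r1 rM (fm_hom eta b).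
etransitivity; first exact: (E M (fun m => m) w (fid (eta M w))).
have E2 := kM _ _ _ _ f _ _ b _ (fid (eta N w')).
etransitivity; last exact: E2.
have -> := fcomp1 (fm_hom eta b).
by have -> := f1comp (fm_hom eta b).
Qed.

(** Naturality at a test [c] from [eta w] to [z] prescribes the component at [z] along [r c]; such
    tests cover, so the component is glued from these values. *)
Lemma dense_2cell (r s : fibmor F H) (u : fibtrans (fibcomp r eta) (fibcomp s eta)) :
  exists! v : fibtrans r s, forall M (x : fob P M), v M (eta M x) = u M x.
Proof.
have glue M (z : fob F M) : exists a : iso (r M z) (s M z),
    forall T (e : T -> M) (w : fob P T) (c : fhom e (eta T w) z),
    (fcomp a (fm_hom r c) : fh H e _ _) = fcomp (fm_hom s c) (u T w).
  have [|T T' g e mg [w c]|T T' g e [w c] [w' c'] /= j ej|m|a ea] := stack_hom_glue sH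
    (f := fun m => m) (x := r M z) (y := s M z)
    (K := fun T e => {w : fob P T & fh F e (eta T w) z})
    (kt := fun T e h => r T (eta T (projT1 h)))
    (kc := fun T e h => fm_hom r (projT2 h))
    (kd := fun T e h => (fcomp (fm_hom s (projT2 h)) (u T (projT1 h)) : fh H e _ _)).
  - exact: is_morphism_id.
  - have [w' [l]] := fP.1 _ _ g w mg.
    by constructor; exists w'; exact: (fcomp c (fm_hom eta l)).
  - have [l el] := dense_test_factor c c' (fhom_morphism j).
    have -> : j = fm_hom r (fm_hom eta l).
      apply: (@fcancel _ _ H fH T' T M g e _ _ _ (fm_hom r c)).
      by rewrite -ej -fm_comp el.
    rewrite -el fm_comp.
    have A1 := fcompA (u T' w') (fm_hom s (fm_hom eta l)) (fm_hom s c).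
    have A2 := fcompA (fm_hom r (fm_hom eta l)) (u T w) (fm_hom s c).
    etransitivity; first exact: esym A1.
    etransitivity; last exact: A2.
    exact: (congr1 (fun t => fcomp (fm_hom s c) t) (ft_nat u l)).
  - have [U [e [w [oe re [c]]]]] := le z m.
    by exists U, e; split=> //; constructor; exists w.
  by exists a => T e w c; exact: (ea T e (existT _ w c)).
have pick M (z : fob F M) := cid (glue M z).
have vP M (z : fob F M) T (e : T -> M) (w : fob P T) (c : fhom e (eta T w) z) :
    (fcomp (projT1 (pick M z)) (fm_hom r c) : fh H e _ _) =
    fcomp (fm_hom s c) (u T w) by exact: (projT2 (pick M z)).
have nat M N (f : M -> N) (x : fob F M) (y : fob F N) (a : fh F f x y) :
    (fcomp (fm_hom s a) (projT1 (pick M x)) : fh H f _ _) =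
    fcomp (projT1 (pick N y)) (fm_hom r a).
  apply: (stack_hom_sep sH) => m; have [U [e [w [oe re [c]]]]] := le x m.
  exists U, e, _, (fm_hom r c); split=> //.
  have A1 := fcompA (fm_hom r c) (projT1 (pick M x)) (fm_hom s a).
  have A2 := fcompA (fm_hom r c) (fm_hom r a) (projT1 (pick N y)).
  have A3 := fcompA (u U w) (fm_hom s c) (fm_hom s a).
  etransitivity; first exact: esym A1.
  etransitivity; last exact: A2.
  etransitivity; first exact: (congr1 (fun t => fcomp (fm_hom s a) t) (vP _ _ _ _ _ c)).
  etransitivity; first exact: A3.
  have B1 := fm_comp s a c; have B2 := fm_comp r a c.
  etransitivity; first exact: (congr1 (fun t => fcomp t (u U w)) (esym B1)).
  etransitivity; last exact: (congr1 (fun t => fcomp (projT1 (pick N y)) t) B2).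
  exact: esym (vP _ _ _ _ _ (fcomp a c)).
exists (Fibtrans nat); split=> [M w /=|v' hv'].
  have := vP M (eta M w) M (fun m => m) w (fid (eta M w)).
  rewrite !fm_id; have -> := fcomp1 (projT1 (pick M (eta M w))).
  by have -> := f1comp (u M w).
apply: fibtrans_eq => M z /=; apply: (stack_hom_sep sH) => m.
have [U [e [w [oe re [c]]]]] := le z m.
exists U, e, _, (fm_hom r c); split=> //.
etransitivity; first exact: vP.
etransitivity; last exact: (ft_nat v' c).
by rewrite hv'.
Qed.

Lemma dense_precomp : precomp_equivalence H eta.
Proof. by split; [exact: dense_extend|exact: dense_2cell]. Qed.
End DensePrecomp.

Lemma dense_2cell_exists (P F H : fibcat R sp) (eta : fibmor P F) (fP : fibred P) (sF : is_stack F)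
  (sH : is_stack H) (r s : fibmor F H) : fully_faithful eta -> loc_ess_surj eta ->
  isomorphic (fibcomp r eta) (fibcomp s eta) -> isomorphic r s.
Proof.
by move=> ef le [u]; have [v _] := dense_2cell fP sF.1 sH ef le u; constructor.
Qed.
End Universal.

(** * Stackification by cocycles *)

Section Stackification.
Context (R : realType) (sp : geometry).
Implicit Types M N P T U : manifold R sp.

Lemma is_morphism_opens M N (f : M -> N) :
  (forall x, exists (U : set M) (oU : open U), U x /\
     is_morphism (fun y : opens oU => f (opens_val y))) -> is_morphism f.
Proof.
move=> H; apply/is_morphismP => x; have [U [oU [Ux mf]]] := H x.
have [z _ <-] : range (@opens_val _ _ _ _ oU) x by rewrite opens_range.
have [ev _] := opens_val_embedding oU.
have [r [rz sr rK vK]] := etale_loc_inv z ev.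
apply: (@smooth_at_near _ _ _ _ (fun y => f (opens_val (r y)))).
  by apply: filterS vK => y ->.
apply: (smooth_at_comp (g := fun y => f (opens_val y)) sr).
exact: (proj1 (is_morphismP _) mf).
Qed.

Variable G : groupoid R sp.
Implicit Types a b c g : g1 G.

Lemma gmulKl a b : src a = tgt b -> mul (inv a) (mul a b) = b.
Proof. by move=> ab; rewrite gmulA ?src_inv // mul_invl ab mul_untl. Qed.

Lemma gmulVKl a b : tgt a = tgt b -> mul a (mul (inv a) b) = b.
Proof. by move=> ab; rewrite gmulA ?src_inv ?tgt_inv // mul_invr ab mul_untl. Qed.

Lemma gmulKr a b : src a = tgt b -> mul (mul a b) (inv b) = a.
Proof. by move=> ab; rewrite -gmulA ?tgt_inv // mul_invr -ab mul_untr. Qed.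

Lemma gmulVKr a b : src a = src b -> mul (mul a (inv b)) b = a.
Proof. by move=> ab; rewrite -gmulA ?tgt_inv ?src_inv // mul_invl -ab mul_untr. Qed.

Lemma gmulI a b c : src a = tgt b -> src a = tgt c -> mul a b = mul a c -> b = c.
Proof. by move=> ab ac e; rewrite -(gmulKl ab) e gmulKl. Qed.

Lemma gmulIr a b c : src b = tgt a -> src c = tgt a -> mul b a = mul c a -> b = c.
Proof. by move=> ab ac e; rewrite -(gmulKr ab) e gmulKr. Qed.

(** Quotients [b a^-1] do not change when both arrows are precomposed with [d]. This makes
    comparisons of local data independent of the index through which they are computed. *)
Lemma gquot a b d : src a = tgt d -> src b = tgt d ->
  mul (mul b d) (inv (mul a d)) = mul b (inv a).
Proof.
move=> ad bd; apply: (@gmulIr (mul a d)).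
- by rewrite src_mul ?src_inv ?tgt_inv ?src_mul //.
- by rewrite src_mul ?src_inv ?tgt_mul // tgt_inv ad.
- rewrite gmulVKr ?src_mul //.
  by rewrite gmulA ?src_mul ?src_inv ?tgt_inv ?gmulVKr // bd ad.
Qed.

(* A descent datum for G-torsors. Transition arrows are relations whose smoothness
   is tested on T-points, which avoids partial functions on overlaps. *)
Record coc_data M := CocData {
  cd_ind : Type;
  cd_dom : cd_ind -> set M;
  cd_open : forall i, open (cd_dom i);
  cd_cover : forall m, exists i, cd_dom i m;
  cd_anchor : cd_ind -> M -> g0 G }.

Definition coc_map M N (f : M -> N) (x : coc_data M) (y : coc_data N)
    (p : cd_ind x -> cd_ind y -> M -> set (g1 G)) : Prop :=
  [/\ forall i j m g, p i j m g -> [/\ cd_dom i m, cd_dom j (f m),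
        src g = cd_anchor i m & tgt g = cd_anchor j (f m)],
      forall i j m, cd_dom i m -> cd_dom j (f m) -> exists g, p i j m g,
      forall i j m g g', p i j m g -> p i j m g' -> g = g' &
      forall i j T (t : T -> M) (g : T -> g1 G), is_morphism t ->
        (forall s, p i j (t s) (g s)) -> is_morphism g].

Record cocycle M := Cocycle {
  co_data :> coc_data M;
  co_tr : cd_ind co_data -> cd_ind co_data -> M -> set (g1 G);
  co_tr_map : coc_map (fun m => m) co_tr;
  co_trM : forall i j k m a b, co_tr i j m a -> co_tr j k m b ->
    co_tr i k m (mul b a) }.

(** The last two clauses are compatibility with the transitions of [x] and of [y]: the arrow does
    not depend on the local trivialisations in which it is read. *)
Definition coc_hom_ax M N (f : M -> N) (x : cocycle M) (y : cocycle N)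
    (p : cd_ind x -> cd_ind y -> M -> set (g1 G)) : Prop :=
  [/\ is_morphism f, coc_map f p,
    forall i i' j m a g, co_tr i i' m a -> p i' j m g -> p i j m (mul g a) &
    forall i j j' m g b, p i j m g -> co_tr j j' (f m) b -> p i j' m (mul b g)].

Definition coc_hom M N (f : M -> N) (x : cocycle M) (y : cocycle N) : Type :=
  {p | @coc_hom_ax M N f x y p}.

Section HomTheory.
Variables (M N : manifold R sp) (f : M -> N) (x : cocycle M) (y : cocycle N).
Variable p : coc_hom f x y.
Local Notation q := (sval p).

Lemma ch_mor : is_morphism f. Proof. by case: (proj2_sig p). Qed.
Lemma ch_dom1 i j m g : q i j m g -> cd_dom i m.
Proof. by case: (proj2_sig p) => _ [H _ _ _] _ _ /H[]. Qed.
Lemma ch_dom2 i j m g : q i j m g -> cd_dom j (f m).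
Proof. by case: (proj2_sig p) => _ [H _ _ _] _ _ /H[]. Qed.
Lemma ch_src i j m g : q i j m g -> src g = cd_anchor i m.
Proof. by case: (proj2_sig p) => _ [H _ _ _] _ _ /H[]. Qed.
Lemma ch_tgt i j m g : q i j m g -> tgt g = cd_anchor j (f m).
Proof. by case: (proj2_sig p) => _ [H _ _ _] _ _ /H[]. Qed.
Lemma ch_ex i j m : cd_dom i m -> cd_dom j (f m) -> exists g, q i j m g.
Proof. by case: (proj2_sig p) => _ [_ H _ _] _ _; exact: H. Qed.
Lemma ch_fun i j m g g' : q i j m g -> q i j m g' -> g = g'.
Proof. by case: (proj2_sig p) => _ [_ _ H _] _ _; exact: H. Qed.
Lemma ch_smooth i j T (t : T -> M) (g : T -> g1 G) : is_morphism t ->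
  (forall s, q i j (t s) (g s)) -> is_morphism g.
Proof. by case: (proj2_sig p) => _ [_ _ _ H] _ _; exact: H. Qed.
Lemma ch_actr i i' j m a g : co_tr i i' m a -> q i' j m g -> q i j m (mul g a).
Proof. by case: (proj2_sig p) => _ _ H _; exact: H. Qed.
Lemma ch_actl i j j' m g b : q i j m g -> co_tr j j' (f m) b -> q i j' m (mul b g).
Proof. by case: (proj2_sig p) => _ _ _ H; exact: H. Qed.
End HomTheory.

(** One inclusion is enough, since both relations are graphs of functions with the same domain. *)
Lemma coc_hom_eq M N (f : M -> N) (x : cocycle M) (y : cocycle N)
  (p q : coc_hom f x y) :
  (forall i j m g, sval p i j m g -> sval q i j m g) -> p = q.
Proof.
move=> pq; have e : sval p = sval q.
  apply/funext => i; apply/funext => j; apply/funext => m; apply/funext => g.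
  apply/propext; split=> [|h]; first exact: pq.
  have [g' h'] := ch_ex p (ch_dom1 h) (ch_dom2 h).
  by rewrite (ch_fun h (pq _ _ _ _ h')).
by case: p q e {pq} => [p hp] [q hq] /= e; subst q; congr exist;
  exact: Prop_irrelevance.
Qed.

Lemma coc_id_subproof M (x : cocycle M) : coc_hom_ax (fun m => m) (@co_tr M x).
Proof.
split; first exact: is_morphism_id.
- exact: co_tr_map.
- by move=> i i' j m a g ha hg; exact: co_trM ha hg.
- by move=> i j j' m g b hg hb; exact: co_trM hg hb.
Qed.

Definition coc_id M (x : cocycle M) : coc_hom (fun m => m) x x :=
  exist _ _ (coc_id_subproof x).

(** The cocycle law makes the transition from [i] to itself idempotent, and an idempotent of a
    groupoid is a unit. *)
Lemma co_tr_refl M (x : cocycle M) i m :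
  cd_dom i m -> co_tr (c := x) i i m (unt (cd_anchor i m)).
Proof.
move=> im; have [g hg] := ch_ex (coc_id x) im im.
suff -> : unt (cd_anchor i m) = g by [].
have e : mul g g = g := ch_fun (p := coc_id x) (co_trM hg hg) hg.
have sg := ch_src (p := coc_id x) hg; have tg := ch_tgt (p := coc_id x) hg.
rewrite /= in sg tg.
by rewrite -(gmulKl (a := g) (b := g)) ?sg ?tg // e mul_invl sg.
Qed.

Section Comp.
Variables (M N P : manifold R sp) (f : M -> N) (h : N -> P).
Variables (x : cocycle M) (y : cocycle N) (z : cocycle P).
Variables (q : coc_hom h y z) (p : coc_hom f x y).

Definition coc_comp_rel (i : cd_ind x) (k : cd_ind z) (m : M) : set (g1 G) :=
  [set c | exists j a b, [/\ sval p i j m a, sval q j k (f m) b & c = mul b a]].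

Lemma coc_comp_st j a b i k m : sval p i j m a -> sval q j k (f m) b ->
  src b = tgt a.
Proof. by move=> ha hb; rewrite (ch_src hb) (ch_tgt ha). Qed.

(** Changing the intermediate index from [j] to [j'] moves a transition arrow [d] of [y] across the
    product: [b = b' d] and [a' = d a]. *)
Lemma coc_comp_fun i k m c c' :
  coc_comp_rel i k m c -> coc_comp_rel i k m c' -> c = c'.
Proof.
move=> [j [a [b [ha hb ->]]]] [j' [a' [b' [ha' hb' ->]]]].
have [d hd] := ch_ex (coc_id y) (ch_dom2 ha) (ch_dom2 ha').
rewrite (ch_fun ha' (ch_actl ha hd)) (ch_fun hb (ch_actr hd hb')).
rewrite gmulA //.
  by rewrite (ch_tgt (p := coc_id y) hd) (ch_src hb').
by rewrite (ch_src (p := coc_id y) hd) (ch_tgt ha).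
Qed.

Lemma coc_comp_subproof : coc_hom_ax (fun m => h (f m)) coc_comp_rel.
Proof.
split; first exact: is_morphism_comp (ch_mor q) (ch_mor p).
- split.
  + move=> i k m _ [j [a [b [ha hb ->]]]]; have e := coc_comp_st ha hb.
    split; [exact: ch_dom1 ha|exact: ch_dom2 hb| |].
      by rewrite src_mul // (ch_src ha).
    by rewrite tgt_mul // (ch_tgt hb).
  + move=> i k m hi hk; have [j hj] := cd_cover y (f m).
    have [a ha] := ch_ex p hi hj; have [b hb] := ch_ex q hj hk.
    by exists (mul b a), j, a, b.
  + exact: coc_comp_fun.
  (* Smoothness is local, so one intermediate index [j] may be fixed near [s0]; there both factors
     are smooth functions. *)
  + move=> i k T t g mt hg; apply: is_morphism_opens => s0.
    have [j hj] := cd_cover y (f (t s0)).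
    have mft := is_morphism_comp (ch_mor p) mt.
    have oV : open [set s | cd_dom j (f (t s))].
      by apply: (open_comp (f := fun s => f (t s))); [move=> s _; exact: mft.1|exact: cd_open].
    exists _, oV; split=> //.
    have hf (s : opens oV) : exists ab, sval p i j (t (opens_val s)) ab.1 /\
        sval q j k (f (t (opens_val s))) ab.2.
      have hs := opens_valP s; have [j' [a' [b' [ha' hb' _]]]] := hg (opens_val s).
      have [a ha] := ch_ex p (ch_dom1 ha') hs.
      by have [b hb] := ch_ex q hs (ch_dom2 hb'); exists (a, b).
    pose ab s := projT1 (cid (hf s)); have abP s := projT2 (cid (hf s)).
    have mv := open_embedding_morphism (opens_val_embedding oV).
    have mtv := is_morphism_comp mt mv.
    rewrite (_ : (fun y => _) = fun s => mul (ab s).2 (ab s).1).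
      apply: mul_morphism.
      * apply: (ch_smooth (p := q) (i := j) (j := k) (is_morphism_comp (ch_mor p) mtv)).
        by move=> s; exact: (abP s).2.
      * apply: (ch_smooth (p := p) (i := i) (j := j) mtv).
        by move=> s; exact: (abP s).1.
      * by move=> s; have [h1 h2] := abP s; exact: coc_comp_st h1 h2.
    apply/funext => s; apply: coc_comp_fun (hg _) _.
    by have [h1 h2] := abP s; exists j, (ab s).1, (ab s).2.
- move=> i i' k m d _ hd [j [a [b [ha hb ->]]]].
  exists j, (mul a d), b; split=> //; first exact: ch_actr hd ha.
  rewrite gmulA //; first exact: coc_comp_st ha hb.
  by rewrite (ch_src ha) (ch_tgt (p := coc_id x) hd).
- move=> i k k' m _ d [j [a [b [ha hb ->]]]] hd.
  exists j, a, (mul d b); split=> //; first exact: ch_actl hb hd.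
  rewrite gmulA //; last exact: coc_comp_st ha hb.
  by rewrite (ch_tgt hb) (ch_src (p := coc_id z) hd).
Qed.

Definition coc_comp : coc_hom (fun m => h (f m)) x z :=
  exist _ _ coc_comp_subproof.
End Comp.

Definition stk : fibcat R sp.
Proof.
refine (@Fibcat R sp cocycle coc_hom (fun M N f x y p => ch_mor p) coc_id
  (fun M N P f h x y z q p => coc_comp q p) _ _ _).
- move=> M N f x y p; apply: coc_hom_eq => i j m g /= [k [a [b [ha hb ->]]]].
  exact: ch_actr ha hb.
- move=> M N f x y p; apply: coc_hom_eq => i j m g /= [k [a [b [ha hb ->]]]].
  exact: ch_actl ha hb.
- move=> M N P Q f h k x y z t p q r; apply: coc_hom_eq => i j m g /=.
  move=> [n [d [c [[l [a [b [ha hb ->]]]] hc ->]]]].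
  exists l, a, (mul c b); split=> //; first by exists n, b, c.
  rewrite gmulA //; last exact: coc_comp_st ha hb.
  exact: coc_comp_st hb hc.
Defined.
End Stackification.

Section StkTheory.
Context (R : realType) (sp : geometry) (G : groupoid R sp).
Implicit Types M N P T U : manifold R sp.
Implicit Types a b c g : g1 G.
Local Notation iso x y := (fhom (fun m => m) x y).

Section Pull.
Variables (M N : manifold R sp) (f : M -> N) (mf : is_morphism f) (y : cocycle G N).

Definition pull_data : coc_data G M.
Proof.
refine (@CocData _ _ G M (cd_ind y) (fun j m => cd_dom j (f m)) _ _
  (fun j m => cd_anchor j (f m))).
- move=> i; apply: (open_comp (f := f)); last exact: cd_open.
  by move=> m _; exact: mf.1.
- by move=> m; exact: cd_cover.
Defined.

Lemma pull_map : coc_map (x := pull_data) (y := pull_data) (fun m => m)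
  (fun (i j : cd_ind y) m => co_tr (c := y) i j (f m)).
Proof.
have [H1 H2 H3 H4] := co_tr_map y; split.
- by move=> i j m g /H1.
- by move=> i j m; exact: H2.
- by move=> i j m; exact: H3.
- by move=> i j T t g mt; apply: H4; exact: is_morphism_comp mt.
Qed.

Definition pull : cocycle G M :=
  Cocycle pull_map (fun i j k m a b ha hb => co_trM ha hb).

Lemma pull_arr_subproof : coc_hom_ax (x := pull) (y := y) f
  (fun (i j : cd_ind y) m => co_tr (c := y) i j (f m)).
Proof.
have [H1 H2 H3 H4] := co_tr_map y; split=> //.
- split.
  + by move=> i j m g /H1.
  + by move=> i j m; exact: H2.
  + by move=> i j m; exact: H3.
  + by move=> i j T t g mt; apply: H4; exact: is_morphism_comp mt.
- by move=> i i' j m a g; exact: co_trM.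
- by move=> i i' j m a g; exact: co_trM.
Qed.

Definition pull_arr : fhom (f0 := stk G) f pull y := exist _ _ pull_arr_subproof.
End Pull.

Section Lift.
Variables (M N P : manifold R sp) (f : M -> N) (h : N -> P).
Variables (x : cocycle G M) (y : cocycle G N) (z : cocycle G P).
Variables (q : coc_hom h y z) (r : coc_hom (fun m => h (f m)) x z).
Hypothesis mf : is_morphism f.

(** In each index [k] of [z], the equation [b a = c] forces [a = b^-1 c]. *)
Definition lift_rel (i : cd_ind x) (j : cd_ind y) (m : M) : set (g1 G) :=
  [set a | exists k b c, [/\ sval q j k (f m) b, sval r i k m c &
    a = mul (inv b) c]].

Lemma lift_st i j k m b c : sval q j k (f m) b -> sval r i k m c -> tgt b = tgt c.
Proof. by move=> hb hc; rewrite (ch_tgt hb) (ch_tgt hc). Qed.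

Lemma lift_fun i j m a a' : lift_rel i j m a -> lift_rel i j m a' -> a = a'.
Proof.
move=> [k [b [c [hb hc ->]]]] [k' [b' [c' [hb' hc' ->]]]].
have [d hd] := ch_ex (coc_id z) (ch_dom2 hb) (ch_dom2 hb').
rewrite (ch_fun hb' (ch_actl hb hd)) (ch_fun hc' (ch_actl hc hd)).
have tb := ch_tgt hb; have tc := ch_tgt hc; have sd := ch_src (p := coc_id z) hd.
have e : src (mul d b) = tgt (mul (inv b) c).
  by rewrite src_mul ?tgt_mul ?tgt_inv // ?src_inv ?tb ?tc.
rewrite -(gmulKl e) -gmulA ?gmulVKl ?tb ?tc ?sd //.
by rewrite tgt_mul ?tgt_inv // src_inv tb tc.
Qed.

Lemma lift_subproof : coc_hom_ax f lift_rel.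
Proof.
split=> //.
- split.
  + move=> i j m _ [k [b [c [hb hc ->]]]]; have e := lift_st hb hc.
    split; [exact: ch_dom1 hc|exact: ch_dom1 hb| |].
      by rewrite src_mul ?src_inv // (ch_src hc).
    by rewrite tgt_mul ?src_inv // tgt_inv (ch_src hb).
  + move=> i j m hi hj; have [k hk] := cd_cover z (h (f m)).
    have [b hb] := ch_ex q hj hk; have [c hc] := ch_ex r hi hk.
    by exists (mul (inv b) c), k, b, c.
  + exact: lift_fun.
  + move=> i j T t g mt hg; apply: is_morphism_opens => s0.
    have [k hk] := cd_cover z (h (f (t s0))).
    have mft := is_morphism_comp mf mt.
    have mht := is_morphism_comp (ch_mor q) mft.
    have oV : open [set s | cd_dom k (h (f (t s)))].
      by apply: (open_comp (f := fun s => h (f (t s)))); [move=> s _; exact: mht.1|exact: cd_open].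
    exists _, oV; split=> //.
    have hf (s : opens oV) : exists ab, sval q j k (f (t (opens_val s))) ab.1 /\
        sval r i k (t (opens_val s)) ab.2.
      have hs := opens_valP s; have [j' [a' [b' [ha' hb' _]]]] := hg (opens_val s).
      have [a ha] := ch_ex q (ch_dom1 ha') hs.
      by have [b hb] := ch_ex r (ch_dom1 hb') hs; exists (a, b).
    pose ab s := projT1 (cid (hf s)); have abP s := projT2 (cid (hf s)).
    have mv := open_embedding_morphism (opens_val_embedding oV).
    have mtv := is_morphism_comp mt mv.
    rewrite (_ : (fun y => _) = fun s => mul (inv (ab s).1) (ab s).2).
      apply: mul_morphism.
      * apply: is_morphism_comp; first exact: inv_morphism.
        apply: (ch_smooth (p := q) (i := j) (j := k) (is_morphism_comp mf mtv)).
        by move=> s; exact: (abP s).1.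
      * apply: (ch_smooth (p := r) (i := i) (j := k) mtv).
        by move=> s; exact: (abP s).2.
      * by move=> s; have [h1 h2] := abP s; rewrite src_inv; exact: lift_st h1 h2.
    apply/funext => s; apply: lift_fun (hg _) _.
    by have [h1 h2] := abP s; exists k, (ab s).1, (ab s).2.
- move=> i i' j m d _ hd [k [b [c [hb hc ->]]]].
  exists k, b, (mul c d); split=> //; first exact: ch_actr hd hc.
  rewrite gmulA ?src_inv //; first exact: lift_st hb hc.
  by rewrite (ch_src hc) (ch_tgt (p := coc_id x) hd).
- move=> i j j' m _ d [k [b [c [hb hc ->]]]] hd.
  have [b' hb'] := ch_ex q (ch_dom2 (p := coc_id y) hd) (ch_dom2 hb).
  exists k, b', c; split=> //.
  have bE := ch_fun hb (ch_actr hd hb').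
  have sb' := ch_src hb'; have td := ch_tgt (p := coc_id y) hd.
  rewrite /= in td.
  have e : src b' = tgt d by rewrite sb' td.
  have tb := lift_st hb hc; have tb' := lift_st hb' hc.
  apply: (@gmulI _ _ _ b').
  + by rewrite e tgt_mul // tgt_mul ?src_inv // tgt_inv bE src_mul.
  + by rewrite tgt_mul ?tgt_inv ?src_inv.
  + rewrite gmulVKl // gmulA //; last first.
      by rewrite tgt_mul ?src_inv // tgt_inv bE src_mul.
    by rewrite -bE gmulVKl.
Qed.

Definition stk_lift : coc_hom f x y := exist _ _ lift_subproof.

Lemma stk_liftP : coc_comp q stk_lift = r.
Proof.
apply: coc_hom_eq => i k m g [j [a [b [[k' [b' [c' [hb' hc' ->]]]] hb ->]]]].
have [d hd] := ch_ex (coc_id z) (ch_dom2 hb') (ch_dom2 hb).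
rewrite (ch_fun hb (ch_actl hb' hd)).
rewrite -gmulA; last 2 first.
- by rewrite (ch_tgt hb') (ch_src (p := coc_id z) hd).
- by rewrite tgt_mul ?tgt_inv // src_inv; exact: lift_st hb' hc'.
rewrite gmulVKl; first exact: ch_actl hc' hd.
exact: lift_st hb' hc'.
Qed.
End Lift.

Lemma coc_comp_split M N P (f : M -> N) (h : N -> P) (x : cocycle G M)
    (y : cocycle G N) (z : cocycle G P) (q : coc_hom h y z) (p : coc_hom f x y)
    i j k m c a :
  sval (coc_comp q p) i k m c -> sval p i j m a ->
  exists2 b, sval q j k (f m) b & c = mul b a.
Proof.
move=> hc ha; have [b hb] := ch_ex q (ch_dom2 ha) (ch_dom2 hc).
exists b => //; apply: (ch_fun hc); by exists j, a, b.
Qed.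

Lemma stk_fibred : fibred (stk G).
Proof.
split=> [M N f y mf|M N P f h x y z q r mf].
  by exists (pull mf y); constructor; exact: pull_arr.
exists (stk_lift q r mf); split; first exact: stk_liftP.
move=> p' e; apply: coc_hom_eq => i j m g [k [b [c [hb hc ->]]]].
have hc' : sval (coc_comp q p') i k m c by rewrite (e : coc_comp q p' = r).
have [a ha] := ch_ex p' (ch_dom1 hc) (ch_dom1 hb).
have [b' hb' ->] := coc_comp_split hc' ha.
rewrite (ch_fun hb hb') gmulKl // (ch_src hb') (ch_tgt ha) //.
Qed.

Lemma stk_hom_sep : hom_sep (stk G).
Proof.
move=> M N f x y p q H; apply: coc_hom_eq => i j m g hg.
have [U [e [t [c [oe [u _ um] pq]]]]] := H m; subst m.
have [l hl] := cd_cover t u; have [d hd] := ch_ex c hl (ch_dom1 hg).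
have hpg : sval (coc_comp p c) l j u (mul g d) by exists i, d, g.
have : sval (coc_comp q c) l j u (mul g d) by rewrite -(pq : coc_comp p c = coc_comp q c).
move=> /coc_comp_split /(_ hd) [g' hg' e'].
suff -> : g = g' by [].
apply: gmulIr e'; first by rewrite (ch_src hg) (ch_tgt hd).
by rewrite (ch_src hg') (ch_tgt hd).
Qed.

(** The trivial torsor with anchor [u]. *)
Definition stk_eta_data M (u : {u : M -> g0 G | is_morphism u}) : coc_data G M :=
  @CocData _ _ G M unit (fun _ => setT) (fun _ => openT)
    (fun m => ex_intro _ tt I) (fun _ => sval u).

Lemma stk_eta_map M N (f : M -> N) u v (a : @pre_hom _ _ G M N f u v) :
  coc_map (x := stk_eta_data u) (y := stk_eta_data v) f
    (fun _ _ m => [set g | g = sval a m]).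
Proof.
case: a => a [mf ma sa ta]; split=> /=.
- by move=> _ _ m _ ->.
- by move=> _ _ m _ _; exists (a m).
- by move=> _ _ m g g' -> ->.
- move=> _ _ T t g mt e; rewrite (_ : g = fun s => a (t s)); last exact/funext.
  exact: is_morphism_comp.
Qed.

Definition stk_eta_ob M (u : {u : M -> g0 G | is_morphism u}) : cocycle G M.
Proof.
refine (@Cocycle _ _ G M (stk_eta_data u) _ (stk_eta_map (fid (f0 := prestack G) u)) _).
move=> _ _ _ m _ _ -> -> /=.
by rewrite -[X in mul (unt X)]tgt_unt mul_untl.
Defined.

Lemma stk_eta_subproof M N (f : M -> N) u v (a : @pre_hom _ _ G M N f u v) :
  coc_hom_ax (x := stk_eta_ob u) (y := stk_eta_ob v) f
    (fun _ _ m => [set g | g = sval a m]).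
Proof.
split; [exact: fhom_morphism (a : fhom (f0 := prestack G) f u v)|exact: stk_eta_map| |].
  move=> _ _ _ m _ _ /= -> ->; case: a => a [mf ma sa ta] /=.
  by rewrite -sa mul_untr.
move=> _ _ _ m _ _ /= -> ->; case: a => a [mf ma sa ta] /=.
by rewrite -ta mul_untl.
Qed.

Definition stk_eta : fibmor (prestack G) (stk G).
Proof.
refine (@Fibmor _ _ (prestack G) (stk G) stk_eta_ob
  (fun M N f u v p => exist _ _ (stk_eta_subproof p)) _ _).
- by move=> M u; apply: coc_hom_eq.
- move=> M N P f h u v w b a; apply: coc_hom_eq => i j m g /= ->.
  by exists tt, (sval a m), (sval b (f m)).
Defined.

Lemma stk_eta_ff : fully_faithful stk_eta.
Proof.
move=> M N f u v; apply: inj_surj_bij => [p p' pp|b].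
  apply: pre_hom_eq => m.
  have h : sval (fm_hom stk_eta p) tt tt m (sval p m) by [].
  by rewrite pp in h.
have hf m := cid (ch_ex (i := tt) (j := tt) (m := m) b I I).
pose a m := projT1 (hf m); have aP m : sval b tt tt m (a m) := projT2 (hf m).
unshelve eexists.
  exists a; split; first exact: ch_mor b.
  - by apply: (ch_smooth (p := b) (i := tt) (j := tt) (is_morphism_id M)) => s; exact: aP.
  - by move=> m; rewrite (ch_src (aP m)).
  - by move=> m; rewrite (ch_tgt (aP m)).
by apply: coc_hom_eq => -[] [] m _ /= ->; exact: aP.
Qed.

Lemma stk_eta_les : loc_ess_surj stk_eta.
Proof.
move=> M z m; have [i hi] := cd_cover z m.
have oU := cd_open (c := z) i.
have mv := open_embedding_morphism (opens_val_embedding oU).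
pose w (y : opens oU) := cd_anchor (c := z) i (opens_val y).
have mw : is_morphism w.
  (* Anchors are not assumed smooth. Smoothness follows because the anchor is the source of the
     transition from [i] to itself, which is the unit and smooth by the axioms of a cocycle. *)
  rewrite (_ : w = fun y => src (unt (w y))); last first.
    by apply/funext => y; rewrite src_unt.
  apply: is_morphism_comp; first exact: src_morphism.
  apply: (ch_smooth (p := coc_id z) (i := i) (j := i) mv) => y.
  exact: co_tr_refl (opens_valP y).
exists (opens oU), (@opens_val _ _ _ _ oU), (exist _ w mw); split.
- exact: opens_val_embedding.
- by rewrite opens_range.
constructor; exists (fun _ j y => co_tr (c := z) i j (opens_val y)).
have [H1 H2 H3 H4] := co_tr_map z; split=> //.
- split.
  + by move=> i0 j y g /H1 [].
  + by move=> i0 j y _; apply: H2; exact: opens_valP.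
  + by move=> i0 j y; exact: H3.
  + by move=> i0 j T t g mt; apply: H4; exact: is_morphism_comp mt.
- move=> i0 i1 j y d g /= -> hg; have [_ _ sg _] := H1 _ _ _ _ hg.
  by rewrite /w -sg mul_untr.
- by move=> i0 j j' y g b; exact: co_trM.
Qed.
End StkTheory.

Section StkStack.
Context (R : realType) (sp : geometry) (G : groupoid R sp).
Implicit Types M N P T U X : manifold R sp.
Local Notation iso x y := (fhom (fun m => m) x y).
Local Notation pt := (0%R : one_point R sp).

Lemma stk_hom_glue : hom_glue (stk G).
Proof.
move=> M N f x y K kt kc kd mf Kr Kc Kcov.
have K0 m : inhabited (K (one_point R sp) (fun _ => m)).
  have [U [e [oe [u _ <-] [k]]]] := Kcov m.
  exact: (Kr _ _ (fun _ => u) e (is_morphism_cst _ u) k).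
pose k0 m := inhabited_witness (K0 m).
(* The glued arrow [g] has to satisfy [g c = d], whence [d c^-1]. One test at each single point
   defines the relation, with no choice of a cover; [A1] then shows that every other test computes
   the same values. *)
pose A (i : cd_ind x) (j : cd_ind y) m := [set g | exists l c d,
  [/\ sval (kc _ _ (k0 m)) l i pt c, sval (kd _ _ (k0 m)) l j pt d &
      g = mul d (inv c)]].
have A1 T (u : T -> M) (k : K T u) t i j l c d : sval (kc _ _ k) l i t c ->
    sval (kd _ _ k) l j t d -> A i j (u t) (mul d (inv c)).
  move=> hc hd.
  have [jj ej] := @flift _ _ (stk G) (stk_fibred G) _ _ _ (fun _ => t) u _ _ _
    (kc _ _ k) (kc _ _ (k0 (u t))) (is_morphism_cst _ t).
  have ed := Kc _ _ (fun _ => t) u k (k0 (u t)) jj (esym ej).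
  have [l0 hl0] := cd_cover (kt _ _ (k0 (u t))) pt.
  have [e he] := ch_ex (j := l) jj hl0 (ch_dom1 hc).
  exists l0, (mul c e), (mul d e); split.
  - by rewrite -ej; exists l, e, c.
  - by rewrite ed; exists l, e, d.
  - by rewrite gquot // (ch_tgt he) ?(ch_src hc) ?(ch_src hd).
have Afun i j m g g' : A i j m g -> A i j m g' -> g = g'.
  move=> [l [c [d [hc hd ->]]]] [l' [c' [d' [hc' hd' ->]]]].
  have [e he] := ch_ex (coc_id (kt _ _ (k0 m))) (ch_dom1 hc) (ch_dom1 hc').
  rewrite (ch_fun hc (ch_actr he hc')) (ch_fun hd (ch_actr he hd')).
  have te := ch_tgt (p := coc_id (kt _ _ (k0 m))) he.
  by rewrite gquot // te ?(ch_src hc') ?(ch_src hd').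
have Aax : coc_hom_ax f A.
  split=> //.
  - split.
    + move=> i j m _ [l [c [d [hc hd ->]]]].
      have e : src d = src c by rewrite (ch_src hc) (ch_src hd).
      split; [exact: ch_dom2 hc|exact: ch_dom2 hd| |].
        by rewrite src_mul ?tgt_inv // src_inv (ch_tgt hc).
      by rewrite tgt_mul ?tgt_inv // (ch_tgt hd).
    + move=> i j m hi hj; have [l hl] := cd_cover (kt _ _ (k0 m)) pt.
      have [c hc] := ch_ex (j := i) (kc _ _ (k0 m)) hl hi.
      have [d hd] := ch_ex (j := j) (kd _ _ (k0 m)) hl hj.
      by exists (mul d (inv c)), l, c, d.
    + exact: Afun.
    (* The pointwise tests say nothing about smoothness. Near [s0] they are replaced by one test
       over an open embedding and one index [l], for which [c] and [d] vary smoothly. *)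
    + move=> i j T t g mt hg; apply: is_morphism_opens => s0.
      have [U [e [oe [u _ eu] [k]]]] := Kcov (t s0).
      have oW : open [set s | range e (t s)].
        apply: (open_comp (f := t)); first by move=> s _; exact: mt.1.
        by apply: etale_open openT; case: oe.
      have mv := open_embedding_morphism (opens_val_embedding oW).
      have [t' mt' et'] := open_embedding_lift oe (is_morphism_comp mt mv)
        (fun s => opens_valP s).
      have [v0 _ ev0] : range (@opens_val _ _ _ _ oW) s0.
        by rewrite opens_range; exists u.
      have [l hl] := cd_cover (kt _ _ k) (t' v0).
      have oV : open [set s | cd_dom l (t' s)].
        by apply: (open_comp (f := t')); [move=> s _; exact: mt'.1|exact: cd_open].
      have oVs : open (@opens_val _ _ _ _ oW @` [set s | cd_dom l (t' s)]).
        by apply: etale_open oV; case: (opens_val_embedding oW).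
      exists _, oVs; split; first by exists v0.
      have mv' := open_embedding_morphism (opens_val_embedding oVs).
      have [w mw ew] := open_embedding_lift (opens_val_embedding oW) mv'
        (fun s => let: ex_intro2 a _ e := opens_valP s in ex_intro2 _ _ a I e).
      have hf s : exists cd, sval (kc _ _ k) l i (t' (w s)) cd.1 /\
          sval (kd _ _ k) l j (t' (w s)) cd.2.
        have hw : cd_dom l (t' (w s)).
          have [a ha ea] := opens_valP s.
          suff -> : w s = a by [].
          apply: (opens_val_embedding oW).2; by rewrite ew.
        have ets : e (t' (w s)) = t (opens_val s) by rewrite et' ew.
        have [l' [c' [d' [hc' hd' _]]]] := hg (opens_val s).
        have h1 := ch_dom2 hc'; have h2 := ch_dom2 hd'; rewrite /= -ets in h1 h2.
        have [c hc] := ch_ex (j := i) (kc _ _ k) hw h1.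
        have [d hd] := ch_ex (j := j) (kd _ _ k) hw h2.
        by exists (c, d).
      pose cd s := projT1 (cid (hf s)); have cdP s := projT2 (cid (hf s)).
      rewrite (_ : (fun y => _) = fun s => mul (cd s).2 (inv (cd s).1)).
        have mtw := is_morphism_comp mt' mw.
        apply: mul_morphism.
        * apply: (ch_smooth (p := kd _ _ k) (i := l) (j := j) mtw) => s.
          exact: (cdP s).2.
        * apply: is_morphism_comp; first exact: inv_morphism.
          apply: (ch_smooth (p := kc _ _ k) (i := l) (j := i) mtw) => s.
          exact: (cdP s).1.
        * by move=> s; rewrite tgt_inv (ch_src (cdP s).1) (ch_src (cdP s).2).
      apply/funext => s; apply: Afun (hg _) _.
      have -> : t (opens_val s) = e (t' (w s)) by rewrite et' ew.
      by apply: A1; [exact: (cdP s).1|exact: (cdP s).2].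
  - move=> i i' j m a _ ha [l [c [d [hc hd ->]]]].
    have [c2 hc2] := ch_ex (j := i) (kc _ _ (k0 m)) (ch_dom1 hc) (ch_dom1 (p := coc_id x) ha).
    have cE := ch_fun hc (ch_actl hc2 ha).
    have e1 : src a = tgt c2.
      by rewrite (ch_tgt hc2); exact: (ch_src (p := coc_id x) ha).
    have e2 : src d = src c by rewrite (ch_src hc) (ch_src hd).
    have e3 : src d = src c2 by rewrite (ch_src hc2) (ch_src hd).
    have e4 : src (mul d (inv c)) = tgt a by rewrite src_mul ?tgt_inv // src_inv cE tgt_mul.
    exists l, c2, d; split=> //; apply: (@gmulIr _ _ _ c2).
    + by rewrite src_mul.
    + by rewrite src_mul ?src_inv ?tgt_inv.
    + by rewrite gmulVKr // -gmulA // -cE gmulVKr.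
  - move=> i j j' m _ b [l [c [d [hc hd ->]]]] hb.
    exists l, c, (mul b d); split=> //; first exact: ch_actl hd hb.
    rewrite gmulA ?tgt_inv ?(ch_src hc) ?(ch_src hd) // (ch_tgt hd).
    exact: (ch_src (p := coc_id y) hb).
exists (exist _ A Aax) => T u k; apply: coc_hom_eq => l j t g [i [c [a [hc [l0 [c0 [d0 [hc0 hd0 ->]]]] ->]]]].
have [d hd] := ch_ex (j := j) (kd _ _ k) (ch_dom1 hc) (ch_dom2 hd0).
have -> : mul d0 (inv c0) = mul d (inv c).
  by apply: (@Afun i j (u t)); [exists l0, c0, d0|exact: A1 hc hd].
by rewrite gmulVKr // (ch_src hc) (ch_src hd).
Qed.

End StkStack.

(** * Gluing cocycles along a covering sieve *)

Section ObjGlue.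
Context (R : realType) (sp : geometry) (G : groupoid R sp).
Implicit Types N P T U X : manifold R sp.
Local Notation iso x y := (fhom (fun m => m) x y).
Local Notation pt := (0%R : one_point R sp).
Variables (M : manifold R sp) (S : sieve M) (s : fibmor (sieve_fib S) (stk G)).
Hypothesis cS : covering S.

Lemma sieve_point (x : M) : S (one_point R sp) (fun _ => x).
Proof.
have [U [e [oe [u _ <-] h]]] := cS x.
exact: (sv_comp (is_morphism_cst _ u) h).
Qed.

(** Keeping the equation as a field lets tests through different members of the sieve share one base
    point [x], over which they are compared. *)
Record ptest (x : M) := PTest {
  pt_T : manifold R sp;
  pt_u : pt_T -> M;
  pt_h : S pt_T pt_u;
  pt_t : pt_T;
  pt_E : pt_u pt_t = x }.

Definition pt_s x (p : ptest x) : cocycle G (pt_T p) := s _ (sieve_ob (pt_h p)).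

Lemma pt_arr_subproof x (p : ptest x) :
  is_morphism (fun _ : one_point R sp => pt_t p) /\
  (fun _ : one_point R sp => x) = (fun _ => pt_u (pt_t p)).
Proof. by split; [exact: is_morphism_cst|rewrite pt_E]. Qed.

Definition pt_arr x (p : ptest x) :
  fhom (fun _ => pt_t p) (sieve_ob (sieve_point x)) (sieve_ob (pt_h p)) :=
  pt_arr_subproof p.

Definition pt_ev x (p : ptest x) : coc_hom (fun _ => pt_t p)
  (s _ (sieve_ob (sieve_point x))) (pt_s p) := fm_hom s (pt_arr p).

(* Over x, the restrictions of two local objects are compared through the
   object s assigns to the point x. *)
Definition cmp x (p p' : ptest x) (i : cd_ind (pt_s p)) (i' : cd_ind (pt_s p')) :
  set (g1 G) := [set g | exists l a b, [/\ sval (pt_ev p) l i pt a,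
    sval (pt_ev p') l i' pt b & g = mul b (inv a)]].

Section Cmp.
Variables (x : M).
Implicit Types (p q r : ptest x).

Lemma cmp_st p q l i j a b : sval (pt_ev p) l i pt a -> sval (pt_ev q) l j pt b ->
  src b = src a.
Proof. by move=> ha hb; rewrite (ch_src ha) (ch_src hb). Qed.

Lemma cmp_dom1 p q i j g : cmp (p := p) (p' := q) i j g -> cd_dom i (pt_t p).
Proof. by move=> [l [a [b [ha hb _]]]]; exact: ch_dom2 ha. Qed.

Lemma cmp_dom2 p q i j g : cmp (p := p) (p' := q) i j g -> cd_dom j (pt_t q).
Proof. by move=> [l [a [b [ha hb _]]]]; exact: ch_dom2 hb. Qed.

Lemma cmp_src p q i j g : cmp (p := p) (p' := q) i j g ->
  src g = cd_anchor i (pt_t p).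
Proof.
move=> [l [a [b [ha hb ->]]]]; rewrite src_mul ?src_inv ?(ch_tgt ha) //.
by rewrite tgt_inv (cmp_st ha hb).
Qed.

Lemma cmp_tgt p q i j g : cmp (p := p) (p' := q) i j g ->
  tgt g = cd_anchor j (pt_t q).
Proof.
move=> [l [a [b [ha hb ->]]]]; rewrite tgt_mul ?(ch_tgt hb) //.
by rewrite tgt_inv (cmp_st ha hb).
Qed.

Lemma cmp_ex p q (i : cd_ind (pt_s p)) (j : cd_ind (pt_s q)) :
  cd_dom i (pt_t p) -> cd_dom j (pt_t q) -> exists g, cmp i j g.
Proof.
move=> hi hj; have [l hl] := cd_cover (s _ (sieve_ob (sieve_point x))) pt.
have [a ha] := ch_ex (j := i) (pt_ev p) hl hi.
have [b hb] := ch_ex (j := j) (pt_ev q) hl hj.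
by exists (mul b (inv a)), l, a, b.
Qed.

(** With [e] the transition at the point between the two auxiliary indices, [b = a' e]; hence
    [(b' a'^-1) (b a^-1)] collapses to [(b' e) a^-1]. *)
Lemma cmp_comp p q r i j k g g' : cmp (p := p) (p' := q) i j g ->
  cmp (p := q) (p' := r) j k g' -> cmp (p := p) (p' := r) i k (mul g' g).
Proof.
move=> [l [a [b [ha hb ->]]]] [l' [a' [b' [ha' hb' ->]]]].
have [e he] := ch_ex (coc_id (s _ (sieve_ob (sieve_point x)))) (ch_dom1 ha) (ch_dom1 ha').
have bE := ch_fun hb (ch_actr he ha').
have te := ch_tgt (p := coc_id (s _ (sieve_ob (sieve_point x)))) he.
have se := ch_src (p := coc_id (s _ (sieve_ob (sieve_point x)))) he.
rewrite /= in te se.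
have e1 : src a' = tgt e by rewrite te (ch_src ha').
have e2 : src b' = tgt e by rewrite te (ch_src hb').
have e3 : src e = src a by rewrite se (ch_src ha).
have e4 : src (mul b' (inv a')) = tgt a' by rewrite src_mul ?src_inv // tgt_inv e1 e2.
have e5 : src (mul b' e) = src a by rewrite src_mul.
have e6 : src (mul a' e) = src a by rewrite src_mul.
have e7 : tgt (mul (mul a' e) (inv a)) = tgt a' by rewrite tgt_mul ?tgt_inv // tgt_mul.
exists l, a, (mul b' e); split=> //; first exact: ch_actr he hb'.
apply: (@gmulIr _ _ _ a).
- by rewrite src_mul ?bE ?e7 // src_mul ?src_inv // tgt_inv.
- by rewrite src_mul ?src_inv // tgt_inv.
have s1 : src (mul b' (inv a')) = tgt (mul (mul a' e) (inv a)) by rewrite e4 e7.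
have s2 : src (mul (mul a' e) (inv a)) = tgt a by rewrite src_mul ?src_inv // tgt_inv e6.
have s3 : src b' = src a' by rewrite e1 e2.
by rewrite bE (gmulVKr e5) -(gmulA s1 s2) (gmulVKr e6) (gmulA e4 e1) (gmulVKr s3).
Qed.

Lemma cmp_tr p i i' g : co_tr (c := pt_s p) i i' (pt_t p) g ->
  cmp (p := p) (p' := p) i i' g.
Proof.
move=> hg; have [l hl] := cd_cover (s _ (sieve_ob (sieve_point x))) pt.
have [a ha] := ch_ex (j := i) (pt_ev p) hl (ch_dom1 (p := coc_id (pt_s p)) hg).
exists l, a, (mul g a); split=> //; first exact: ch_actl ha hg.
rewrite gmulKr // (ch_tgt ha); exact: (ch_src (p := coc_id (pt_s p)) hg).
Qed.

Lemma cmp_fun p q i j g g' : cmp (p := p) (p' := q) i j g ->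
  cmp (p := p) (p' := q) i j g' -> g = g'.
Proof.
move=> [l [a [b [ha hb ->]]]] [l' [a' [b' [ha' hb' ->]]]].
have [e he] := ch_ex (coc_id (s _ (sieve_ob (sieve_point x)))) (ch_dom1 ha) (ch_dom1 ha').
rewrite (ch_fun ha (ch_actr he ha')) (ch_fun hb (ch_actr he hb')).
have te := ch_tgt (p := coc_id (s _ (sieve_ob (sieve_point x)))) he.
by rewrite gquot // te ?(ch_src ha') ?(ch_src hb').
Qed.

(** The arrow from the point [x] to [v] factors through [al], so by functoriality of [s] the values
    of [s] on [al] are comparison arrows. *)
Lemma cmp_nat T T' (u : T -> M) (v : T' -> M) h hv (F : T -> T')
    (al : fhom F (sieve_ob (S := S) (u := u) h) (sieve_ob (S := S) (u := v) hv))
    t (E : u t = x) (E' : v (F t) = x) i i' g :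
  sval (fm_hom s al : coc_hom _ _ _) i i' t g ->
  cmp (p := PTest h E) (p' := PTest hv E') i i' g.
Proof.
move=> hg; have [l hl] := cd_cover (s _ (sieve_ob (sieve_point x))) pt.
have [a ha] := ch_ex (j := i) (pt_ev (PTest h E)) hl (ch_dom1 hg).
exists l, a, (mul g a); split=> //; last first.
  by rewrite gmulKr // (ch_tgt ha) (ch_src hg).
have -> : pt_ev (PTest hv E') = coc_comp (fm_hom s al) (pt_ev (PTest h E)).
  rewrite /pt_ev; etransitivity; last exact: (fm_comp s al (pt_arr (PTest h E))).
  exact: (congr1 (fun z : fhom (fun _ => F t) (sieve_ob (sieve_point x)) (sieve_ob hv) =>
    fm_hom s z) (@Prop_irrelevance (_ /\ _) _ _)).
by exists i, a, g.
Qed.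
End Cmp.

(** Comparisons are defined one point at a time. Over [X] both tests restrict to the same member of
    the sieve, and there the comparison is the quotient of the smooth arrows that [s] assigns to the
    two restrictions. *)
Lemma cmp_smooth X T T' (u : T -> M) (u' : T' -> M) (h : S T u) (h' : S T' u')
    (t : X -> T) (t' : X -> T') (i : cd_ind (s _ (sieve_ob h)))
    (i' : cd_ind (s _ (sieve_ob h'))) (g : X -> g1 G)
    (E : forall y, u' (t' y) = u (t y)) :
  is_morphism t -> is_morphism t' ->
  (forall y, cmp (p := PTest h (erefl (u (t y)))) (p' := PTest h' (E y)) i i' (g y)) ->
  is_morphism g.
Proof.
move=> mt mt' hg.
have hw : S X (fun y => u (t y)) by exact: sv_comp.
pose al : fhom t (sieve_ob hw) (sieve_ob h) := conj mt erefl.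
have Ew : (fun y => u (t y)) = (fun y => u' (t' y)) by apply/funext => y; rewrite E.
pose al' : fhom t' (sieve_ob hw) (sieve_ob h') := conj mt' Ew.
apply: is_morphism_opens => y0.
have [l hl] := cd_cover (s _ (sieve_ob hw)) y0.
have oV := cd_open (c := s _ (sieve_ob hw)) l.
exists _, oV; split=> //.
have mv := open_embedding_morphism (opens_val_embedding oV).
have hf (y : opens oV) : exists ab,
    sval (fm_hom s al : coc_hom _ _ _) l i (opens_val y) ab.1 /\
    sval (fm_hom s al' : coc_hom _ _ _) l i' (opens_val y) ab.2.
  have [a ha] := ch_ex (j := i) (fm_hom s al : coc_hom _ _ _) (opens_valP y)
    (cmp_dom1 (hg (opens_val y))).
  have [b hb] := ch_ex (j := i') (fm_hom s al' : coc_hom _ _ _) (opens_valP y)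
    (cmp_dom2 (hg (opens_val y))).
  by exists (a, b).
pose ab y := projT1 (cid (hf y)); have abP y := projT2 (cid (hf y)).
have st y : src (ab y).2 = src (ab y).1.
  by rewrite (ch_src (abP y).1) (ch_src (abP y).2).
rewrite (_ : (fun y => _) = fun y => mul (ab y).2 (inv (ab y).1)).
  apply: mul_morphism.
  - exact: (ch_smooth (p := fm_hom s al' : coc_hom _ _ _) mv (fun y => (abP y).2)).
  - apply: is_morphism_comp; first exact: inv_morphism.
    exact: (ch_smooth (p := fm_hom s al : coc_hom _ _ _) mv (fun y => (abP y).1)).
  - by move=> y; rewrite tgt_inv st.
apply/funext => y.
have h1 := cmp_nat (erefl : u (t (opens_val y)) = _) erefl (abP y).1.
have h2 := cmp_nat (erefl : u (t (opens_val y)) = _) (E _) (abP y).2.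
have h3 := cmp_fun h2 (cmp_comp h1 (hg (opens_val y))).
rewrite h3 gmulKr // (cmp_src (hg (opens_val y))) /=.
exact: esym (ch_tgt (abP y).1).
Qed.

Lemma glue_pick (m : M) : {U : manifold R sp & {e : U -> M |
  [/\ manifold_open_embedding e, range e m & S U e]}}.
Proof. by have [U hU] := cid (cS m); exists U; exact: cid. Qed.

Definition ce (m : M) := sval (projT2 (glue_pick m)).
Arguments ce : clear implicits.

Lemma ce_emb m : manifold_open_embedding (ce m).
Proof. by rewrite /ce; case: (projT2 (glue_pick m)) => e []. Qed.

Lemma ce_range m : range (ce m) m.
Proof. by rewrite /ce; case: (projT2 (glue_pick m)) => e []. Qed.

Lemma ce_S m : S _ (ce m).
Proof. by rewrite /ce; case: (projT2 (glue_pick m)) => e []. Qed.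

(** A retraction of the chosen embedding; off its range the value is a default that merely makes the
    function total. *)
Definition ce_r (m x : M) : projT1 (glue_pick m) :=
  if pselect (range (ce m) x) is left E then projT1 (cid2 E)
  else projT1 (cid2 (ce_range m)).

Lemma ce_rK m n : ce_r m (ce m n) = n.
Proof.
rewrite /ce_r; case: pselect => [E|[]]; last by exists n.
by case: (cid2 E) => n' /= _; exact: (ce_emb m).2.
Qed.

Definition glue_data : coc_data G M.
Proof.
refine (@CocData _ _ G M {m : M & cd_ind (s _ (sieve_ob (ce_S m)))}
  (fun p => ce (projT1 p) @` cd_dom (projT2 p)) _ _
  (fun p x => cd_anchor (projT2 p) (ce_r (projT1 p) x))).
- move=> [m i] /=; apply: etale_open (cd_open _); exact: (ce_emb m).1.
- move=> m; have [n _ en] := ce_range m.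
  have [i hi] := cd_cover (s _ (sieve_ob (ce_S m))) n.
  by exists (existT _ m i), n.
Defined.

(** Compares an arbitrary member of the sieve with the chosen embeddings. Applied to a chosen
    embedding it yields the transitions of the glued cocycle, and in general the arrows of the cone,
    so both inherit their laws from [cmp]. *)
Definition glue_rel T (u : T -> M) (h : S T u) (i : cd_ind (s _ (sieve_ob h)))
    (p : cd_ind glue_data) (t : T) : set (g1 G) :=
  [set g | exists n' (E : ce (projT1 p) n' = u t),
    cmp (p := PTest h (erefl (u t))) (p' := PTest (ce_S (projT1 p)) E) i (projT2 p) g].

Lemma glue_rel_map T (u : T -> M) (h : S T u) :
  coc_map (x := s _ (sieve_ob h) : cocycle G T) (y := glue_data) u (@glue_rel T u h).
Proof.
split.
- move=> i [m j] t g [n [E hg]]; split.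
  + exact: cmp_dom1 hg.
  + by exists n => //; exact: cmp_dom2 hg.
  + exact: cmp_src hg.
  + have e : ce_r m (u t) = n by rewrite -(E : ce m n = u t) ce_rK.
    by rewrite (cmp_tgt hg) /= e.
- move=> i [m j] t hi [n hn E].
  have [g hg] := cmp_ex (p := PTest h (erefl (u t))) (q := PTest (ce_S m) E) hi hn.
  by exists g, n, E.
- move=> i [m j] t g g' [n [E hg]] [n' [E' hg']].
  have nn : n = n' by apply: (ce_emb m).2; exact: etrans E (esym E').
  subst n'; rewrite (Prop_irrelevance E' E) in hg'; exact: cmp_fun hg hg'.
- move=> i [m j] X t g mt hg.
  have mu := sv_morphism h.
  have [|t' mt' et'] := open_embedding_lift (ce_emb m) (is_morphism_comp mu mt).
    by move=> y; have [n [E _]] := hg y; exists n.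
  apply: (cmp_smooth (t := t) (t' := t') (i := i) (i' := j) (E := et') mt mt') => y.
  have [n [E hgy]] := hg y; have nn : n = t' y by apply: (ce_emb m).2; rewrite et'.
  by subst n; rewrite (Prop_irrelevance (et' y) E).
Qed.

Lemma glue_tr_map : coc_map (x := glue_data) (y := glue_data) (fun m => m)
  (fun p q m => [set g | exists n (E : ce (projT1 p) n = m),
     glue_rel (h := ce_S (projT1 p)) (projT2 p) q n g]).
Proof.
split.
- move=> p q _ g [n [<- hg]]; have [H1 _ _ _] := glue_rel_map (ce_S (projT1 p)).
  have [h1 h2 h3 h4] := H1 _ _ _ _ hg; split=> //; first by exists n.
  by rewrite h3 /= ce_rK.
- move=> p q _ [n hn <-] hq; have [_ H2 _ _] := glue_rel_map (ce_S (projT1 p)).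
  by have [g hg] := H2 (projT2 p) q n hn hq; exists g, n, erefl.
- move=> p q m g g' [n [E hg]] [n' [E' hg']].
  have nn : n = n' by apply: (ce_emb _).2; exact: etrans E (esym E').
  by subst n'; have [_ _ H3 _] := glue_rel_map (ce_S (projT1 p)); exact: H3 hg hg'.
- move=> p q X t g mt hg; have [_ _ _ H4] := glue_rel_map (ce_S (projT1 p)).
  have [|t' mt' et'] := open_embedding_lift (ce_emb (projT1 p)) mt.
    by move=> y; have [n [E _]] := hg y; exists n.
  apply: (H4 (projT2 p) q X t' g mt') => y.
  have [n [E hgy]] := hg y; suff <- : n = t' y by [].
  by apply: (ce_emb (projT1 p)).2; rewrite et'.
Qed.

Lemma glue_rel_comp T (u : T -> M) (h : S T u) (i : cd_ind (s _ (sieve_ob h)))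
    (p q : cd_ind glue_data) t g g' :
  glue_rel i p t g ->
  (exists n (E : ce (projT1 p) n = u t),
     glue_rel (h := ce_S (projT1 p)) (projT2 p) q n g') ->
  glue_rel i q t (mul g' g).
Proof.
move=> [n [E hg]] [n' [E' [n2 [E2 hg']]]].
have nn : n' = n by apply: (ce_emb _).2; exact: etrans E' (esym E).
subst n'; have E3 := etrans E2 E.
exists n2, E3; apply: cmp_comp hg _.
move: (u t) E E3 {E'} => x E E3; subst x.
by rewrite (Prop_irrelevance E3 E2).
Qed.

Lemma glue_trM (p q r : cd_ind glue_data) m a b :
  (exists n (E : ce (projT1 p) n = m),
     glue_rel (h := ce_S (projT1 p)) (projT2 p) q n a) ->
  (exists n (E : ce (projT1 q) n = m),
     glue_rel (h := ce_S (projT1 q)) (projT2 q) r n b) ->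
  (exists n (E : ce (projT1 p) n = m),
     glue_rel (h := ce_S (projT1 p)) (projT2 p) r n (mul b a)).
Proof.
move=> [n [E ha]] hb; exists n, E; apply: glue_rel_comp ha _.
by rewrite E.
Qed.

Definition glue_ob : cocycle G M := Cocycle glue_tr_map glue_trM.

Lemma glue_arr_subproof T (u : T -> M) (h : S T u) :
  coc_hom_ax (x := s _ (sieve_ob h) : cocycle G T) (y := glue_ob) u (@glue_rel T u h).
Proof.
split; [exact: sv_morphism h|exact: glue_rel_map| |].
  move=> i i' p t a g ha [n [E hg]]; exists n, E.
  apply: cmp_comp hg; exact: (cmp_tr (p := PTest h (erefl (u t)))).
by move=> i p q t g b hg hb; exact: glue_rel_comp hg hb.
Qed.

Definition glue_arr T (u : T -> M) (h : S T u) :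
  fhom (f0 := stk G) u (s T (sieve_ob h)) glue_ob := exist _ _ (glue_arr_subproof h).

Lemma glue_cone : is_cone (s := s) (z := glue_ob) glue_arr.
Proof.
move=> T T' f v h hv mf; apply: coc_hom_eq => i p t g.
move=> [j [a [b [ha [n [E hb]] ->]]]]; exists n, E.
apply: cmp_comp hb; exact: cmp_nat ha.
Qed.
End ObjGlue.

(** * Recognising associated stacks *)

Section Assoc.
Context (R : realType) (sp : geometry) (G : groupoid R sp).
Implicit Types M N P T U X : manifold R sp.

Lemma isomorphic_assoc (F H K L : fibcat R sp) (p : fibmor F H) (q : fibmor H K)
    (r : fibmor K L) :
  isomorphic (fibcomp (fibcomp r q) p) (fibcomp r (fibcomp q p)).
Proof.
constructor; refine (@Fibtrans _ _ F L (fibcomp (fibcomp r q) p) (fibcomp r (fibcomp q p))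
  (fun M x => fid (r M (q M (p M x)))) _) => M N f x y a.
exact: etrans (fcomp1 _) (esym (f1comp _)).
Qed.

Lemma isomorphic_assocV (F H K L : fibcat R sp) (p : fibmor F H) (q : fibmor H K)
    (r : fibmor K L) :
  isomorphic (fibcomp r (fibcomp q p)) (fibcomp (fibcomp r q) p).
Proof.
constructor; refine (@Fibtrans _ _ F L (fibcomp r (fibcomp q p)) (fibcomp (fibcomp r q) p)
  (fun M x => fid (r M (q M (p M x)))) _) => M N f x y a.
exact: etrans (fcomp1 _) (esym (f1comp _)).
Qed.

Lemma isomorphic_idl (F H : fibcat R sp) (p : fibmor F H) :
  isomorphic p (fibcomp (fibid H) p).
Proof.
constructor; refine (@Fibtrans _ _ F H p (fibcomp (fibid H) p)
  (fun M x => fid (p M x)) _) => M N f x y a.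
exact: etrans (fcomp1 _) (esym (f1comp _)).
Qed.

Lemma stk_is_stack : is_stack (stk G).
Proof.
apply: is_stack_intro; [exact: stk_fibred|exact: stk_hom_sep|exact: stk_hom_glue|].
by move=> M S s cS; exists (glue_ob s cS), (@glue_arr _ _ _ _ _ s cS); exact: glue_cone.
Qed.

Lemma prestack_fibred : fibred (prestack G).
Proof.
split=> [M N f v mf|M N P f h u v w b c mf].
  exists (exist _ (fun m => sval v (f m)) (is_morphism_comp (proj2_sig v) mf)).
  constructor; exists (fun m => unt (sval v (f m))); split=> //.
  - apply: is_morphism_comp (unt_morphism G) _; exact: is_morphism_comp (proj2_sig v) mf.
  - by move=> m; rewrite src_unt.
  - by move=> m; rewrite tgt_unt.
have [_ mb sb tb] := proj2_sig b; have [_ mc sc tc] := proj2_sig c.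
have st m : tgt (sval b (f m)) = tgt (sval c m) by rewrite tb tc.
unshelve eexists.
  exists (fun m => mul (inv (sval b (f m))) (sval c m)); split=> //.
  - apply: mul_morphism => //; last by move=> m; rewrite src_inv.
    by apply: is_morphism_comp (inv_morphism G) _; exact: is_morphism_comp mb mf.
  - by move=> m; rewrite src_mul ?src_inv.
  - by move=> m; rewrite tgt_mul ?src_inv // tgt_inv sb.
split; first by apply: pre_hom_eq => m /=; rewrite gmulVKl.
move=> a' e; have [_ ma sa ta] := proj2_sig a'.
apply: pre_hom_eq => m /=.
have -> : sval c m = mul (sval b (f m)) (sval a' m) by rewrite -e.
by rewrite gmulKl // sb ta.
Qed.

Lemma dense_associated (F : fibcat R sp) (eta : fibmor (prestack G) F) :
  is_stack F -> fully_faithful eta -> loc_ess_surj eta -> associated_stack eta.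
Proof.
move=> sF ef le; split=> // H sH.
exact: dense_precomp prestack_fibred sF.1 sH ef le.
Qed.

Lemma stk_associated : associated_stack (stk_eta G).
Proof.
by apply: dense_associated; [exact: stk_is_stack|exact: stk_eta_ff|exact: stk_eta_les].
Qed.

Lemma associated_dense (F : fibcat R sp) (eta : fibmor (prestack G) F) :
  associated_stack eta -> fully_faithful eta /\ loc_ess_surj eta.
Proof.
move=> [sF uF]; have sS := stk_is_stack; have [_ uS] := stk_associated.
have fP := prestack_fibred.
have [/(_ (stk_eta G))[r hr] _] := uF _ sS.
have [/(_ eta)[s hs] _] := uS _ sF.
have sr : isomorphic (fibcomp s r) (fibid F).
  have [_ u2] := uF _ sF.
  have [t] : isomorphic (fibcomp (fibcomp s r) eta) (fibcomp (fibid F) eta).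
    apply: isomorphic_trans (isomorphic_assoc _ _ _) _.
    apply: isomorphic_trans (isomorphic_postcomp s hr) _.
    exact: isomorphic_trans hs (isomorphic_idl _).
  by have [v _] := u2 (fibcomp s r) (fibid F) t; constructor.
have [t] := sr.
(* As [s r] is isomorphic to the identity, [r] is faithful; full faithfulness of [eta] then follows
   from that of [r eta]. *)
have fr M N (f : M -> N) (x : fob F M) (y : fob F N) (a b : fhom f x y) :
    fm_hom r a = fm_hom r b -> a = b.
  move=> ab; have [ti [tti _]] := finv sF.1 (t M x).
  have e : (fcomp a (t M x) : fhom f _ _) = fcomp b (t M x).
    etransitivity; first exact: (ft_nat t a).
    etransitivity; last exact: esym (ft_nat t b).
    by rewrite /= ab.
  have A1 := fcompA ti (t M x) a; have A2 := fcompA ti (t M x) b.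
  have E := congr1 (fun u : fhom f _ _ => (fcomp u ti : fhom f _ _)) e.
  have {E} := etrans A1 (etrans E (esym A2)).
  have -> : fcomp (t M x) ti = fid _ by [].
  by rewrite (fcomp1 a) (fcomp1 b).
have fre := isomorphic_ff sS.1 (isomorphic_sym sS.1 hr) (@stk_eta_ff _ _ G).
split.
  move=> M N f x y; apply: inj_surj_bij => [a b ab|b].
    by apply: (ff_inj fre); rewrite /= ab.
  have [a ea] := ff_surj (p := fibcomp r eta) (x := x) (y := y) (fm_hom r b) fre.
  by exists a; apply: fr.
(* A local preimage of [r z] in the stack of cocycles is carried back to [F] by [s]. *)
move=> M z m; have [U [e [w [oe re [c]]]]] := @stk_eta_les _ _ G M (r M z) m.
have [hs'] := isomorphic_sym sF.1 hs.
exists U, e, w; split=> //; constructor.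
exact: (fcomp (t M z) (fcomp (fm_hom s c) (hs' U w))).
Qed.
End Assoc.

(** * Open embeddings of orbifolds *)

Section FibreProduct.
Context (R : realType) (sp : geometry).
Implicit Types X Y Z F : fibcat R sp.
Implicit Types M N P T U W : manifold R sp.
Local Notation iso x y := (fhom (fun m => m) x y).
Local Notation fh F f x y := (@fhom R sp F _ _ f x y).

Lemma fp_square X Y Z (p : fibmor X Z) (q : fibmor Y Z) M N P (f : M -> N) (g : N -> P)
    (x1 : fob X M) (x2 : fob Y M) (i : iso (p M x1) (q M x2))
    (y1 : fob X N) (y2 : fob Y N) (j : iso (p N y1) (q N y2))
    (z1 : fob X P) (z2 : fob Y P) (k : iso (p P z1) (q P z2))
    (a1 : fhom f x1 y1) (a2 : fhom f x2 y2) (b1 : fhom g y1 z1) (b2 : fhom g y2 z2) :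
  fibred Z -> (fcomp (fm_hom q b2) j : fh Z g _ _) = fcomp k (fm_hom p b1) ->
  (fcomp (fm_hom q (fcomp b2 a2)) i : fh Z (fun m => g (f m)) _ _) =
    fcomp k (fm_hom p (fcomp b1 a1)) ->
  (fcomp (fm_hom q a2) i : fh Z f _ _) = fcomp j (fm_hom p a1).
Proof.
move=> fZ sb sc; apply: (@fcancel _ _ Z fZ _ _ _ f g _ _ _ (fm_hom q b2)).
have A1 := fcompA i (fm_hom q a2) (fm_hom q b2).
have A2 := fcompA (fm_hom p a1) j (fm_hom q b2).
have A3 := fcompA (fm_hom p a1) (fm_hom p b1) k.
etransitivity; first exact: A1.
etransitivity; first exact: (congr1 (fun t => fcomp t i) (esym (fm_comp q b2 a2))).
etransitivity; first exact: sc.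
etransitivity; first exact: (congr1 (fun t => fcomp k t) (fm_comp p b1 a1)).
etransitivity; first exact: A3.
etransitivity; last exact: esym A2.
exact: (congr1 (fun t => fcomp t (fm_hom p a1)) (esym sb)).
Qed.

Lemma fp_lift X Y Z (p : fibmor X Z) (q : fibmor Y Z) M N P (f : M -> N) (g : N -> P)
    (x : fp_ob p q M) (y : fp_ob p q N) (z : fp_ob p q P)
    (b : fp_hom g y z) (c : fp_hom (fun m => g (f m)) x z) :
  fibred X -> fibred Y -> fibred Z -> is_morphism f ->
  exists a : fp_hom f x y,
    [/\ fcomp (sval b).1 (sval a).1 = (sval c).1,
        fcomp (sval b).2 (sval a).2 = (sval c).2 &
        forall a' : fp_hom f x y, fcomp (sval b).1 (sval a').1 = (sval c).1 ->
          fcomp (sval b).2 (sval a').2 = (sval c).2 -> a = a'].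
Proof.
case: b c => [[b1 b2] /= sb] [[c1 c2] /= sc] fX fY fZ mf.
have [a1 e1] := flift fX b1 c1 mf; have [a2 e2] := flift fY b2 c2 mf.
rewrite -e1 -e2 in sc *; exists (exist _ (a1, a2) (fp_square fZ sb sc)); split=> //=.
move=> a' e1' e2'; apply: fp_hom_eq; case: a' e1' e2' => [[a1' a2'] _] /= e1' e2'.
by rewrite (fcancel fX e1') (fcancel fY e2').
Qed.

Lemma fp_fibred X Y Z (p : fibmor X Z) (q : fibmor Y Z) :
  fibred X -> fibred Y -> fibred Z -> fibred (fibre_product p q).
Proof.
move=> fX fY fZ; split=> [M N f B mf|M N P f g x y z b c mf].
  have [u [xi]] := fX.1 _ _ f (fp1 B) mf; have [v [ups]] := fY.1 _ _ f (fp2 B) mf.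
  have [i ei] := flift1 fZ (fm_hom q ups) (fcomp (fp_iso B) (fm_hom p xi)).
  by exists (FpOb i); constructor; exists (xi, ups).
have [a [e1 e2 ua]] := fp_lift b c fX fY fZ mf.
exists a; split=> [|a' ea].
  by apply: fp_hom_eq; rewrite [LHS]/= e1 e2; case: (sval c).
by apply: ua; rewrite -ea.
Qed.

Lemma yoneda_fibred M : fibred (yoneda M).
Proof.
split=> [N T f y mf|N T P f g x y z b c mf].
  have h : is_morphism (fun m => sval y (f m)) by exact: is_morphism_comp (proj2_sig y) mf.
  by exists (exist _ _ h); constructor; split.
have [mg yz] := b; have [mgf xz] := c.
exists (conj mf (etrans xz (esym (congr1 (fun k m => k (f m)) yz)))).
by split=> [|a' _]; exact: (@Prop_irrelevance (_ /\ _)).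
Qed.

Section OpenEmbedding.
Variables (X Y : fibcat R sp) (F : fibmor X Y).
Hypotheses (sX : is_stack X) (sY : is_stack Y).
Let fX := sX.1.
Let fY := sY.1.
Variables (G : groupoid R sp) (eta : fibmor (prestack G) Y).
Hypothesis pe : presentation eta.
Local Notation pm := (presentation_map eta).
Local Notation fp := (fibre_product F pm).
Variables (W : manifold R sp) (e : W -> g0 G) (E : fibmor (yoneda W) fp).
Hypothesis oe : manifold_open_embedding e.
Hypothesis eqE : equivalence E.
Hypothesis eE : forall M (u : fob (yoneda W) M) m,
  sval (fp2 (E M u)) m = e (sval u m).

Let ffp : fibred fp := @fp_fibred _ _ _ F pm fX (@yoneda_fibred (g0 G)) fY.

(** Through [E], objects of the fibre product are maps to [W], and injectivity of [e] lets them be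
    recognised in [g0]. So an arrow over [f] exists, and is unique, as soon as the maps to [g0]
    match. *)
Lemma oe_fp_hom M N (f : M -> N) (A : fob fp M) (B : fob fp N) : is_morphism f ->
  (forall m, sval (fp2 A) m = sval (fp2 B) (f m)) ->
  exists h : fhom f A B, forall h', h = h'.
Proof.
move=> mf eAB; have [ffE esE] := eqE.
have [u [al]] := esE _ A; have [v [be]] := esE _ B.
have [ai [aai aia]] := finv ffp al.
have eu m : sval (fp2 A) m = e (sval u m).
  have [_ h2] := (sval al).2; rewrite -eE; exact: esym (congr1 (@^~ m) h2).
have ev n : sval (fp2 B) n = e (sval v n).
  have [_ h2] := (sval be).2; rewrite -eE; exact: esym (congr1 (@^~ n) h2).
have euv : sval u = (fun m => sval v (f m)).
  by apply/funext => m; apply: oe.2; rewrite -eu -ev eAB.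
pose k : fhom f u v := conj mf euv.
exists (fcomp be (fcomp (fm_hom E k) ai)) => h'.
have [g eg] := @flift _ _ fp ffp _ _ _ f (fun n => n) _ _ _ be (fcomp h' al) mf.
have [k' ek] : exists k', fm_hom E k' = g by exact: ff_surj.
have kk : k' = k by exact: (@Prop_irrelevance (_ /\ _)).
have A1 := fcompA ai (fm_hom E k) be; have A2 := fcompA ai al h'.
etransitivity; first exact: A1.
subst k'; etransitivity; first exact: (congr1 (fun t => fcomp (fcomp be t) ai) ek).
etransitivity; first exact: (congr1 (fun t => fcomp t ai) eg).
etransitivity; first exact: esym A2.
etransitivity; first exact: (congr1 (fun t => fcomp h' t) aai).
exact: fcomp1.
Qed.

Lemma pm_les : loc_ess_surj pm.
Proof.
move=> M z m; have [_ le] := associated_dense pe.2.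
have [U [k [w [ok rk hw]]]] := le M z m.
by exists U, k, w; split.
Qed.

(* A local isomorphism of F x with F y, seen in the fibre product. *)
Lemma oe_local M (x y : fob X M) (b : iso (F M x) (F M y)) m :
  exists U (k : U -> M) x1 y1 (w : fob (yoneda (g0 G)) U)
    (xi : fhom k x1 x) (ups : fhom k y1 y) (ga : fhom k (pm U w) (F M y))
    (ax : iso (F U x1) (pm U w)) (ay : iso (F U y1) (pm U w)),
  [/\ manifold_open_embedding k, range k m,
     (fcomp ga ax : fh Y k _ _) = fcomp b (fm_hom F xi) &
     (fcomp ga ay : fh Y k _ _) = fm_hom F ups].
Proof.
have [U [k [w [ok rk [ga]]]]] := pm_les (F M y) m.
have mk := open_embedding_morphism ok.
have [x1 [xi]] := fpull sX x mk; have [y1 [ups]] := fpull sX y mk.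
have [ax eax] := flift1 fY ga (fcomp b (fm_hom F xi)).
have [ay eay] := flift1 fY ga (fm_hom F ups).
by exists U, k, x1, y1, w, xi, ups, ga, ax, ay.
Qed.

Lemma oe_square U M (k : U -> M) (x : fob X U) (y : fob X U) (z : fob Y M)
    (w : fob (yoneda (g0 G)) U) (ga : fhom k (pm U w) z)
    (ax : iso (F U x) (pm U w)) (ay : iso (F U y) (pm U w)) (a : iso x y) :
  (fcomp ga ax : fh Y k _ _) = fcomp (fcomp ga ay) (fm_hom F a) ->
  (fcomp (fm_hom pm (fid w)) ax : iso _ _) = fcomp ay (fm_hom F a).
Proof.
move=> h; rewrite fm_id (f1comp ax).
apply: (fcancel1 fY (b := ga)); etransitivity; first exact: h.
exact: esym (fcompA (fm_hom F a) ay ga).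
Qed.

(** Locally, an isomorphism from [F x] to [F y] puts [x] and [y] in the fibre product over the same
    map to [g0]. The arrow between these two objects gives a local preimage, and its uniqueness
    gives faithfulness. *)
Lemma presented_embedding_ff : fully_faithful F.
Proof.
apply: ff_of_local => // M x y.
  move=> b m.
  have [U [k [x1 [y1 [w [xi [ups [ga [ax [ay [ok rk e1 e2]]]]]]]]]]] := oe_local b m.
  have [|//|h _] := @oe_fp_hom _ _ (fun m => m) (FpOb ax : fob fp U) (FpOb ay : fob fp U).
    exact: is_morphism_id.
  exists U, k, x1, xi, (fcomp ups (sval h).1); split=> //.
  have sq := proj2_sig h; rewrite /= in sq.
  etransitivity; first exact: (fm_comp F ups (sval h).1).
  rewrite -e2.
  etransitivity; first exact: esym (fcompA (fm_hom F (sval h).1) ay ga).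
  etransitivity; first exact: (congr1 (fun t => fcomp ga t) (esym sq)).
  have -> : (sval h).2 = fid w by exact: (@Prop_irrelevance (_ /\ _)).
  rewrite -[fm_hom eta _]/(fm_hom pm (fid w)) fm_id (f1comp ax).
  exact: e1.
move=> a b ab m.
have [U [k [x1 [y1 [w [xi [ups [ga [ax [ay [ok rk e1 e2]]]]]]]]]]] := oe_local (fm_hom F a) m.
exists U, k, x1, xi; split=> //.
have sq (c : iso x y) : fm_hom F c = fm_hom F a -> exists c' : iso x1 y1,
    (fcomp ups c' : fh X k _ _) = fcomp c xi /\
    (fcomp (fm_hom pm (fid w)) ax : iso _ _) = fcomp ay (fm_hom F c').
  move=> ca; have [c' ec] := flift1 fX ups (fcomp c xi); exists c'; split=> //.
  apply: (oe_square (ga := ga)); etransitivity; first exact: e1.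
  etransitivity; last exact: (congr1 (fun t => fcomp t (fm_hom F c')) (esym e2)).
  etransitivity; last exact: (fm_comp F ups c').
  etransitivity; last exact: (congr1 (@fm_hom _ _ _ _ F _ _ k _ _) (esym ec)).
  etransitivity; last exact: esym (fm_comp F c xi).
  by rewrite ca.
have [a' [ea sa]] := sq a erefl; have [b' [eb sb]] := sq b (esym ab).
have [|//|h hu] := @oe_fp_hom _ _ (fun m => m) (FpOb ax : fob fp U) (FpOb ay : fob fp U).
  exact: is_morphism_id.
have h1 := hu (exist _ (a', fid w) sa); have h2 := hu (exist _ (b', fid w) sb).
have ab' : a' = b' by have := congr1 (fun t => (sval t).1) (etrans (esym h1) h2).
etransitivity; first exact: esym ea.
by rewrite ab'.
Qed.
End OpenEmbedding.

Lemma open_embedding_ff X Y (F : fibmor X Y) : is_stack X -> is_stack Y ->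
  open_embedding F -> fully_faithful F.
Proof.
move=> sX sY [_ [G [eta [pe [W [e [E [oe eqE eE]]]]]]]].
exact: (presented_embedding_ff sX sY pe oe eqE eE).
Qed.
End FibreProduct.

(** * Morphisms of charts *)

Section ChartMorphism.
Context (R : realType) (sp : geometry).
Implicit Types M N P T U W : manifold R sp.
Local Notation iso x y := (fhom (fun m => m) x y).
Local Notation fh F f x y := (@fhom R sp F _ _ f x y).
Local Notation pt := (0%R : one_point R sp).

Lemma ff_comp (F G H : fibcat R sp) (p : fibmor F G) (q : fibmor G H) :
  fully_faithful p -> fully_faithful q -> fully_faithful (fibcomp q p).
Proof.
move=> fp fq M N f x y; apply: (bij_comp (f := @fm_hom _ _ _ _ q M N f _ _)).
  exact: fq.
exact: fp.
Qed.

Lemma ff_cancel (F G H : fibcat R sp) (p : fibmor F G) (q : fibmor G H) :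
  fully_faithful q -> fully_faithful (fibcomp q p) -> fully_faithful p.
Proof.
move=> fq fqp M N f x y; apply: inj_surj_bij => [a b ab|b].
  by apply: (ff_inj fqp); rewrite /= ab.
have [a ea] := ff_surj (p := fibcomp q p) (x := x) (y := y) (fm_hom q b) fqp.
by exists a; apply: (ff_inj fq).
Qed.

Lemma near_neq (S : topologicalType) (T : topologicalType) (a b : S -> T) x :
  hausdorff_space T -> {for x, continuous a} -> {for x, continuous b} ->
  a x <> b x -> \forall y \near x, a y <> b y.
Proof.
rewrite open_hausdorff => hT ca cb /eqP /hT [[A B] /= [xA xB] [oA oB /eqP AB]].
have nA := near_continuous ca (open_nbhs_nbhs (conj oA (set_mem xA))).
have nB := near_continuous cb (open_nbhs_nbhs (conj oB (set_mem xB))).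
apply: filterS2 nA nB => y /= Ay By e.
have : (A `&` B) (a y) by split=> //; rewrite e.
by rewrite AB.
Qed.

Variables (c c' : achart R sp) (p : equivariant_map c c').
Hypothesis cp : is_chart_morphism p.
Local Notation A := (prestack_map (action_groupoid_map p)).

(** The square defining the induced map commutes up to isomorphism, and its three other sides are
    fully faithful. *)
Lemma chart_prestack_ff : fully_faithful A.
Proof.
have [q [q' [F [ind oF]]]] := cp.
have [fq _] := associated_dense (qs_assoc q).
have [fq' _] := associated_dense (qs_assoc q').
have fF := open_embedding_ff (qs_assoc q).1 (qs_assoc q').1 oF.
apply: (ff_cancel fq'); apply: (isomorphic_ff (qs_assoc q').1.1 ind).
exact: ff_comp.
Qed.

Definition act_point (d : achart R sp) (v w : ac_V d) (h : ac_H d)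
  (e : ac_act h v = w) : fhom (f0 := prestack (action_groupoid d)) (fun m => m)
    (gpoint (G := action_groupoid d) v) (gpoint (G := action_groupoid d) w).
Proof.
exists (fun _ => action_arrow h v).
by split=> //; [exact: is_morphism_id|exact: is_morphism_cst].
Defined.

(** Full faithfulness over the one-point manifold, where arrows of the action groupoid from [v] to
    [w] are the group elements carrying [v] to [w]. *)
Lemma chart_arrow (v w : ac_V c) (h' : ac_H c') :
  ac_act h' (em_V p v) = em_V p w ->
  exists h, [/\ em_H p h = h', ac_act h v = w &
    forall k, em_H p k = h' -> ac_act k v = w -> k = h].
Proof.
move=> e.
have [a ea] := ff_surj (act_point e : fh (prestack (action_groupoid c')) (fun m => m)
    (A _ (gpoint (G := action_groupoid c) v)) (A _ (gpoint (G := action_groupoid c) w)))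
    chart_prestack_ff.
have [_ _ sa ta] := proj2_sig a.
have sE : arrow_src (sval a pt) = v by exact: sa.
have tE : ac_act (arrow_elt (sval a pt)) v = w.
  exact: etrans (congr1 (ac_act _) (esym sE)) (ta pt).
exists (arrow_elt (sval a pt)); split=> //.
  exact: (congr1 (fun t => @arrow_elt _ _ c' (sval t pt)) ea).
move=> k ek tk.
have ak : fm_hom A (act_point tk) = fm_hom A a.
  rewrite ea; apply: pre_hom_eq => m /=.
  by rewrite /arrow_elt /arrow_src /= ek.
by rewrite -(ff_inj chart_prestack_ff ak).
Qed.

Lemma em_H1 : em_H p 1%g = 1%g.
Proof. by apply: (@mulgI _ (em_H p 1)); rewrite -em_HM !mulg1. Qed.

(* A local inverse is found inside the base change of the open embedding
   [H\V] -> [H'\V'], corrected by an element of H. *)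
Lemma chart_local_section (v0 : ac_V c) : exists r : ac_V c' -> ac_V c,
  [/\ r (em_V p v0) = v0, smooth_at r (em_V p v0) &
      \forall z \near em_V p v0, em_V p (r z) = z].
Proof.
have [q [q' [F [[ind] [_ [G [eta [pe [W [e [E [oe [ffE esE] eE]]]]]]]]]]]] := cp.
have [sX sY] := ((qs_assoc q).1, (qs_assoc q').1).
have [fX fY] := (sX.1, sY.1).
have [fq lq] := associated_dense (qs_assoc q).
have [fq' _] := associated_dense (qs_assoc q').
pose idV : fob (prestack (action_groupoid c')) (ac_V c') :=
  exist _ (fun x => x) (is_morphism_id (ac_V c')).
(* Near the image of [v0], the tautological object of [H'\V'] over V' is represented by a map [s]
   into the presentation [G]. *)
have [U [k [s [ok [u0 _ eu0] [ga]]]]] := pm_les pe (qs_eta q' _ idV) (em_V p v0).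
have mk := open_embedding_morphism ok.
pose gv0 := gpoint (G := action_groupoid c) v0.
have un : fh (prestack (action_groupoid c')) (fun _ => k u0) (A _ gv0) idV.
  exists (fun _ => unt (em_V p v0 : g0 (action_groupoid c'))); split.
  - exact: is_morphism_cst.
  - exact: is_morphism_cst.
  - by move=> m; rewrite src_unt.
  - by move=> m; rewrite tgt_unt.
have [j _] := @flift _ _ _ fY _ _ _ (fun _ => u0) k _ _ _ ga
  (fcomp (fm_hom (qs_eta q') un) (ind _ gv0)) (is_morphism_cst _ u0).
pose s0 : fob (yoneda (g0 G)) (one_point R sp) :=
  exist _ (fun _ => sval s u0) (is_morphism_cst _ (sval s u0)).
have sg : fh (yoneda (g0 G)) (fun _ => u0) s0 s by split=> //; exact: is_morphism_cst.
have [j' _] := flift1 fY (fm_hom (presentation_map eta) sg) j.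
have [u [al]] := esE _ (@FpOb _ _ q (yoneda (g0 G)) q' F (presentation_map eta) _
  (qs_eta q _ gv0) s0 j').
(* [v0] itself gives a point of the base change over [s u0]. So [s u0] lies in the open image of
   [W], and [s] lifts to [W] near [u0]. *)
have ru : range e (sval s u0).
  exists (sval u pt) => //; rewrite -eE.
  by have [_ h2] := (sval al).2; exact: (congr1 (@^~ pt) h2).
have ms : is_morphism (sval s) := proj2_sig s.
have oD : open [set x | range e (sval s x)].
  apply: (open_comp (f := sval s)); first by move=> x _; exact: ms.1.
  by apply: etale_open openT; case: oe.
have ov := opens_val_embedding oD.
have mv := open_embedding_morphism ov.
have [s3 ms3 es3] := open_embedding_lift oe (is_morphism_comp ms mv)
  (fun x => opens_valP x).
pose B := E _ (exist _ s3 ms3 : fob (yoneda W) _).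
have ta : fh (yoneda (g0 G)) (@opens_val _ _ _ _ oD) (fp2 B) s.
  by split=> //; apply/funext => x; rewrite eE es3.
have [u00 _ eu00] : range (@opens_val _ _ _ _ oD) u0 by rewrite opens_range.
have [U3 [k3 [r [ok3 [m0 _ em0] [rho]]]]] := lq _ (fp1 B) u00.
have [indi] := isomorphic_sym fY (inhabits ind).
pose kap x := k (opens_val (k3 x)).
have okap : manifold_open_embedding kap.
  apply: open_embedding_comp ok _; exact: open_embedding_comp ov ok3.
have arr : fh q' kap (qs_eta q' _ (A _ r)) (qs_eta q' _ idV).
  exact: (fcomp ga (fcomp (fm_hom (presentation_map eta) ta)
    (fcomp (fp_iso B) (fcomp (fm_hom F rho) (indi _ r))))).
(* The object of [H\V] obtained from [W] is locally a map [r] into V, and [a] is a family of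
   elements of H' carrying its image in V' to the given point [kap m]. The element is locally
   constant in [m], and at [m0] it comes from some [h] in H. *)
have [a _] := ff_surj arr fq'; have [_ ma sa tga] := proj2_sig a.
have hE m : ac_act (arrow_elt (sval a m)) (em_V p (sval r m)) = kap m.
  exact: etrans (congr1 (ac_act _) (esym (sa m))) (tga m).
have km0 : kap m0 = em_V p v0 by rewrite /kap em0 eu00.
have [h [eh hv _]] := chart_arrow (etrans (hE m0) km0).
pose r' m := ac_act h (sval r m).
have mr' : is_morphism r'.
  by apply: is_morphism_comp (proj2_sig r); exact: ac_act_morphism.
have nr' : \forall m \near m0, em_V p (r' m) = kap m.
  apply: filterS (arrow_elt_near ma m0) => m em.
  by rewrite /r' em_equiv eh -em.
have [ki [kik ski _ kki]] := etale_loc_inv m0 okap.1.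
rewrite km0 in kik ski kki.
exists (fun z => r' (ki z)); split; first by rewrite kik.
  by apply: (smooth_at_comp ski); exact: (proj1 (is_morphismP _) mr').
have n2 : \forall z \near em_V p v0, em_V p (r' (ki z)) = kap (ki z).
  by apply: (near_continuous (P := fun m => em_V p (r' m) = kap m) ski.1); rewrite kik.
by apply: filterS2 n2 kki => z -> .
Qed.

(** With [r] a local section, [r (p x) = h x] for some [h] in the kernel of H -> H'. As H is finite,
    for [x] near [v0] such an [h] must fix [v0], and by uniqueness in [chart_arrow] it is then 1. *)
Lemma chart_etale : etale (em_V p).
Proof.
have mp := em_V_morphism p.
apply/etaleP; split=> // v0.
have [r [rv sr fr]] := chart_local_section v0.
exists r; split=> //.
have sf := proj1 (is_morphismP _) mp v0.
have srf : {for v0, continuous (fun x => r (em_V p x))}.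
  by have [] := smooth_at_comp sf sr.
have n1 : \forall x \near v0, em_V p (r (em_V p x)) = em_V p x.
  exact: (near_continuous sf.1 fr).
have n2 : \forall x \near v0, forall h : ac_H c,
    ac_act h v0 <> v0 -> ac_act h x <> r (em_V p x).
  apply: filter_forall => h.
  have [e|ne] := pselect (ac_act h v0 = v0); first by apply: nearW => x.
  have ch : {for v0, continuous (ac_act h)} := (ac_act_morphism h).1 v0.
  apply: filterS (near_neq (@mhausdorff _ _ _) ch srf _) => //.
  by rewrite rv.
apply: filterS2 n1 n2 => x e1 hx.
have [|h [eh hxr _]] := @chart_arrow x (r (em_V p x)) 1%g; first by rewrite ac_act1 e1.
have hv0 : ac_act h v0 = v0 by apply: contrapT => /hx; exact.
have [|k [_ _ uk]] := @chart_arrow v0 v0 1%g; first by rewrite ac_act1.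
have h1 : h = 1%g by rewrite (uk h eh hv0) (uk 1%g em_H1 (ac_act1 _)).
by rewrite -hxr h1 ac_act1.
Qed.
End ChartMorphism.

(** * The groupoid of an atlas *)

Section AtlasPoints.
Context (R : realType) (sp : geometry) (X : topologicalType) (A : atlas R sp X).
Implicit Types a b d e r : A.
Local Notation V a := (ac_V (at_chart a)).
Local Notation fm f := (em_V (at_map f)).

(** [{classic A}] supplies the choice structure that a disjoint union indexed by the charts
    needs. *)
Definition objects : manifold R sp :=
  coprod (fun a : {classic A} => ac_V (at_chart (a : A))).

Definition obj a (v : V a) : objects :=
  coprod_in (V := fun a : {classic A} => ac_V (at_chart (a : A))) (i := a) v.

Definition obj_pi (p : objects) : X := oc_pi (projT2 p : V (projT1 p)).

Lemma obj_inj a : injective (@obj a).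
Proof. by move=> v w e; have := existT_injr e. Qed.

Lemma iota_surj a (h : ac_H (at_chart a)) : exists k, at_iota (a := a) k = h.
Proof. by have [g _ gK] := at_iota_bij a; exists (g h). Qed.

(** The atlas axiom yields a chart [d] over the common image in X, but its arrows may miss [v] and
    [w]. They hit the right orbits, and composing with automorphisms of [a] and [b] corrects
    them. *)
Lemma dominate a b (v : V a) (w : V b) : oc_pi v = oc_pi w ->
  exists d (z : V d) (f : cc_hom d a) (g : cc_hom d b), fm f z = v /\ fm g z = w.
Proof.
move=> vw; have [||d [[f0] [g0] [z _ ez]]] := @at_refine _ _ _ A a b (oc_pi v).
- by exists v.
- by exists w.
have move_to c (u : V c) (f : cc_hom d c) : oc_pi u = oc_pi v ->
    exists f' : cc_hom d c, fm f' z = u.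
  move=> uv; have : oc_pi (fm f z) = oc_pi u by rewrite at_map_pi ez uv.
  move=> /oc_orbit [h ->]; have [k <-] := iota_surj h.
  by exists (cc_comp k f); rewrite at_comp_V at_iota_V.
have [f ef] := move_to a v f0 erefl; have [g eg] := move_to b w g0 (esym vw).
by exists d, z, f, g.
Qed.

(** The torsor gives [k'] in Aut(a) with [k' f1 = f2]. It carries [f1 z2] to [f1 z1], so by
    [chart_arrow] it lifts along [f1] to a unique automorphism of [d] carrying [z2] to [z1]. *)
Lemma hom_eq_at d a (f1 f2 : cc_hom d a) (z1 z2 : V d) : fm f1 z1 = fm f2 z2 ->
  exists k : cc_hom d d, [/\ f2 = cc_comp f1 k, fm k z2 = z1 &
    forall k', f2 = cc_comp f1 k' -> fm k' z2 = z1 -> k' = k].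
Proof.
move=> e12; have [k' [ek' uk']] := cc_torsor f1 f2.
have [|h [eh hz uh]] := @chart_arrow _ _ _ _ _ (at_map_chart f1) z2 z1 (at_iota k').
  by rewrite -at_iota_V -at_comp_V ek'.
have [k ek] := iota_surj h.
have iota_inj c := bij_inj (at_iota_bij c).
have f2E : f2 = cc_comp f1 k.
  have [k2 [ek2 _]] := cc_torsor f1 (cc_comp f1 k).
  have := at_iota_nat ek2; rewrite ek eh => /iota_inj k2E.
  by rewrite -ek' -ek2 k2E.
exists k; split=> // [|k3 e3 z3]; first by rewrite at_iota_V ek.
apply: iota_inj; rewrite ek; apply: uh; last by rewrite -at_iota_V.
by rewrite (at_iota_nat (f := f1) (k := k3) (k' := k')) // ek' e3.
Qed.

(** If [h f = g] then [h] fixes [f k], and Aut(a) acts freely. *)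
Lemma hom_epi e d a (k : cc_hom e d) (f g : cc_hom d a) :
  cc_comp f k = cc_comp g k -> f = g.
Proof.
move=> fg; have [h [eh _]] := cc_torsor f g.
have [u [_ uu]] := cc_torsor (cc_comp f k) (cc_comp f k).
have h1 : u = h by apply: uu; rewrite cc_compA eh fg.
have h2 : u = cc_id a by apply: uu; rewrite cc_1comp.
by rewrite -eh -h1 h2 cc_1comp.
Qed.

Definition leg d := {a : {classic A} & cc_hom d (a : A)}.
Definition mk_leg d a (f : cc_hom d a) : leg d :=
  existT (fun a : {classic A} => cc_hom d (a : A)) a f.
Definition leg_pt d (l : leg d) (z : V d) : objects := obj (fm (projT2 l) z).
Definition leg_comp e d (l : leg d) (k : cc_hom e d) : leg e :=
  mk_leg (cc_comp (projT2 l) k).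

Lemma mk_leg_inj d a : injective (@mk_leg d a).
Proof. by move=> f g h; have := existT_injr h. Qed.

Lemma leg_ptM e d (l : leg d) (k : cc_hom e d) y :
  leg_pt (leg_comp l k) y = leg_pt l (fm k y).
Proof. by rewrite /leg_pt /= at_comp_V. Qed.

Lemma leg_compA r e d (l : leg d) (k : cc_hom e d) (k' : cc_hom r e) :
  leg_comp (leg_comp l k) k' = leg_comp l (cc_comp k k').
Proof. by rewrite /leg_comp /= -cc_compA. Qed.

Lemma leg_comp1 d (l : leg d) : leg_comp l (cc_id d) = l.
Proof. by case: l => a f; rewrite /leg_comp /= cc_comp1. Qed.

Lemma leg_pt_pi d (l : leg d) (z : V d) : obj_pi (leg_pt l z) = oc_pi z.
Proof. by rewrite /obj_pi /= at_map_pi. Qed.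

Lemma leg_eq_at d (l1 l2 : leg d) (z1 z2 : V d) : leg_pt l1 z1 = leg_pt l2 z2 ->
  exists k : cc_hom d d, [/\ l2 = leg_comp l1 k, fm k z2 = z1 &
    forall k', l2 = leg_comp l1 k' -> fm k' z2 = z1 -> k' = k].
Proof.
case: l1 l2 => a f1 [b f2] e.
have ab : a = b := congr1 (@projT1 _ _) e; subst b.
have [k [e1 e2 uk]] := hom_eq_at (obj_inj e).
exists k; split=> // [|k' e' ]; first by rewrite /leg_comp /= -e1.
by apply: uk; exact: mk_leg_inj e'.
Qed.

Lemma leg_epi e d (k : cc_hom e d) (l l' : leg d) :
  leg_comp l k = leg_comp l' k -> l = l'.
Proof.
case: l l' => a f [b g] h.
have ab : a = b := congr1 (@projT1 _ _) h; subst b.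
by congr existT; apply: (hom_epi (k := k)); exact: mk_leg_inj h.
Qed.

(** A chart dominating both points makes the two legs agree at a point; an automorphism of that
    chart then makes them equal as arrows. *)
Lemma leg_refine d d' (l : leg d) (l' : leg d') z z' :
  leg_pt l z = leg_pt l' z' -> exists e y (k : cc_hom e d) (k' : cc_hom e d'),
  [/\ fm k y = z, fm k' y = z' & leg_comp l k = leg_comp l' k'].
Proof.
move=> e0; have pzz : oc_pi z = oc_pi z' by rewrite -(leg_pt_pi l) e0 leg_pt_pi.
have [e [y [k [k' [ky k'y]]]]] := dominate pzz.
have [|j [ej jy _]] := @leg_eq_at e (leg_comp l k) (leg_comp l' k') y y.
  by rewrite !leg_ptM ky k'y.
exists e, y, (cc_comp k j), k'; split=> //; first by rewrite at_comp_V jy.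
by rewrite -leg_compA.
Qed.

(* A span stands for the arrow from leg_pt l1 z to leg_pt l2 z. *)
Record span := Span { sp_d : A; sp_l1 : leg sp_d; sp_l2 : leg sp_d; sp_z : V sp_d }.

Definition span_rel (s t : span) : Prop :=
  exists e y (k : cc_hom e (sp_d s)) (k' : cc_hom e (sp_d t)),
  [/\ fm k y = sp_z s, fm k' y = sp_z t,
      leg_comp (sp_l1 s) k = leg_comp (sp_l1 t) k' &
      leg_comp (sp_l2 s) k = leg_comp (sp_l2 t) k'].

Lemma span_refl s : span_rel s s.
Proof. by exists (sp_d s), (sp_z s), (cc_id _), (cc_id _); rewrite at_id_V. Qed.

Lemma span_sym s t : span_rel s t -> span_rel t s.
Proof. by move=> [e [y [k [k' [h1 h2 h3 h4]]]]]; exists e, y, k', k. Qed.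

(** The two refinements both map to the chart of [t]; [leg_refine] equalises these maps, which is
    the Ore condition. *)
Lemma span_trans s t u : span_rel s t -> span_rel t u -> span_rel s u.
Proof.
move=> [e [y [k [k' [h1 h2 h3 h4]]]]] [e' [y' [m [m' [g1 g2 g3 g4]]]]].
have [|r [w [n [n' [nw n'w]]]]] := @leg_refine e e' (mk_leg k') (mk_leg m) y y'.
  by rewrite /leg_pt /= h2 g1.
move=> /mk_leg_inj /= nn.
exists r, w, (cc_comp k n), (cc_comp m' n'); split.
- by rewrite at_comp_V nw.
- by rewrite at_comp_V n'w.
- by rewrite -leg_compA h3 leg_compA nn -leg_compA g3 leg_compA.
- by rewrite -leg_compA h4 leg_compA nn -leg_compA g4 leg_compA.
Qed.

Definition arrow_class := {S : set span | exists s, S = span_rel s}.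

Definition phi d (l1 l2 : leg d) (z : V d) : arrow_class :=
  exist _ (span_rel (Span l1 l2 z)) (ex_intro _ (Span l1 l2 z) erefl).

Lemma phi_eq d d' (l1 l2 : leg d) (l1' l2' : leg d') z z' :
  phi l1 l2 z = phi l1' l2' z' <-> span_rel (Span l1 l2 z) (Span l1' l2' z').
Proof.
split=> [/(congr1 sval) /= ->|h]; first exact: span_refl.
apply: eq_exist => /=; apply/funext => s; apply/propext; split.
  exact: span_trans (span_sym h).
exact: span_trans h.
Qed.

Lemma phi_surj (g : arrow_class) : exists d (l1 l2 : leg d) z, g = phi l1 l2 z.
Proof.
by case: g => S [[d l1 l2 z] eS]; exists d, l1, l2, z; exact: eq_exist.
Qed.

Lemma phi_comp e d (l1 l2 : leg d) (k : cc_hom e d) y :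
  phi (leg_comp l1 k) (leg_comp l2 k) y = phi l1 l2 (fm k y).
Proof.
by apply/phi_eq; exists e, y, (cc_id _), k; rewrite /= at_id_V !leg_comp1.
Qed.

(** The two refinements differ by an automorphism [j] of [e] that fixes both [y] and the leg [l1 k],
    so [j] is the identity by uniqueness in [leg_eq_at]. Arrows differing by an ineffective element
    are thus kept apart. *)
Lemma phi_inj2 d (l1 l2 l2' : leg d) z : phi l1 l2 z = phi l1 l2' z -> l2 = l2'.
Proof.
move=> /phi_eq [e [y [k [k' [/= h1 h2 h3 h4]]]]].
suff kk : k' = k by apply: (leg_epi (k := k)); rewrite h4 kk.
have [|j [kj jy _]] := @hom_eq_at e d k k' y y; first by rewrite h1 h2.
have [i [_ _ ui]] := @leg_eq_at e (leg_comp l1 k) (leg_comp l1 k) y y erefl.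
have ji : j = i by apply: ui => //; rewrite leg_compA -kj h3.
have idi : cc_id e = i by apply: ui; rewrite ?leg_comp1 ?at_id_V.
by rewrite kj ji -idi cc_comp1.
Qed.

Lemma span_src s t : span_rel s t ->
  leg_pt (sp_l1 s) (sp_z s) = leg_pt (sp_l1 t) (sp_z t).
Proof. by move=> [e [y [k [k' [<- <- h _]]]]]; rewrite -!leg_ptM h. Qed.

Lemma span_tgt s t : span_rel s t ->
  leg_pt (sp_l2 s) (sp_z s) = leg_pt (sp_l2 t) (sp_z t).
Proof. by move=> [e [y [k [k' [<- <- _ h]]]]]; rewrite -!leg_ptM h. Qed.

Definition arr_src (g : arrow_class) : objects :=
  let s := projT1 (cid (proj2_sig g)) in leg_pt (sp_l1 s) (sp_z s).
Definition arr_tgt (g : arrow_class) : objects :=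
  let s := projT1 (cid (proj2_sig g)) in leg_pt (sp_l2 s) (sp_z s).

Lemma arr_srcE d (l1 l2 : leg d) z : arr_src (phi l1 l2 z) = leg_pt l1 z.
Proof.
rewrite /arr_src; case: (cid _) => s /= es; symmetry.
by apply: (span_src (s := Span l1 l2 z)); rewrite es; exact: span_refl.
Qed.

Lemma arr_tgtE d (l1 l2 : leg d) z : arr_tgt (phi l1 l2 z) = leg_pt l2 z.
Proof.
rewrite /arr_tgt; case: (cid _) => s /= es; symmetry.
by apply: (span_tgt (s := Span l1 l2 z)); rewrite es; exact: span_refl.
Qed.

Lemma arr_from d (l : leg d) z g : arr_src g = leg_pt l z ->
  exists e y (k : cc_hom e d) (n : leg e), fm k y = z /\ g = phi (leg_comp l k) n y.
Proof.
have [d' [l1 [l2 [z' ->]]]] := phi_surj g; rewrite arr_srcE => /esym /leg_refine.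
move=> [e [y [k [k' [ky k'y lk]]]]]; exists e, y, k, (leg_comp l2 k'); split=> //.
by rewrite lk phi_comp k'y.
Qed.

(* The torsor property removes the refinement: every arrow between two points
   lying under d is carried by d itself. *)
Lemma arr_normal d (l1 l2 : leg d) z g : arr_src g = leg_pt l1 z ->
  arr_tgt g = leg_pt l2 z -> exists2 f : cc_hom d (projT1 l2 : A), g = phi l1 (mk_leg f) z &
    leg_pt (mk_leg f) z = leg_pt l2 z.
Proof.
move=> gs gt; have [e [y [k [n [ky eg]]]]] := arr_from gs.
have nE : leg_pt n y = leg_pt (leg_comp l2 k) y by rewrite leg_ptM ky -gt eg arr_tgtE.
case: n nE eg => b n nE eg.
have eb : b = projT1 l2 := congr1 (@projT1 _ _) nE; subst b.
have [h [eh _]] := cc_torsor (cc_comp (projT2 l2) k) n.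
have E : phi l1 (mk_leg (cc_comp h (projT2 l2))) z = g.
  rewrite eg -ky -phi_comp; congr phi.
  by rewrite /leg_comp /= -cc_compA eh.
by exists (cc_comp h (projT2 l2)) => //; rewrite -gt -E arr_tgtE.
Qed.

Definition id_leg a : leg a := mk_leg (cc_id a).

Definition arr_unt (p : objects) : arrow_class :=
  phi (id_leg (projT1 p)) (id_leg (projT1 p)) (projT2 p).

Lemma arr_untE d (l : leg d) z : arr_unt (leg_pt l z) = phi l l z.
Proof.
case: l => a f; rewrite /arr_unt /leg_pt /= -phi_comp /leg_comp /= cc_1comp //.
Qed.

Definition arr_inv (g : arrow_class) : arrow_class :=
  let s := projT1 (cid (proj2_sig g)) in phi (sp_l2 s) (sp_l1 s) (sp_z s).

Lemma arr_invE d (l1 l2 : leg d) z : arr_inv (phi l1 l2 z) = phi l2 l1 z.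
Proof.
rewrite /arr_inv; case: (cid _) => -[d' l1' l2' z'] /= es.
apply/phi_eq; have : span_rel (Span l1 l2 z) (Span l1' l2' z').
  by rewrite es; exact: span_refl.
by move=> [e [y [k [k' [h1 h2 h3 h4]]]]]; exists e, y, k', k.
Qed.

Definition arr_comp (g' g h : arrow_class) : Prop :=
  exists e y (n1 n2 n3 : leg e),
  [/\ g = phi n1 n2 y, g' = phi n2 n3 y & h = phi n1 n3 y].

Lemma arr_comp_ex g' g : arr_src g' = arr_tgt g -> exists h, arr_comp g' g h.
Proof.
have [d [l1 [l2 [z ->]]]] := phi_surj g; rewrite arr_tgtE => /arr_from.
move=> [e [y [k [n [<- ->]]]]]; rewrite -phi_comp.
by exists (phi (leg_comp l1 k) n y), e, y, (leg_comp l1 k), (leg_comp l2 k), n.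
Qed.

Lemma arr_comp_uniq g' g h h' : arr_comp g' g h -> arr_comp g' g h' -> h = h'.
Proof.
move=> [e [y [n1 [n2 [n3 [-> -> ->]]]]]] [e' [y' [m1 [m2 [m3 []]]]]].
move=> /phi_eq [r [w [k [k' [/= <- <- h1 h2]]]]].
rewrite -!phi_comp -h2 => /phi_inj2 h3 ->.
by rewrite h1 h3.
Qed.

(** The value [g] for pairs that cannot be composed is a default. *)
Definition arr_mul (g' g : arrow_class) : arrow_class :=
  if pselect (exists h, arr_comp g' g h) is left e then projT1 (cid e) else g.

Lemma arr_mulE e (n1 n2 n3 : leg e) y :
  arr_mul (phi n2 n3 y) (phi n1 n2 y) = phi n1 n3 y.
Proof.
have c : arr_comp (phi n2 n3 y) (phi n1 n2 y) (phi n1 n3 y) by exists e, y, n1, n2, n3.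
rewrite /arr_mul; case: pselect => [E|[]]; last by exists (phi n1 n3 y).
by case: (cid E) => h /= hc; exact: arr_comp_uniq hc c.
Qed.

Lemma arr_split g' g : arr_src g' = arr_tgt g -> exists e y (n1 n2 n3 : leg e),
  g = phi n1 n2 y /\ g' = phi n2 n3 y.
Proof.
by move=> /arr_comp_ex [h [e [y [n1 [n2 [n3 [-> -> _]]]]]]]; exists e, y, n1, n2, n3.
Qed.

Lemma arr_mulA (a b c : arrow_class) : arr_src a = arr_tgt b -> arr_src b = arr_tgt c ->
  arr_mul a (arr_mul b c) = arr_mul (arr_mul a b) c.
Proof.
move=> ab /arr_split [e [y [n1 [n2 [n3 [cE bE]]]]]].
move: ab; rewrite cE bE arr_tgtE => /arr_from [r [w [k [n [kw ->]]]]].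
by rewrite -kw -!phi_comp !arr_mulE.
Qed.
End AtlasPoints.

(** * Topology and manifold structure on the arrows *)

Section ArrowTopology.
Context (R : realType) (sp : geometry) (X : topologicalType) (A : atlas R sp X).
Local Notation V a := (ac_V (at_chart a)).
Local Notation arrows := (arrow_class A).

(** The final topology for the families [phi l1 l2]. *)
Definition arr_open (U : set arrows) : Prop :=
  forall (d : A) (l1 l2 : leg d), open [set z | U (phi l1 l2 z)].

Lemma arr_openT : arr_open setT.
Proof. by move=> d l1 l2; exact: openT. Qed.

Lemma arr_openI : setI_closed arr_open.
Proof. by move=> U U' oU oU' d l1 l2; exact: (openI (oU d l1 l2) (oU' d l1 l2)). Qed.

Lemma arr_open_bigU (I : Type) (f : I -> set arrows) :
  (forall i, arr_open (f i)) -> arr_open (\bigcup_i f i).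
Proof. by move=> of_ d l1 l2; apply: bigcup_open => i _; exact: of_. Qed.

HB.instance Definition _ := gen_eqMixin arrows.
HB.instance Definition _ := gen_choiceMixin arrows.
HB.instance Definition _ := isOpenTopological.Build arrows
  arr_openT arr_openI arr_open_bigU.

Lemma arr_openE (U : set arrows) : open U = arr_open U.
Proof. by []. Qed.
End ArrowTopology.

Section ArrowSpace.
Context (R : realType) (sp : geometry) (X : topologicalType) (A : atlas R sp X).
Implicit Types a b d e r : A.
Local Notation V a := (ac_V (at_chart a)).
Local Notation fm f := (em_V (at_map f)).
Local Notation arrows := (arrow_class A).
Local Notation objects := (objects A).

Lemma obj_embedding a : manifold_open_embedding (@obj _ _ _ A a).
Proof. exact: (@coprod_in_embedding R sp {classic A} (fun a => ac_V (at_chart (a : A))) a). Qed.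

Lemma hom_etale d a (f : cc_hom d a) : etale (fm f).
Proof. by apply: chart_etale; exact: at_map_chart. Qed.

Lemma leg_etale d (l : leg d) : etale (leg_pt l).
Proof. by apply: etale_comp; [exact: (obj_embedding _).1|exact: hom_etale]. Qed.

Lemma phi_continuous d (l1 l2 : leg d) : continuous (phi l1 l2).
Proof. by apply/continuousP => U oU; exact: oU. Qed.

(** Where two families meet, they agree after restriction to a chart [e], whose maps to [d] and [d']
    are etale; hence they agree on a whole neighbourhood. *)
Lemma phi_open d (l1 l2 : leg d) (U : set (V d)) : open U ->
  open (phi l1 l2 @` U).
Proof.
move=> oU; rewrite arr_openE => d' m1 m2; rewrite openE => z' [z Uz /phi_eq].
move=> [e [y [k [k' [/= kz <- h1 h2]]]]].
have oW : open (fm k @^-1` U).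
  apply: open_comp oU => x _; exact: (etale_morphism (hom_etale k)).1.
have nW : nbhs (fm k' y) (fm k' @` (fm k @^-1` U)).
  apply: open_nbhs_nbhs; split; first exact: etale_open (hom_etale k') oW.
  by exists y => //=; rewrite kz.
rewrite /interior; apply: filterS nW => _ [w Uw <-] /=.
by exists (fm k w) => //; rewrite -!phi_comp h1 h2.
Qed.

Lemma phi_nbhs d (l1 l2 : leg d) (U : set (V d)) z : nbhs z U ->
  nbhs (phi l1 l2 z) (phi l1 l2 @` U).
Proof.
move=> /nbhs_interior nU; have := open_nbhs_nbhs (conj (phi_open l1 l2 (open_interior U))
  (ex_intro2 _ _ z (nbhs_singleton nU) erefl)).
by apply: filterS => _ [w /interior_subset Uw <-]; exists w.
Qed.

Lemma arr_src_continuous : continuous (@arr_src _ _ _ A : arrows -> objects).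
Proof.
apply/continuousP => U oU; rewrite arr_openE => d l1 l2.
rewrite (_ : [set z | _] = leg_pt l1 @^-1` U).
  apply: open_comp oU => x _; exact: (etale_morphism (leg_etale l1)).1.
by apply/seteqP; split=> z /=; rewrite arr_srcE.
Qed.

Lemma arr_src_loc (g : arrows) : exists D : set arrows, [/\ open D, D g,
  forall h k, D h -> D k -> arr_src h = arr_src k -> h = k &
  forall U, open U -> U `<=` D -> open ((@arr_src _ _ _ A : arrows -> objects) @` U)].
Proof.
have [d [l1 [l2 [z ->]]]] := phi_surj g.
have [U [oU Uz iU]] := etale_inj_near z (leg_etale l1).
exists (phi l1 l2 @` U); split; first exact: phi_open.
- by exists z.
- by move=> _ _ [y Uy <-] [w Uw <-]; rewrite !arr_srcE => /(iU _ _ Uy Uw) ->.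
move=> W oW sW.
rewrite (_ : _ @` W = leg_pt l1 @` ([set y | W (phi l1 l2 y)] `&` U)).
  by apply: etale_open (leg_etale l1) _; apply: openI oU; exact: oW.
apply/seteqP; split=> [_ [h Wh <-]|_ [y [Wy Uy] <-]].
  by have [y Uy ey] := sW _ Wh; exists y; [rewrite /= ey|rewrite -ey arr_srcE].
by exists (phi l1 l2 y) => //; rewrite arr_srcE.
Qed.

Lemma arr_tgt_continuous : continuous (@arr_tgt _ _ _ A : arrows -> objects).
Proof.
apply/continuousP => U oU; rewrite arr_openE => d l1 l2.
rewrite (_ : [set z | _] = leg_pt l2 @^-1` U).
  apply: open_comp oU => x _; exact: (etale_morphism (leg_etale l2)).1.
by apply/seteqP; split=> z /=; rewrite arr_tgtE.
Qed.

(** Arrows that cannot be separated have the same source and target, because the objects are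
    Hausdorff. By [arr_normal] one chart carries both at the same point with the same first leg; an
    arrow common to the two families then forces equal second legs. *)
Lemma arr_hausdorff : hausdorff_space arrows.
Proof.
move=> g h cgh.
have hs : hausdorff_space objects := @mhausdorff _ _ objects.
have cl (f : arrows -> objects) : continuous f -> f g = f h.
  move=> cf; apply: hs => P Q nP nQ.
  by have [k [Pk Qk]] := cgh _ _ (cf _ _ nP) (cf _ _ nQ); exists (f k).
have es := cl _ arr_src_continuous; have et := cl _ arr_tgt_continuous.
have [d [l1 [l2 [z gE]]]] := phi_surj g.
rewrite gE arr_srcE in es; rewrite gE arr_tgtE in et.
have [f hE _] := arr_normal (esym es) (esym et).
have [U [oU Uz iU]] := etale_inj_near z (leg_etale l1).
have nU := open_nbhs_nbhs (conj oU Uz).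
have ng := phi_nbhs l1 l2 nU; have nh := phi_nbhs l1 (mk_leg f) nU.
rewrite -gE in ng; rewrite -hE in nh.
have [k [[y Uy ey] [w Uw ew]]] := cgh _ _ ng nh.
have yw : y = w by apply: iU => //; rewrite -(arr_srcE l1 l2) ey -ew arr_srcE.
subst w; have l2f : l2 = mk_leg f by apply: (phi_inj2 (l1 := l1) (z := y)); rewrite ey ew.
by rewrite gE hE -l2f.
Qed.

Definition arrow_space : manifold R sp :=
  etale_space arr_hausdorff arr_src_continuous arr_src_loc.

Definition a_src : arrow_space -> objects := @arr_src _ _ _ A.
Definition a_tgt : arrow_space -> objects := @arr_tgt _ _ _ A.
Definition a_phi d (l1 l2 : leg d) : V d -> arrow_space := phi l1 l2.

Lemma a_src_etale : etale a_src.
Proof. exact: etale_space_etale. Qed.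

Lemma a_phi_etale d (l1 l2 : leg d) : etale (a_phi l1 l2).
Proof.
have eq_src : (fun z => a_src (a_phi l1 l2 z)) = leg_pt l1.
  by apply/funext => z; exact: arr_srcE.
have mphi : is_morphism (a_phi l1 l2).
  apply: morphism_etale a_src_etale _ _; first exact: phi_continuous.
  by rewrite eq_src; exact: etale_morphism (leg_etale l1).
apply/etaleP; split=> // z.
have [r [rz sr rK _]] := etale_loc_inv z (leg_etale l1).
have srcE y : a_src (a_phi l1 l2 y) = leg_pt l1 y by exact: arr_srcE.
exists (fun g => r (a_src g)); rewrite !srcE; split=> //.
- apply: smooth_at_comp; last by rewrite srcE.
  exact: (proj1 (is_morphismP _) (etale_morphism a_src_etale)).
- by apply: filterS rK => y; rewrite srcE.
apply: filterS (phi_nbhs l1 l2 rK) => _ [y ry <-].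
by rewrite [a_src _]srcE ry.
Qed.

Lemma a_phi_lift (T : manifold R sp) (g : T -> arrow_space) t d (l1 l2 : leg d) z :
  smooth_at g t -> g t = phi l1 l2 z ->
  exists s : T -> V d, [/\ s t = z, smooth_at s t &
    \forall t' \near t, g t' = phi l1 l2 (s t')].
Proof.
move=> sg gt; have [r [rz sr rK pK]] := etale_loc_inv z (a_phi_etale l1 l2).
have gt' : a_phi l1 l2 z = g t by rewrite gt.
rewrite gt' in rz sr pK.
exists (fun t' => r (g t')); split=> //; first exact: smooth_at_comp sg sr.
by apply: filterS (near_continuous sg.1 pK) => t' {1}<-.
Qed.

Lemma a_phi_smooth (T : manifold R sp) d (l1 l2 : leg d) (s : T -> V d) t :
  smooth_at s t -> smooth_at (fun t' => a_phi l1 l2 (s t')) t.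
Proof.
move=> ss; apply: smooth_at_comp ss _.
exact: (proj1 (is_morphismP _) (etale_morphism (a_phi_etale l1 l2))).
Qed.

Lemma leg_smooth (T : manifold R sp) d (l : leg d) (s : T -> V d) t :
  smooth_at s t -> smooth_at (fun t' => leg_pt l (s t')) t.
Proof.
move=> ss; apply: smooth_at_comp ss _.
exact: (proj1 (is_morphismP _) (etale_morphism (leg_etale l))).
Qed.

Lemma a_local (N : manifold R sp) (F : arrow_space -> N) :
  (forall d (l1 l2 : leg d), is_morphism (fun z => F (a_phi l1 l2 z))) ->
  is_morphism F.
Proof.
move=> mF; apply/is_morphismP => g; have [d [l1 [l2 [z gE]]]] := phi_surj g.
have [s [sz ss gs]] := a_phi_lift (smooth_at_id g) gE.
have sF := proj1 (is_morphismP _) (mF d l1 l2) (s g).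
apply: (smooth_at_near _ (smooth_at_comp ss sF)).
by apply: filterS gs => g' {2}->.
Qed.

Lemma a_tgt_morphism : is_morphism a_tgt.
Proof.
apply: a_local => d l1 l2; rewrite (_ : (fun z => _) = leg_pt l2).
  exact: etale_morphism (leg_etale l2).
by apply/funext => z; exact: arr_tgtE.
Qed.

Definition a_inv : arrow_space -> arrow_space := @arr_inv _ _ _ A.

Lemma a_inv_morphism : is_morphism a_inv.
Proof.
apply: a_local => d l1 l2; rewrite (_ : (fun z => _) = a_phi l2 l1).
  exact: etale_morphism (a_phi_etale l2 l1).
by apply/funext => z; exact: arr_invE.
Qed.

Definition a_unt : objects -> arrow_space := @arr_unt _ _ _ A.

Lemma a_unt_morphism : is_morphism a_unt.
Proof.
apply: coprod_morphism => a.
exact: etale_morphism (a_phi_etale (id_leg a) (id_leg a)).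
Qed.

Definition a_mul : arrow_space -> arrow_space -> arrow_space := @arr_mul _ _ _ A.

Lemma a_mul_morphism (T : manifold R sp) (g h : T -> arrow_space) :
  is_morphism g -> is_morphism h -> (forall t, a_src (g t) = a_tgt (h t)) ->
  is_morphism (fun t => a_mul (g t) (h t)).
Proof.
move=> /is_morphismP mg /is_morphismP mh gh; apply/is_morphismP => t.
have [e [y [n1 [n2 [n3 [hE gE]]]]]] := arr_split (gh t).
have [s [sy ss hs]] := a_phi_lift (mh t) hE.
have [s' [s'y ss' gs]] := a_phi_lift (mg t) gE.
(* [s] and [s'] have the same image under the middle leg [n2], which is injective near [y]; so they
   coincide near [t]. *)
have [U [oU Uy iU]] := etale_inj_near y (leg_etale n2).
have ns : \forall t' \near t, U (s t').
  by apply: (near_continuous (P := U) ss.1); rewrite sy; exact: open_nbhs_nbhs.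
have ns' : \forall t' \near t, U (s' t').
  by apply: (near_continuous (P := U) ss'.1); rewrite s'y; exact: open_nbhs_nbhs.
apply: (@smooth_at_near _ _ _ _ (fun t' => a_phi n1 n3 (s t'))); last exact: a_phi_smooth.
near=> t'.
have h1 : h t' = phi n1 n2 (s t') by near: t'.
have h2 : g t' = phi n2 n3 (s' t') by near: t'.
have h3 : U (s t') by near: t'.
have h4 : U (s' t') by near: t'.
have e1 : s' t' = s t'.
  apply: iU => //; have := gh t'.
  by rewrite /a_src /a_tgt h1 h2 arr_srcE arr_tgtE.
by rewrite h1 h2 e1 /a_mul arr_mulE.
Unshelve. all: by end_near. Qed.

Definition atlas_groupoid : groupoid R sp.
Proof.
refine (@Groupoid _ _ objects arrow_space a_src a_tgt a_unt a_inv a_mul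
  (etale_morphism a_src_etale) a_tgt_morphism a_unt_morphism a_inv_morphism
  a_mul_morphism _ _ _ _ _ _ _ _ _ _ _).
- by move=> [a v]; rewrite /a_src arr_srcE /leg_pt /= at_id_V.
- by move=> [a v]; rewrite /a_tgt arr_tgtE /leg_pt /= at_id_V.
- move=> g; have [d [l1 [l2 [z ->]]]] := phi_surj g.
  by rewrite /a_src /a_inv /a_tgt arr_invE arr_srcE arr_tgtE.
- move=> g; have [d [l1 [l2 [z ->]]]] := phi_surj g.
  by rewrite /a_src /a_inv /a_tgt arr_invE arr_srcE arr_tgtE.
- move=> g h /arr_split [e [y [n1 [n2 [n3 [-> ->]]]]]].
  by rewrite /a_src /a_mul arr_mulE !arr_srcE.
- move=> g h /arr_split [e [y [n1 [n2 [n3 [-> ->]]]]]].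
  by rewrite /a_tgt /a_mul arr_mulE !arr_tgtE.
- by move=> g h k; exact: arr_mulA.
- move=> g; have [d [l1 [l2 [z ->]]]] := phi_surj g.
  by rewrite /a_tgt arr_tgtE /a_unt arr_untE /a_mul arr_mulE.
- move=> g; have [d [l1 [l2 [z ->]]]] := phi_surj g.
  by rewrite /a_src arr_srcE /a_unt arr_untE /a_mul arr_mulE.
- move=> g; have [d [l1 [l2 [z ->]]]] := phi_surj g.
  by rewrite /a_src arr_srcE /a_unt arr_untE /a_inv arr_invE /a_mul arr_mulE.
- move=> g; have [d [l1 [l2 [z ->]]]] := phi_surj g.
  by rewrite /a_tgt arr_tgtE /a_unt arr_untE /a_inv arr_invE /a_mul arr_mulE.
Defined.
End ArrowSpace.

(** * Properness of the groupoid *)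

Section Proper.
Context (R : realType) (sp : geometry) (X : topologicalType) (A : atlas R sp X).
Hypothesis hX : hausdorff_space X.
Local Notation V a := (ac_V (at_chart a)).
Local Notation fm f := (em_V (at_map f)).
Local Notation objects := (objects A).
Local Notation arrow_space := (arrow_space A).
Local Notation asrc := (@a_src R sp X A).
Local Notation atgt := (@a_tgt R sp X A).

Lemma obj_pi_preimage_open (U : set X) : open U -> open (@obj_pi _ _ _ A @^-1` U).
Proof.
move=> oU; apply/coprod_open => a; apply: open_comp oU => v _.
exact: oc_cont.
Qed.

Lemma arr_pi (g : arrow_space) : obj_pi (a_src g) = obj_pi (a_tgt g).
Proof.
have [d [l1 [l2 [z ->]]]] := phi_surj g.
by rewrite /a_src /a_tgt arr_srcE arr_tgtE !leg_pt_pi.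
Qed.

Lemma a_tgt_etale : etale (@a_tgt _ _ _ A).
Proof.
rewrite (_ : @a_tgt _ _ _ A = fun g => a_src (a_inv g)); last first.
  apply/funext => g; have [d [l1 [l2 [z ->]]]] := phi_surj g.
  by rewrite /a_tgt /a_src /a_inv arr_invE arr_srcE arr_tgtE.
apply: etale_comp; first exact: a_src_etale.
have invK (g : arrow_space) : a_inv (a_inv g) = g.
  by have [d [l1 [l2 [z ->]]]] := phi_surj g; rewrite /a_inv !arr_invE.
have nI (g : arrow_space) : \forall h \near g, a_inv (a_inv h) = h.
  by near=> h; exact: invK.
apply/etaleP; split=> [|g]; first exact: a_inv_morphism.
exists (@a_inv _ _ _ A); split; first exact: invK.
- exact: (proj1 (is_morphismP _) (@a_inv_morphism _ _ _ A)).
- exact: nI.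
- exact: nI.
Unshelve. all: by end_near. Qed.

Lemma ultra_finite_union (T : Type) (I : finType) (f : I -> set T) (F : set_system T) :
  UltraFilter F -> F (\bigcup_i f i) -> exists i, F (f i).
Proof.
move=> UF FU; apply: contrapT => nF.
have Fc : \forall x \near F, forall i, ~ f i x.
  apply: filter_forall => i; have [Fi|//] := in_ultra_setVsetC (f i) UF.
  by exfalso; apply: nF; exists i.
have [x [[i _ fix_] nfx]] := filter_ex (filterI FU Fc).
exact: nfx fix_.
Qed.

Lemma dominate_obj (p q : objects) : obj_pi p = obj_pi q ->
  exists (d : A) (l1 l2 : leg d) z, leg_pt l1 z = p /\ leg_pt l2 z = q.
Proof.
case: p q => a v [b w] /= /dominate [d [z [f [g [e1 e2]]]]].
exists d, (mk_leg f), (mk_leg g), z; split.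
  exact: (congr1 (@obj _ _ _ A a) e1).
exact: (congr1 (@obj _ _ _ A b) e2).
Qed.

(** [z1] and [z2] have the same image in X, so a group element of [d] carries one to the other;
    absorbed into [l2], it reduces the claim to [arr_normal] at the single point [z1]. *)
Lemma arr_near_cases d (l1 l2 : leg (A := A) d) z1 z2 (g : arrow_space) :
  a_src g = leg_pt l1 z1 -> a_tgt g = leg_pt l2 z2 ->
  exists f : cc_hom d (projT1 l2 : A), g = phi l1 (mk_leg f) z1.
Proof.
move=> gs gt; have := arr_pi g; rewrite gs gt !leg_pt_pi => /oc_orbit [h z2E].
have [k ek] := iota_surj h.
have [||f gE _] := @arr_normal _ _ _ _ _ l1 (leg_comp l2 k) z1 g.
- exact: gs.
- by rewrite leg_ptM at_iota_V ek -z2E; exact: gt.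
by exists f.
Qed.

Lemma atlas_groupoid_proper (C : set (objects * objects)%type) : compact C ->
  compact ((fun g : arrow_space => (a_src g, a_tgt g)) @^-1` C).
Proof.
move=> cC; rewrite compact_ultra => F UF FC.
pose st (g : arrow_space) := (a_src g, a_tgt g).
have [[p q] [Cpq clpq]] := cC (st @ F) _ FC.
have Fst N : nbhs (p, q) N -> F (st @^-1` N).
  move=> nN; have [//|Fc] := in_ultra_setVsetC (st @^-1` N) UF.
  by have [y [ny /ny]] := clpq (~` N) N Fc nN.
have Fp P : nbhs p P -> F (asrc @^-1` P).
  move=> nP; have : F (st @^-1` (P `*` setT)).
    by apply: Fst; exists (P, setT) => //=; split=> //; exact: filterT.
  by apply: filterS => g [].
have Fq P : nbhs q P -> F (atgt @^-1` P).
  move=> nP; have : F (st @^-1` (setT `*` P)).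
    by apply: Fst; exists (setT, P) => //=; split=> //; exact: filterT.
  by apply: filterS => g [].
(* Source and target of an arrow lie over the same point of X; as X is Hausdorff, the same holds for
   their limits. *)
have pq : obj_pi p = obj_pi q.
  apply: hX => P Q /nbhs_interior nP /nbhs_interior nQ.
  have FP := Fp _ (open_nbhs_nbhs (conj (obj_pi_preimage_open (open_interior P))
    (nbhs_singleton nP))).
  have FQ := Fq _ (open_nbhs_nbhs (conj (obj_pi_preimage_open (open_interior Q))
    (nbhs_singleton nQ))).
  have [g [/= /interior_subset Pg /interior_subset Qg]] := filter_ex (filterI FP FQ).
  by exists (obj_pi (a_src g)); split=> //; rewrite arr_pi.
have [d [l1 [l2 [z [ep eq]]]]] := dominate_obj pq.
have [U [oU Uz iU]] := etale_inj_near z (leg_etale l1).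
have n1 : nbhs p (leg_pt l1 @` U).
  apply: open_nbhs_nbhs; split; last by exists z.
  exact: etale_open (leg_etale l1) oU.
have n2 : nbhs q (range (leg_pt l2)).
  apply: open_nbhs_nbhs; split; last by exists z.
  exact: etale_open (leg_etale l2) openT.
(* Near [(p, q)] the arrows fall into finitely many families, one for each element of the group of
   the target chart; the ultrafilter picks one. *)
have [h Fh] : exists h : ac_H (at_chart (projT1 l2 : A)), F [set g |
    exists2 f : cc_hom d (projT1 l2 : A),
      (exists2 k, at_iota k = h & f = cc_comp k (projT2 l2)) &
      exists2 z1, U z1 & g = phi l1 (mk_leg f) z1].
  apply: ultra_finite_union; apply: filterS2 (Fp _ n1) (Fq _ n2).
  move=> g /= [z1 Uz1 gs] [z2 _ gt].
  have [f gE] := arr_near_cases (esym gs) (esym gt).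
  have [k [ek _]] := cc_torsor (projT2 l2) f.
  by exists (at_iota k) => //=; exists f; [exists k|exists z1].
have [k ek] := iota_surj h.
pose f := cc_comp k (projT2 l2).
have {}Fh : F [set g | exists2 z1, U z1 & g = phi l1 (mk_leg f) z1].
  apply: filterS Fh => g [f' [k' ek' ->] hg].
  by move: hg; rewrite (bij_inj (at_iota_bij _) (etrans ek' (esym ek))).
pose g0 : arrow_space := phi l1 (mk_leg f) z.
have cv : F --> g0.
  move=> N /= nN.
  have nW : nbhs z (phi l1 (mk_leg f) @^-1` N `&` U).
    apply: filterI; last exact: open_nbhs_nbhs.
    exact: (@phi_continuous _ _ _ A d l1 (mk_leg f) z).
  have Fl := Fp _ (open_nbhs_nbhs (conj (etale_open (leg_etale l1) (open_interior _))
    (ex_intro2 _ _ z (nbhs_singleton (nbhs_interior nW)) ep))).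
  apply: filterS2 Fh Fl => g [z1 Uz1 ->] /= [z2 /interior_subset [Nz2 Uz2]].
  by rewrite /a_src arr_srcE => /(iU _ _ Uz2 Uz1) <-.
exists g0; split=> //=.
have -> : a_src g0 = p by rewrite /a_src arr_srcE.
suff -> : a_tgt g0 = q by [].
apply: (@mhausdorff _ _ objects) => P Q nP nQ.
have FP := cv _ ((@a_tgt_morphism _ _ _ A).1 g0 P nP).
by have [g [/= Pg Qg]] := filter_ex (filterI FP (Fq _ nQ)); exists (a_tgt g).
Qed.

Lemma atlas_is_Sp_groupoid : is_Sp_groupoid (atlas_groupoid A).
Proof.
split; [exact: a_src_etale|exact: a_tgt_etale|].
exact: atlas_groupoid_proper.
Qed.
End Proper.

(** * A criterion for open embeddings *)

Section OpenEmbeddingIntro.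
Context (R : realType) (sp : geometry).
Implicit Types M N T : manifold R sp.
Local Notation iso x y := (fhom (fun m => m) x y).
Local Notation fh F f x y := (@fhom R sp F _ _ f x y).

(** The square determines the image under [p] of the first component, and [p] is fully faithful. *)
Lemma fp_ff_hom (X Y Z : fibcat R sp) (p : fibmor X Z) (q : fibmor Y Z) :
  fibred Z -> fully_faithful p ->
  forall M N (f : M -> N) (x : fp_ob p q M) (y : fp_ob p q N)
    (b : fhom f (fp2 x) (fp2 y)),
  exists h : fp_hom f x y, (sval h).2 = b /\ forall h', (sval h').2 = b -> h' = h.
Proof.
move=> fZ pf M N f x y b.
have [a0 e0] := @flift _ _ Z fZ _ _ _ f (fun n => n) _ _ _ (fp_iso y)
  (fcomp (fm_hom q b) (fp_iso x)) (fhom_morphism b).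
have [a ea] := ff_surj a0 pf.
have sq : (fcomp (fm_hom q b) (fp_iso x) : fh Z f _ _) = fcomp (fp_iso y) (fm_hom p a).
  by rewrite ea; exact: esym e0.
exists (exist _ (a, b) sq); split=> // -[[a' b'] sq'] /= eb.
move: sq'; rewrite /= eb => sq'; apply: fp_hom_eq => /=; congr pair.
apply: (ff_inj pf); apply: (@fcancel _ _ Z fZ _ _ _ f (fun n => n) _ _ _ (fp_iso y)).
by etransitivity; [exact: esym sq'|exact: sq].
Qed.

Lemma ff_representable (X Y : fibcat R sp) (p : fibmor X Y) : fibred Y ->
  fully_faithful p -> representable_morphism p.
Proof.
move=> fY pf T t _ M x a.
have [h [_ uh]] := fp_ff_hom (q := t) fY pf (f := fun m => m) (x := x) (y := x) (fid _).
rewrite (uh a); first by rewrite (uh (fid (f0 := fibre_product p t) x)).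
exact: (@Prop_irrelevance (_ /\ _)).
Qed.

Section Intro.
Variables (F Q : fibcat R sp) (p : fibmor F Q) (G : groupoid R sp).
Variables (eta : fibmor (prestack G) Q) (W : manifold R sp) (e : W -> g0 G).
Hypotheses (sF : is_stack F) (sQ : is_stack Q) (pf : fully_faithful p).
Hypotheses (pe : presentation eta) (oe : manifold_open_embedding e).
Local Notation pm := (presentation_map eta).

Definition emb_ob M (u : fob (yoneda W) M) : fob (yoneda (g0 G)) M :=
  exist _ (fun m => e (sval u m))
    (is_morphism_comp (open_embedding_morphism oe) (proj2_sig u)).

Hypothesis im : forall M (u : fob (yoneda W) M), loc_image p (pm M (emb_ob u)).
Hypothesis im_range : forall M (x : fob F M) (u : fob (yoneda (g0 G)) M),
  iso (p M x) (pm M u) -> forall m, range e (sval u m).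

Lemma emb_pick M (u : fob (yoneda W) M) :
  {x : fob F M & iso (p M x) (pm M (emb_ob u))}.
Proof.
have [x hx] := cid (loc_image_image pf sF sQ (im u)).
by exists x; exact: inhabited_witness hx.
Qed.

Definition emb_fp M (u : fob (yoneda W) M) : fob (fibre_product p pm) M :=
  FpOb (projT2 (emb_pick u)).

Lemma emb_hom M N (f : M -> N) (u : fob (yoneda W) M) (v : fob (yoneda W) N)
  (a : fhom f u v) : fhom f (emb_ob u) (emb_ob v).
Proof. by case: a => mf uv; split=> //=; rewrite uv. Qed.

Lemma emb_uniq M N (f : M -> N) (x : fob (fibre_product p pm) M)
    (y : fob (fibre_product p pm) N) (b : fhom f (fp2 x) (fp2 y)) :
  exists h : fhom f x y, forall h', h' = h.
Proof.
have [h [_ uh]] := fp_ff_hom (q := pm) sQ.1 pf b.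
by exists h => h'; apply: uh; exact: (@Prop_irrelevance (_ /\ _)).
Qed.

Lemma open_embedding_intro : open_embedding p.
Proof.
split; first exact: ff_representable sQ.1 pf.
(* Between the chosen objects there is exactly one arrow over a given one, so the trivial relation
   already defines a functor. *)
have rE M N (f : M -> N) (u : fob (yoneda W) M) (v : fob (yoneda W) N)
    (a : fhom f u v) : exists! b : fhom f (emb_fp u) (emb_fp v), True.
  have [h uh] := emb_uniq (x := emb_fp u) (y := emb_fp v) (emb_hom a).
  by exists h; split=> // h' _; rewrite (uh h').
pose E : fibmor (yoneda W) (fibre_product p pm) :=
  @mk_fibmor _ _ (yoneda W) (fibre_product p pm) emb_fp (fun M N f u v a b => True)
    rE (fun _ _ => I) (fun _ _ _ _ _ _ _ _ _ _ _ _ _ _ => I).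
exists G, eta; split; first exact: pe.
exists W, e, E; split; [exact: oe|split|by []].
  move=> M N f u v; apply: inj_surj_bij => [a b _|h].
    exact: (@Prop_irrelevance (_ /\ _)).
  have [mf /= euv] := (sval h).2.
  have uv : sval u = (fun m => sval v (f m)).
    by apply/funext => m; apply: oe.2; exact: (congr1 (@^~ m) euv).
  exists (conj mf uv); have [h0 uh] := emb_uniq (x := emb_fp u) (y := emb_fp v)
    (emb_hom (conj mf uv : fhom (f0 := yoneda W) f u v)).
  by rewrite [LHS](uh (fm_hom E _)) (uh h).
move=> M z; have [u mu eu] := open_embedding_lift oe (proj2_sig (fp2 z)) (im_range (fp_iso z)).
have b : fhom (f0 := yoneda (g0 G)) (fun m => m) (emb_ob (exist _ u mu)) (fp2 z).
  by split; [exact: is_morphism_id|exact/funext].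
have [h _] := emb_uniq (x := emb_fp (exist _ u mu)) (y := z) b.
by exists (exist _ u mu); constructor; exact: h.
Qed.
End Intro.
End OpenEmbeddingIntro.

(** * The orbifold of an atlas *)

Section ChartMap.
Context (R : realType) (sp : geometry) (X : topologicalType) (A : atlas R sp X).
Implicit Types M N T U : manifold R sp.
Local Notation iso x y := (fhom (fun m => m) x y).
Local Notation fh F f x y := (@fhom R sp F _ _ f x y).
Local Notation V a := (ac_V (at_chart a)).
Local Notation fm f := (em_V (at_map f)).
Local Notation objects := (objects A).
Local Notation arrow_space := (arrow_space A).
Local Notation G := (atlas_groupoid A).
Local Notation pt := (0%R : one_point R sp).

Definition iota_inv (a : A) (h : ac_H (at_chart a)) : cc_hom a a := projT1 (cid (iota_surj h)).

Lemma iota_invK (a : A) (h : ac_H (at_chart a)) : at_iota (iota_inv h) = h.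
Proof. by rewrite /iota_inv; case: cid. Qed.

Lemma iota_inj (a : A) : injective (@at_iota _ _ _ A a).
Proof. exact: bij_inj (at_iota_bij a). Qed.

Lemma iotaK (a : A) (k : cc_hom a a) : iota_inv (at_iota k) = k.
Proof. by apply: iota_inj; rewrite iota_invK. Qed.

Lemma iota_invM (a : A) (h h' : ac_H (at_chart a)) :
  iota_inv (h * h')%g = cc_comp (iota_inv h) (iota_inv h').
Proof. by apply: iota_inj; rewrite at_iotaM !iota_invK. Qed.

Lemma iota_inv1 (a : A) : iota_inv (1%g : ac_H (at_chart a)) = cc_id a.
Proof.
apply: iota_inj; rewrite iota_invK; apply: (@mulgI _ (at_iota (cc_id a))).
by rewrite mulg1 -at_iotaM cc_1comp.
Qed.

Lemma iota_inv_act (a : A) (h : ac_H (at_chart a)) v : fm (iota_inv h) v = ac_act h v.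
Proof. by rewrite at_iota_V iota_invK. Qed.

Lemma iota_inv_nat (a b : A) (f : cc_hom a b) (h : ac_H (at_chart a)) :
  cc_comp (iota_inv (em_H (at_map f) h)) f = cc_comp f (iota_inv h).
Proof.
have [k [ek _]] := cc_torsor f (cc_comp f (iota_inv h)).
rewrite -ek; congr cc_comp; apply: iota_inj.
by rewrite iota_invK (at_iota_nat ek) iota_invK.
Qed.

(** Objects over the image of chart [a] are locally isomorphic to objects of that chart. A span
    through some [d], found at the point [m], spreads to a neighbourhood because its second leg is
    locally invertible. *)
Lemma chart_reduction M (w : M -> objects) m (a : A) (v : V a) : is_morphism w ->
  oc_pi v = obj_pi (w m) -> exists T (e : T -> M) (h : T -> V a) (g : T -> arrow_space),
  [/\ manifold_open_embedding e, range e m, is_morphism h, is_morphism g &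
      forall x, a_src (g x) = obj (h x) /\ a_tgt (g x) = w (e x)].
Proof.
move=> mw; case e0 : (w m) => [b w0] ev0.
have [d [z [f [g [_ gz]]]]] := dominate (ev0 : oc_pi v = oc_pi (w0 : V (b : A))).
have lz : leg_pt (mk_leg g) z = w m by rewrite e0 -[RHS]/(obj w0) -gz.
have [U0 [oU0 Uz iU]] := etale_inj_near z (leg_etale (mk_leg g)).
have ov := opens_val_embedding oU0.
have oee : manifold_open_embedding (fun y : opens oU0 => leg_pt (mk_leg g) (opens_val y)).
  split; first exact: etale_comp (leg_etale _) ov.1.
  by move=> y y' /(iU _ _ (opens_valP y) (opens_valP y')) /ov.2.
have oD : open [set x | range (fun y : opens oU0 => leg_pt (mk_leg g) (opens_val y)) (w x)].
  apply: (open_comp (f := w)); first by move=> x _; exact: mw.1.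
  exact: etale_open oee.1 openT.
have oD' := opens_val_embedding oD.
have mD := open_embedding_morphism oD'.
have [s ms es] := open_embedding_lift oee (is_morphism_comp mw mD) (fun x => opens_valP x).
have mvs := is_morphism_comp (open_embedding_morphism ov) ms.
exists (opens oD), (@opens_val _ _ _ _ oD), (fun x => fm f (opens_val (s x))),
  (fun x => a_phi (mk_leg f) (mk_leg g) (opens_val (s x))); split=> //.
- rewrite opens_range; have [y _ ey] : range (@opens_val _ _ _ _ oU0) z by rewrite opens_range.
  by exists y => //; rewrite ey.
- exact: is_morphism_comp (etale_morphism (hom_etale f)) mvs.
- apply: is_morphism_comp mvs; exact: etale_morphism (a_phi_etale _ _).
- by move=> x; rewrite -es; split; [exact: arr_srcE|exact: arr_tgtE].
Qed.

Section OneChart.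
Variable a : A.
Local Notation c := (oc_chart (at_chart a)).

Definition chart_arr (x : action_arrows c) : arrow_space :=
  phi (id_leg a) (mk_leg (iota_inv (arrow_elt x))) (arrow_src x).

Lemma chart_arr_morphism : is_morphism chart_arr.
Proof.
apply/is_morphismP => x.
have n := arrow_elt_near (is_morphism_id (action_arrows c)) x.
have sS := proj1 (is_morphismP _) (@arrow_src_morphism _ _ c) x.
apply: (smooth_at_near _ (a_phi_smooth (id_leg a) (mk_leg (iota_inv (arrow_elt x))) sS)).
by apply: filterS n => y; rewrite /a_phi /chart_arr => ->.
Qed.

Definition chart_map : groupoid_map (action_groupoid c) G.
Proof.
refine (@GroupoidMap _ _ (action_groupoid c) G (@obj _ _ _ A a) chart_arr
  (open_embedding_morphism (obj_embedding a)) chart_arr_morphism _ _ _ _).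
- by move=> x; rewrite /= /a_src arr_srcE /leg_pt /= at_id_V.
- by move=> x; rewrite /= /a_tgt arr_tgtE /leg_pt /= iota_inv_act.
- by move=> v; rewrite /= /chart_arr /= iota_inv1.
- move=> [g w] [h v]; rewrite /= /arrow_tgt /= => ->.
  rewrite /chart_arr /= iota_invM -iota_inv_act /a_mul.
  have -> : phi (id_leg a) (mk_leg (iota_inv g)) (fm (iota_inv h) v) =
      phi (mk_leg (iota_inv h)) (mk_leg (cc_comp (iota_inv g) (iota_inv h))) v :> arrow_space.
    by rewrite -phi_comp /leg_comp /= cc_1comp.
  by rewrite arr_mulE.
Defined.

(** An arrow between two points of chart [a] is the span with legs the identity and a [k] in Aut(a).
    By [phi_inj2] this [k] is unique, and in a smooth family it is locally constant. *)
Lemma chart_map_ff : fully_faithful (prestack_map chart_map).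
Proof.
move=> M N f u v; apply: inj_surj_bij => [x y xy|b].
  apply: pre_hom_eq => m.
  have [_ _ sx _] := proj2_sig x; have [_ _ sy _] := proj2_sig y.
  have := congr1 (fun t => sval t m) xy.
  move: (sx m) (sy m); rewrite /= /chart_arr.
  case: (sval x m) => h v1; case: (sval y m) => h' v2.
  rewrite /arrow_src /arrow_elt /= => -> -> /phi_inj2/mk_leg_inj e.
  by congr existT; rewrite -(iota_invK h) e iota_invK.
have [mf mb sb tb] := proj2_sig b.
have sE m : a_src (sval b m) = leg_pt (id_leg a) (sval u m).
  by rewrite [LHS]sb /leg_pt /= at_id_V.
have tE m : a_tgt (sval b m) = leg_pt (id_leg a) (sval v (f m)).
  by rewrite [LHS]tb /leg_pt /= at_id_V.
pose k m := projT1 (cid (arr_near_cases (sE m) (tE m))).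
have kE m : sval b m = phi (id_leg a) (mk_leg (k m)) (sval u m).
  exact: projT2 (cid (arr_near_cases (sE m) (tE m))).
have kloc m0 : \forall m \near m0, at_iota (k m) = at_iota (k m0).
  have [s [_ _ hs]] := a_phi_lift (proj1 (is_morphismP _) mb m0) (kE m0).
  apply: filterS hs => m hm; have := sE m; rewrite hm /a_src arr_srcE.
  rewrite /leg_pt /= !at_id_V => /obj_inj su; rewrite su kE in hm.
  by rewrite (mk_leg_inj (phi_inj2 hm)).
have mu : is_morphism (fun m => action_arrow (c := c) (at_iota (k m)) (sval u m)).
  exact: action_arrow_morphism kloc (proj2_sig u).
unshelve eexists.
  exists (fun m => action_arrow (c := c) (at_iota (k m)) (sval u m)); split=> // m.
  apply: (@obj_inj _ _ _ A a); rewrite -[RHS](tb m) kE /= /a_tgt arr_tgtE.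
  by rewrite /arrow_tgt /= /leg_pt /= at_iota_V.
apply: pre_hom_eq => m; rewrite kE /= /chart_arr /arrow_elt /= iotaK //.
Qed.

Lemma pihat_exists (q : quotient_stack c) : exists r : fibmor q (stk G),
  isomorphic (fibcomp r (qs_eta q)) (fibcomp (stk_eta G) (prestack_map chart_map)).
Proof. exact: ((qs_assoc q).2 _ (stk_is_stack G)).1. Qed.

Definition pihat (q : quotient_stack c) : fibmor q (stk G) :=
  projT1 (cid (pihat_exists q)).

Lemma pihatP (q : quotient_stack c) : isomorphic (fibcomp (pihat q) (qs_eta q))
  (fibcomp (stk_eta G) (prestack_map chart_map)).
Proof. by rewrite /pihat; case: cid. Qed.

Lemma pihat_ff (q : quotient_stack c) : fully_faithful (pihat q).
Proof.
have [fq lq] := associated_dense (qs_assoc q); have sS := stk_is_stack G.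
apply: (ff_of_dense (@prestack_fibred _ _ _) (qs_assoc q).1 sS lq fq).
apply: (isomorphic_ff sS.1 (isomorphic_sym sS.1 (pihatP q))).
exact: ff_comp chart_map_ff (@stk_eta_ff _ _ G).
Qed.

Definition chart_image : set objects := [set p | range (oc_pi (o := at_chart a)) (obj_pi p)].

Lemma chart_image_open : open chart_image.
Proof. apply: obj_pi_preimage_open; exact: oc_open. Qed.

Lemma stk_presentation : hausdorff_space X -> presentation (stk_eta G).
Proof. by move=> hX; split; [exact: atlas_is_Sp_groupoid|exact: stk_associated]. Qed.

(** The base change is represented by the objects lying over the image of the chart. These can be
    moved into the chart locally, and conversely isomorphic objects have the same image in X. *)
Lemma pihat_open_embedding (hX : hausdorff_space X) (q : quotient_stack c) :
  open_embedding (pihat q).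
Proof.
have sS := stk_is_stack G; have sq := (qs_assoc q).1.
have [t] := pihatP q; have [ti] := isomorphic_sym sS.1 (pihatP q).
have oW : manifold_open_embedding (N := g0 G) (@opens_val _ _ _ _ chart_image_open).
  exact: opens_val_embedding.
apply: (open_embedding_intro (oe := oW) sq sS (@pihat_ff q) (stk_presentation hX)).
  move=> M u m.
  pose w m := opens_val (sval u m).
  have mw : is_morphism w.
    exact: is_morphism_comp (open_embedding_morphism (opens_val_embedding _)) (proj2_sig u).
  have [v0 _ ev0] : chart_image (w m) := opens_valP (sval u m).
  have [T [e [h [g [oe re mh mg eg]]]]] := chart_reduction mw ev0.
  pose w' : fob (prestack (action_groupoid c)) T := exist _ h mh.
  have arr : fh (prestack G) e (prestack_map chart_map _ w') (exist _ w mw).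
    by exists g; split=> // [|x|x]; [exact: open_embedding_morphism|apply eg..].
  exists T, e, (qs_eta q _ w'); split=> //.
  have ta := fcomp (fm_hom (stk_eta G) arr) (t _ w').
  rewrite (_ : presentation_map _ _ _ = stk_eta G M (exist _ w mw)); first exact: inhabits ta.
  by congr (stk_eta G M _); exact: eq_exist.
move=> M x u i m; rewrite opens_range.
have [_ lq] := associated_dense (qs_assoc q).
have [U [k [w [ok [n _ nm] [rho]]]]] := lq _ x m.
have arr := fcomp i (fcomp (fm_hom (pihat q) rho) (ti _ w)).
have [b _] := ff_surj (p := stk_eta G) (x := prestack_map chart_map _ w) (y := u)
  (arr : fh (stk G) k _ _) (@stk_eta_ff _ _ G).
have [_ _ sb tb] := proj2_sig b.
exists (sval w n) => //.
have := arr_pi (sval b n); have -> : a_src (sval b n) = obj (sval w n) by exact: sb.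
have -> : a_tgt (sval b n) = sval u m by rewrite -nm; exact: tb.
by [].
Qed.
End OneChart.

Lemma pihat_compat (a b : A) (f : cc_hom a b) (q : quotient_stack (at_chart a))
    (q' : quotient_stack (at_chart b)) (F : fibmor q q') :
  induced_map (at_map f) F -> isomorphic (fibcomp (pihat q') F) (pihat q).
Proof.
move=> ind; have sS := stk_is_stack G.
have [fq lq] := associated_dense (qs_assoc q).
apply: (dense_2cell_exists (@prestack_fibred _ _ _) (qs_assoc q).1 sS fq lq).
apply: isomorphic_trans (isomorphic_assoc _ _ _) _.
apply: isomorphic_trans (isomorphic_postcomp _ ind) _.
apply: isomorphic_trans (isomorphic_assocV _ _ _) _.
apply: isomorphic_trans (isomorphic_precomp _ (pihatP q')) _.
apply: isomorphic_trans (isomorphic_assoc _ _ _) _.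
apply: isomorphic_trans (isomorphic_sym sS.1 (pihatP q)).
apply: isomorphic_postcomp; constructor.
(* The span with legs [f] and the identity joins the image of a point in chart [b] to the point
   itself in chart [a]. *)
have sub T (u : fob (prestack (action_groupoid (at_chart a))) T) :
  [/\ is_morphism (fun x : T => x),
      is_morphism (fun x => a_phi (mk_leg f) (id_leg a) (sval u x)),
      forall x, a_src (a_phi (mk_leg f) (id_leg a) (sval u x)) = obj (fm f (sval u x)) &
      forall x, a_tgt (a_phi (mk_leg f) (id_leg a) (sval u x)) = obj (sval u x)].
  split; first exact: is_morphism_id.
  - apply: is_morphism_comp (proj2_sig u); exact: etale_morphism (a_phi_etale _ _).
  - by move=> x; rewrite /a_src arr_srcE.
  - by move=> x; rewrite /a_tgt arr_tgtE /leg_pt /= at_id_V.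
refine (@Fibtrans _ _ _ _ (fibcomp (prestack_map (chart_map b))
  (prestack_map (action_groupoid_map (at_map f)))) (prestack_map (chart_map a))
  (fun T u => exist _ _ (sub T u)) _).
move=> M N g u v al; apply: pre_hom_eq => m /=.
have [_ _ sal tal] := proj2_sig al.
have := tal m; have := sal m; rewrite /= /chart_arr /a_phi /a_mul.
case: (sval al m) => h v1; rewrite /arrow_src /arrow_tgt /arrow_elt /= => -> <-.
rewrite -!iota_inv_act -!phi_comp /leg_comp /= !cc_1comp arr_mulE.
by rewrite iota_inv_nat arr_mulE.
Qed.

Lemma one_point_eq (x y : one_point R sp) : x = y.
Proof. by apply/rowP => -[]. Qed.

(** Anchors in different indices are joined by a transition arrow, so their image in X does not
    depend on the chosen index. *)
Definition coarse (z : fob (stk G) (one_point R sp)) : X :=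
  obj_pi (cd_anchor (projT1 (cid (cd_cover (z : cocycle G _) pt))) pt : objects).

Lemma coarse_iso z z' : iso z z' -> coarse z = coarse z'.
Proof.
move=> p; rewrite /coarse; case: (cid _) => /= i hi; case: (cid _) => /= j hj.
have [g hg] := ch_ex (p : coc_hom _ _ _) hi hj.
by rewrite -(ch_src hg) -(ch_tgt hg); exact: (arr_pi (g : arrow_space)).
Qed.

Lemma coarse_eta (p : objects) : coarse (stk_eta G _ (gpoint (G := G) p)) = obj_pi p.
Proof. by rewrite /coarse; case: (cid _). Qed.

Lemma stk_point (z : fob (stk G) (one_point R sp)) : exists p : objects,
  inhabited (iso (stk_eta G _ (gpoint (G := G) p)) z).
Proof.
have [U [e [w [oe [n _ en] [c]]]]] := @stk_eta_les _ _ G _ z pt.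
exists (sval w n).
have arr : fh (prestack G) (fun _ : one_point R sp => n) (gpoint (G := G) (sval w n)) w.
  exists (fun _ => unt (sval w n : g0 G)); split; try exact: is_morphism_cst.
  - by move=> m; rewrite src_unt.
  - by move=> m; rewrite tgt_unt.
(* The composite lies over a constant map, which on a one-point manifold is the identity. *)
constructor; apply: (fcast (f := fun _ => e n)); last exact: (fcomp c (fm_hom (stk_eta G) arr)).
by apply/funext => m; exact: one_point_eq.
Qed.

Lemma coarse_eq z z' : coarse z = coarse z' -> inhabited (iso z z').
Proof.
move=> zz; have [p [al]] := stk_point z; have [p' [be]] := stk_point z'.
have pp : obj_pi p = obj_pi p'.
  by rewrite -!coarse_eta (coarse_iso al) (coarse_iso be).
have [d [l1 [l2 [z0 [e1 e2]]]]] := dominate_obj pp.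
have arr : fh (prestack G) (fun m => m) (gpoint (G := G) p) (gpoint (G := G) p').
  exists (fun _ => phi l1 l2 z0 : g1 G); split; [exact: is_morphism_id|exact: is_morphism_cst| |].
  - by move=> m; rewrite /= /a_src arr_srcE.
  - by move=> m; rewrite /= /a_tgt arr_tgtE.
have [ai _] := finv (stk_is_stack G).1 al.
constructor; exact: (fcomp be (fcomp (fm_hom (stk_eta G) arr) ai)).
Qed.

Lemma coarse_homeo : hausdorff_space X -> coarse_homeomorphism coarse.
Proof.
move=> hX; split.
- by move=> z z'; split=> [/coarse_eq //|[i]]; exact: coarse_iso.
- move=> x; have [a [v _ <-]] := at_cover A x.
  by exists (stk_eta G _ (gpoint (G := G) (obj v : objects))); rewrite coarse_eta.
exists G, (stk_eta G); split; first exact: stk_presentation.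
move=> U; have -> : [set p : g0 G | U (coarse (stk_eta G _ (gpoint (G := G) p)))] =
    @obj_pi _ _ _ A @^-1` U.
  by apply/seteqP; split=> p /=; rewrite coarse_eta.
split; first exact: obj_pi_preimage_open.
move=> /coprod_open oU.
(* Openness is checked on the image of each chart, where the quotient topology of V(a) is known. *)
have -> : U = \bigcup_(a : A) (U `&` range (oc_pi (o := at_chart a))).
  apply/seteqP; split=> [x Ux|x [a _ []] //].
  by have [a ra] := at_cover A x; exists a.
apply: bigcup_open => a _.
apply: (proj2 (oc_quotient (o := at_chart a) (@subIsetr _ U (range (oc_pi (o := at_chart a)))))).
rewrite (_ : _ @^-1` _ = [set v | U (oc_pi (v : V a))]); first exact: (oU a).
by apply/seteqP; split=> v /=; [case|move=> Uv; split=> //; exists v].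
Qed.

Lemma coarse_pihat (a : A) (q : quotient_stack (at_chart a)) v :
  coarse (pihat q (one_point R sp) (qs_point q v)) = oc_pi v.
Proof.
have [t] := pihatP q.
rewrite (coarse_iso (t _ (gpoint (G := action_groupoid (at_chart a)) v))).
exact: (coarse_eta (obj v)).
Qed.
End ChartMap.

(** * Change of atlas *)

Section QuasiInverse.
Context (R : realType) (sp : geometry).
Implicit Types (M N P T : manifold R sp) (F G : fibcat R sp).
Local Notation iso x y := (fhom (fun m => m) x y).
Local Notation fh F f x y := (@fhom R sp F _ _ f x y).

Lemma quasi_inverse F G (p : fibmor F G) : fibred G -> equivalence p ->
  exists p' : fibmor G F, equivalence p' /\
    forall M (z : fob G M), inhabited (iso (p M (p' M z)) z).
Proof.
move=> fG [pf ps].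
have pick M (z : fob G M) : {x : fob F M & iso (p M x) z}.
  by have [x hx] := cid (ps M z); exists x; exact: inhabited_witness hx.
pose o M (z : fob G M) := projT1 (pick M z).
pose k M (z : fob G M) : iso (p M (o M z)) z := projT2 (pick M z).
pose r M N (f : M -> N) z w (a : fh G f z w) (b : fh F f (o M z) (o N w)) :=
  (fcomp (k N w) (fm_hom p b) : fh G f _ _) = fcomp a (k M z).
have rE M N (f : M -> N) z w (a : fh G f z w) : exists! b, r M N f z w a b.
  have [b0 e0] := @flift _ _ G fG _ _ _ f (fun n => n) _ _ _ (k N w) (fcomp a (k M z))
    (fhom_morphism a).
  have [b eb] := ff_surj b0 pf.
  exists b; split=> [|b' rb']; first by rewrite /r eb; exact: e0.
  apply: (ff_inj pf); apply: (@fcancel _ _ G fG _ _ _ f (fun n => n) _ _ _ (k N w)).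
  by rewrite eb; etransitivity; [exact: e0|exact: esym rb'].
have r1 M (z : fob G M) : r M M (fun m => m) z z (fid z) (fid (o M z)).
  rewrite /r fm_id; etransitivity; first exact: (fcomp1 (k M z)).
  exact: esym (f1comp (k M z)).
have rM M N P (f : M -> N) (g : N -> P) x y z (a : fh G f x y) (b : fh G g y z) a' b' :
    r _ _ _ _ _ a a' -> r _ _ _ _ _ b b' -> r _ _ _ _ _ (fcomp b a) (fcomp b' a').
  rewrite /r => ea eb; rewrite fm_comp.
  etransitivity; first exact: (fcompA (fm_hom p a') (fm_hom p b') (k P z)).
  etransitivity; first exact: (congr1 (fun t => fcomp t (fm_hom p a')) eb).
  etransitivity; first exact: esym (fcompA (fm_hom p a') (k N y) b).
  etransitivity; first exact: (congr1 (fcomp b) ea).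
  exact: (fcompA (k M x) a b).
pose p' := mk_fibmor rE r1 rM.
exists p'; split; last by move=> M z; constructor; exact: (k M z).
split=> [M N f z w|M x].
  apply: inj_surj_bij => [a a' aa|b].
    have h := mk_fibmorP rE r1 rM a; have h' := mk_fibmorP rE r1 rM a'.
    apply: (fcancelr fG (t := k M z)).
    by etransitivity; [exact: esym h|rewrite aa; exact: h'].
  have [a ea] := fliftr fG (k M z) (fcomp (k N w) (fm_hom p b) : fh G f _ _).
  exists a; have [c [_ u]] := rE M N f z w a.
  rewrite -(u _ (mk_fibmorP rE r1 rM a)); apply: u; exact: esym ea.
have [b eb] := ff_surj (p := p) (x := o M (p M x)) (y := x) (k M (p M x)) pf.
by exists (p M x); constructor; exact: b.
Qed.
End QuasiInverse.

Section AtlasMorphism.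
Context (R : realType) (sp : geometry) (X : topologicalType) (A B : atlas R sp X).
Variable m : atlas_morphism A B.
Implicit Types (M N P T : manifold R sp) (F G : fibcat R sp).
Local Notation iso x y := (fhom (fun m => m) x y).
Local Notation fh F f x y := (@fhom R sp F _ _ f x y).
Local Notation V a := (ac_V (at_chart a)).
Local Notation im a := (em_V (am_iso m a)).

Definition am_leg (d : A) (l : leg d) : leg (am_ob m d) := mk_leg (am_hom m (projT2 l)).

Definition am_pt (p : objects A) : objects B := obj (im (projT1 p) (projT2 p)).

Lemma am_leg_pt (d : A) (l : leg d) z : leg_pt (am_leg l) (im d z) = am_pt (leg_pt l z).
Proof. by rewrite /leg_pt /= -am_nat_V. Qed.

Lemma am_leg_comp (e d : A) (l : leg d) (k : cc_hom e d) :
  am_leg (leg_comp l k) = leg_comp (am_leg l) (am_hom m k).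
Proof. by rewrite /am_leg /= am_comp. Qed.

Lemma am_pt_pi p : obj_pi (am_pt p) = obj_pi p.
Proof. exact: am_iso_pi. Qed.

Definition am_arr (g : arrow_space A) : arrow_space B :=
  let s := projT1 (cid (proj2_sig g)) in
  phi (am_leg (sp_l1 s)) (am_leg (sp_l2 s)) (im (sp_d s) (sp_z s)).

Lemma am_arrE (d : A) (l1 l2 : leg d) z :
  am_arr (phi l1 l2 z) = phi (am_leg l1) (am_leg l2) (im d z).
Proof.
rewrite /am_arr; case: (cid _) => -[d' l1' l2' z'] /= es.
have : span_rel (Span l1 l2 z) (Span l1' l2' z') by rewrite es; exact: span_refl.
move=> [e [y [k [k' [/= <- <- h1 h2]]]]].
by rewrite !am_nat_V -!phi_comp -!am_leg_comp h1 h2.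
Qed.

Lemma am_pt_etale : etale am_pt.
Proof.
have iE a : etale (fun v : V a => am_pt (obj v)).
  apply: (@etale_comp _ _ _ _ _ (im a) (@obj _ _ _ B (am_ob m a))).
    exact: (obj_embedding _).1.
  exact: chart_etale (am_iso_chart m a).
have mo a := open_embedding_morphism (@obj_embedding _ _ _ A a).
apply/etaleP; split; first by apply: coprod_morphism => a; exact: etale_morphism (iE a).
move=> [a v]; have [r [rv sr rK pK]] := etale_loc_inv v (iE a).
exists (fun q => obj (r q)); split=> //; first by rewrite [r _]rv.
  apply: smooth_at_comp sr _; exact: (proj1 (is_morphismP _) (mo a)).
have oP := open_interior [set y | r (am_pt (obj y)) = y].
have : nbhs (obj v) (@obj _ _ _ A a @` interior [set y | r (am_pt (obj y)) = y]).
  apply: open_nbhs_nbhs; split; first exact: etale_open (obj_embedding a).1 oP.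
  by exists v => //; exact: nbhs_singleton (nbhs_interior rK).
by apply: filterS => _ [y /interior_subset /= ey <-]; rewrite ey.
Qed.

Lemma am_arr_morphism : is_morphism am_arr.
Proof.
apply: a_local => d l1 l2.
rewrite (_ : (fun z => _) = fun z => a_phi (am_leg l1) (am_leg l2) (im d z)).
  apply: is_morphism_comp (em_V_morphism _); exact: etale_morphism (a_phi_etale _ _).
by apply/funext => z; exact: am_arrE.
Qed.

Definition am_map : groupoid_map (atlas_groupoid A) (atlas_groupoid B).
Proof.
refine (@GroupoidMap _ _ (atlas_groupoid A) (atlas_groupoid B) am_pt am_arr
  (etale_morphism am_pt_etale) am_arr_morphism _ _ _ _).
- move=> g; have [d [l1 [l2 [z ->]]]] := phi_surj g.
  by rewrite /= am_arrE /a_src !arr_srcE am_leg_pt.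
- move=> g; have [d [l1 [l2 [z ->]]]] := phi_surj g.
  by rewrite /= am_arrE /a_tgt !arr_tgtE am_leg_pt.
- move=> [a v]; rewrite /= /a_unt /arr_unt /= am_arrE.
  by rewrite /am_leg /= am_id.
- move=> g h /arr_split [e [y [n1 [n2 [n3 [-> ->]]]]]].
  by rewrite /= /a_mul arr_mulE !am_arrE arr_mulE.
Defined.

Lemma am_arr_inj (g g' : arrow_space A) : a_src g = a_src g' -> a_tgt g = a_tgt g' ->
  am_arr g = am_arr g' -> g = g'.
Proof.
move=> es et; have [d [l1 [l2 [z [e1 e2]]]]] := dominate_obj (arr_pi g).
have [f -> _] := arr_normal (esym e1) (esym e2).
have [f' -> _] := arr_normal (etrans (esym es) (esym e1)) (etrans (esym et) (esym e2)).
by rewrite !am_arrE => /phi_inj2/mk_leg_inj /= e; rewrite (bij_inj (am_ff m _ _) e).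
Qed.

(** Both ends lie under one chart [d] of the first atlas, and by [arr_normal] the image of [d]
    carries [b]. Fullness of the functor between the chart categories brings the second leg back. *)
Lemma am_arr_surj p q (b : arrow_space B) : a_src b = am_pt p -> a_tgt b = am_pt q ->
  exists g, [/\ a_src g = p, a_tgt g = q & am_arr g = b].
Proof.
move=> bp bq; have pq : obj_pi p = obj_pi q by rewrite -!am_pt_pi -bp -bq arr_pi.
have [d [l1 [l2 [z [e1 e2]]]]] := dominate_obj pq.
have [||f' bE fz] := @arr_normal _ _ _ _ _ (am_leg l1) (am_leg l2) (im d z) b.
- by rewrite am_leg_pt e1.
- by rewrite am_leg_pt e2.
have [h _ hK] := am_ff m d (projT1 l2 : A).
have fE : mk_leg f' = am_leg (mk_leg (h f')) by rewrite /am_leg /= hK.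
exists (phi l1 (mk_leg (h f')) z); split.
- by rewrite /a_src arr_srcE.
- rewrite /a_tgt arr_tgtE -e2; move: fz; rewrite fE !am_leg_pt.
  move=> /obj_inj /(can_inj (@am_isoK_V _ _ _ _ _ m _)) e3.
  exact: (congr1 (@obj _ _ _ A (projT1 l2)) e3).
by rewrite am_arrE -fE.
Qed.

Lemma am_map_ff : fully_faithful (prestack_map am_map).
Proof.
move=> M N f u v; apply: inj_surj_bij => [x y xy|b].
  apply: pre_hom_eq => t.
  have [_ _ sx tx] := proj2_sig x; have [_ _ sy ty] := proj2_sig y.
  apply: am_arr_inj; first exact: etrans (sx t) (esym (sy t)).
    exact: etrans (tx t) (esym (ty t)).
  exact: (congr1 (fun h => sval h t) xy).
have [mf mb sb tb] := proj2_sig b.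
pose G t := cid (am_arr_surj (sb t) (tb t)).
pose g t := projT1 (G t).
have gP t : [/\ a_src (g t) = sval u t, a_tgt (g t) = sval v (f t) & am_arr (g t) = sval b t].
  exact: projT2 (G t).
(* [g] is chosen pointwise. Near [t0] it has the same image as the smooth family [phi l1 l2 (s' t)];
   the ends also agree, since [am_pt] is locally injective, so the two are equal by [am_arr_inj]. *)
have mg : is_morphism g.
  apply/is_morphismP => t0; have [gs gt gb] := gP t0.
  have [d [l1 [l2 [z gE]]]] := phi_surj (g t0).
  have bE : sval b t0 = phi (am_leg l1) (am_leg l2) (im d z) by rewrite -gb gE am_arrE.
  have [s [s0 ss bs]] := a_phi_lift (proj1 (is_morphismP _) mb t0) bE.
  pose s' t := em_V (am_inv m d) (s t).
  have s'0 : s' t0 = z by rewrite /s' s0 am_isoK_V.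
  have ss' : smooth_at s' t0.
    apply: smooth_at_comp ss _; exact: (proj1 (is_morphismP _) (em_V_morphism (am_inv m d))).
  have su : smooth_at (sval u) t0 := proj1 (is_morphismP _) (proj2_sig u) t0.
  have sv : smooth_at (fun t => sval v (f t)) t0.
    exact: (proj1 (is_morphismP _) (is_morphism_comp (proj2_sig v) mf) t0).
  have inj_near (w : M -> objects A) (l : leg d) : smooth_at w t0 -> w t0 = leg_pt l z ->
      \forall t \near t0, am_pt (w t) = am_pt (leg_pt l (s' t)) -> w t = leg_pt l (s' t).
    move=> sw wl; have [U [oU Uw iU]] := etale_inj_near (w t0) am_pt_etale.
    have nU := open_nbhs_nbhs (conj oU Uw).
    have n1 : \forall t \near t0, U (w t) by exact: near_continuous sw.1 nU.
    have n2 : \forall t \near t0, U (leg_pt l (s' t)).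
      have := near_continuous (P := U) (leg_smooth l ss').1; apply.
      by rewrite s'0 -wl.
    by apply: filterS2 n1 n2 => t; exact: iU.
  apply: (@smooth_at_near _ _ _ _ (fun t => a_phi l1 l2 (s' t))); last exact: a_phi_smooth.
  have := inj_near _ l1 su; have := inj_near _ l2 sv.
  rewrite -gs -gt gE /a_src /a_tgt arr_srcE arr_tgtE => /(_ erefl) n2 /(_ erefl) n1.
  near=> t; have [gst gtt gbt] := gP t.
  have bt : sval b t = phi (am_leg l1) (am_leg l2) (s t) by near: t.
  have bt' : am_arr (a_phi l1 l2 (s' t)) = sval b t.
    by rewrite bt [LHS]am_arrE /s' am_invK_V.
  have u1 : am_pt (sval u t) = am_pt (leg_pt l1 (s' t)).
    by rewrite -[LHS](sb t) bt [LHS]arr_srcE -am_leg_pt /s' am_invK_V.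
  have u2 : am_pt (sval v (f t)) = am_pt (leg_pt l2 (s' t)).
    by rewrite -[LHS](tb t) bt [LHS]arr_tgtE -am_leg_pt /s' am_invK_V.
  have e1 : sval u t = leg_pt l1 (s' t) by move: u1; near: t.
  have e2 : sval v (f t) = leg_pt l2 (s' t) by move: u2; near: t.
  apply: am_arr_inj; last by rewrite bt' gbt.
    by rewrite gst e1 /a_src arr_srcE.
  by rewrite gtt e2 /a_tgt arr_tgtE.
have gs t : a_src (g t) = sval u t by have [] := gP t.
have gt t : a_tgt (g t) = sval v (f t) by have [] := gP t.
exists (exist _ g (And4 mf mg gs gt)); apply: pre_hom_eq => t.
by have [] := gP t.
Unshelve. all: by end_near. Qed.

Local Notation GA := (atlas_groupoid A).
Local Notation GB := (atlas_groupoid B).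

Lemma am_stack_equivalence : exists E : fibmor (stk GA) (stk GB),
  equivalence E /\ forall x, coarse (E (one_point R sp) x) = coarse x.
Proof.
have [sA sB] := (stk_is_stack GA, stk_is_stack GB).
have [E [t]] := ((stk_associated GA).2 _ sB).1 (fibcomp (stk_eta GB) (prestack_map am_map)).
have Eff : fully_faithful E.
  apply: (ff_of_dense (@prestack_fibred _ _ _) sA sB (@stk_eta_les _ _ GA) (@stk_eta_ff _ _ GA)).
  apply: (isomorphic_ff sB.1 (isomorphic_sym sB.1 (inhabits t))).
  exact: ff_comp am_map_ff (@stk_eta_ff _ _ GB).
exists E; split; first split=> // M z.
  apply: (loc_image_image Eff sA sB) => p.
  have [U [e [w [oe [n _ en] [c]]]]] := @stk_eta_les _ _ GB _ z p.
  (* The charts of the smaller atlas already cover X, so every object of the larger groupoid can be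
     moved locally into one of them. *)
  have [a [v _ ev]] := at_cover A (obj_pi (sval w n : objects B)).
  have [|T [k [h [g [ok [n' _ en'] mh mg eg]]]]] :=
    @chart_reduction _ _ _ B _ (sval w) n _ (im a v) (proj2_sig w).
    by rewrite am_iso_pi.
  have mu : is_morphism (fun x => obj (em_V (am_inv m a) (h x)) : objects A).
    apply: is_morphism_comp; first exact: open_embedding_morphism (obj_embedding a).
    exact: is_morphism_comp (em_V_morphism _) mh.
  pose u : fob (prestack GA) T := exist _ _ mu.
  have arr : fh (prestack GB) k (prestack_map am_map T u) w.
    exists g; split=> // [|x|x]; first exact: open_embedding_morphism.
      by rewrite [LHS](eg x).1 /= /am_pt /= am_invK_V.
    exact: (eg x).2.
  exists T, (fun x => e (k x)), (stk_eta GA T u); split.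
  - exact: open_embedding_comp.
  - by exists n' => //; rewrite en' en.
  - constructor; exact: (fcomp (fcomp c (fm_hom (stk_eta GB) arr)) (t T u)).
move=> x; have [p [al]] := stk_point x.
rewrite -(coarse_iso al) -(coarse_iso (fm_hom E al)) coarse_eta.
by rewrite (coarse_iso (t _ (gpoint (G := GA) p))) [LHS](coarse_eta (am_pt p)) am_pt_pi.
Qed.
End AtlasMorphism.

Lemma atlas_equivalent_stacks (R : realType) (sp : geometry) (X : topologicalType)
    (A B : atlas R sp X) : atlas_equivalent A B ->
  exists E : fibmor (stk (atlas_groupoid A)) (stk (atlas_groupoid B)),
    equivalence E /\ forall x, coarse (E (one_point R sp) x) = coarse x.
Proof.
elim=> {A B} [A B [m]|A|A B _ [E [eE cE]]|A B C _ [E [eE cE]] _ [E' [eE' cE']]].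
- exact: am_stack_equivalence m.
- exists (fibid _); split=> //; split=> [|M z]; first exact: ff_id.
  by exists z; constructor; exact: fid.
- have [E' [eE' h]] := quasi_inverse (stk_is_stack _).1 eE.
  exists E'; split=> // x; have [i] := h _ x.
  by rewrite -cE (coarse_iso i).
exists (fibcomp E' E); split=> [|x]; last by rewrite /= cE' cE.
split=> [|M z]; first exact: ff_comp eE.1 eE'.1.
have [y [b]] := eE'.2 M z; have [x [a]] := eE.2 M y.
by exists x; constructor; exact: (fcomp b (fm_hom E' a)).
Qed.

(** The first conjunct keeps the quantification over quotient stacks from being vacuous. Naturality
    appears as compatibility with the arrows of the atlas and as invariance, over the coarse space,
    under equivalence of atlases. *)
Theorem theorem3p2p1 (R : realType) (sp : geometry) :
  (forall c : achart R sp, inhabited (quotient_stack c)) /\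
  exists (Q : satake_orbifold R sp -> fibcat R sp)
    (pihat : forall (X : satake_orbifold R sp) (a : so_atlas X)
       (q : quotient_stack (at_chart a)), fibmor q (Q X))
    (coarse : forall X : satake_orbifold R sp, fob (Q X) (one_point R sp) -> X),
  (forall X : satake_orbifold R sp,
    [/\ is_orbifold (Q X),
        forall (a : so_atlas X) (q : quotient_stack (at_chart a)),
          open_embedding (pihat X a q),
        coarse_homeomorphism (@coarse X),
        forall (a : so_atlas X) (q : quotient_stack (at_chart a))
          (v : ac_V (at_chart a)),
          coarse X (pihat X a q (one_point R sp) (qs_point q v)) = oc_pi v &
        forall (a b : so_atlas X) (f : cc_hom a b)
          (q : quotient_stack (at_chart a)) (q' : quotient_stack (at_chart b))
          (F : fibmor q q'), induced_map (at_map f) F ->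
          isomorphic (fibcomp (pihat X b q') F) (pihat X a q)]) /\
  (forall (X : topologicalType) (hX : hausdorff_space X) (A B : atlas R sp X),
    atlas_equivalent A B ->
    exists E : fibmor (Q (SatakeOrbifold hX A)) (Q (SatakeOrbifold hX B)),
      equivalence E /\
      forall x : fob (Q (SatakeOrbifold hX A)) (one_point R sp),
        coarse (SatakeOrbifold hX B) (E (one_point R sp) x) =
        coarse (SatakeOrbifold hX A) x).
Proof.
split=> [c|]; first by constructor; exact: QuotientStack (stk_associated (action_groupoid c)).
exists (fun X : satake_orbifold R sp => stk (atlas_groupoid (so_atlas X))), (fun X a q => pihat q),
  (fun X : satake_orbifold R sp => @coarse R sp X (so_atlas X)).
split=> [X|X hX A B]; last exact: atlas_equivalent_stacks.
have hX := so_hausdorff (s := X); split=> [|a q||a q v|a b f q q' F].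
- exists (atlas_groupoid (so_atlas X)), (stk_eta _); exact: stk_presentation hX.
- exact: pihat_open_embedding hX q.
- exact: coarse_homeo hX.
- exact: coarse_pihat.
- exact: pihat_compat.
Qed.
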